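(* Let $d\ge 2$ be an integer and let $p\in(1,\infty)$. (a) Suppose $d=2$. For every nonconstant function $\Phi\in C^{\infty}(\mathbb{R}^2\setminus\{0\},\mathbb{R})$ that is homogeneous of degree $0$, there exists a constant $c_{d,p,\Phi}>0$, independent of $t$, such that for all $t\in\mathbb{R}$ $$\lVert T_{\Phi}^{t}\rVert_{L^p\to L^p}\ \ge\ c_{d,p,\Phi}\,\langle t\rangle^{2\left|\frac12-\frac1p\right|}.$$ (b) Suppose $d\ge 3$. There is a dense open set $\mathcal{G}$ in the Whitney topology on $C^{\infty}(S^{d-1},\mathbb{R})$ such that for every $\phi\in\mathcal{G}$ there exists a constant $c_{d,p,\phi}>0$, independent of $t$, for which the $0$-homogeneous extension $\Phi\in C^{\infty}(\mathbb{R}^d\setminus\{0\},\mathbb{R})$ of $\phi$, defined by $\Phi(\xi):=\phi\left(\frac{\xi}{|\xi|}\right)$, satisfies for all $t\in\mathbb{R}$ $$\lVert T_{\Phi}^{t}\rVert_{L^p\to L^p}\ \ge\ c_{d,p,\phi}\,\langle t\rangle^{d\left|\frac12-\frac1p\right|}.$$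
   Context: $|\cdot|$ is the Euclidean norm, $S^{d-1}$ is the unit sphere centered at $0$ in $\mathbb{R}^d$, and $\langle t\rangle:=(1+|t|^2)^{1/2}$. A function $\Phi$ on $\mathbb{R}^d\setminus\{0\}$ is homogeneous of degree $0$ if $\Phi(\lambda\xi)=\Phi(\xi)$ for all $\lambda>0$ and $\xi\ne0$. The Fourier transform is normalized as $\widehat f(\xi):=\frac{1}{(2\pi)^d}\int_{\mathbb{R}^d}f(x)e^{-i\xi\cdot x}\,dx$. For $\Phi\in C^\infty(\mathbb{R}^d\setminus\{0\},\mathbb{R})$ homogeneous of degree $0$ and $t\in\mathbb{R}$, the Fourier multiplier operator $T_\Phi^t$ is defined on Schwartz functions $f\in\mathcal{S}(\mathbb{R}^d)$ by $$T_\Phi^t f(x):=\int_{\mathbb{R}^d}e^{it\Phi(\xi)+i\xi\cdot x}\,\widehat f(\xi)\,d\xi .$$ By Calderón–Zygmund theory it extends to a bounded operator on $L^p(\mathbb{R}^d)$ for every $p\in(1,\infty)$, and $\lVert T_\Phi^t\rVert_{L^p\to L^p}$ denotes its operator norm on $L^p(\mathbb{R}^d)$ (equivalently, the supremum of $\lVert T_\Phi^tf\rVert_{L^p}/\lVert f\rVert_{L^p}$ over nonzero Schwartz $f$). The Whitney topology on $C^\infty(S^{d-1},\mathbb{R})$ is the one in Hirsch, Differential Topology, §II.1; since $S^{d-1}$ is compact, it is the usual $C^\infty$ topology of uniform convergence of all derivatives (in local charts). *)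

(* Defs.v *)
From HB Require Import structures.
From mathcomp Require Import all_boot all_order all_algebra.
From mathcomp Require Import all_classical all_reals all_analysis.
From mathcomp Require Import complex.

Set Implicit Arguments.
Unset Strict Implicit.
Unset Printing Implicit Defensive.

Import Order.TTheory GRing.Theory Num.Theory.
Import numFieldNormedType.Exports.
Local Open Scope classical_set_scope.
Local Open Scope ring_scope.
Local Open Scope complex_scope.

Definition dotp (R : realType) (n : nat) (x y : 'rV[R]_n) : R :=
  \sum_(i < n) x 0 i * y 0 i.

(* The library norm [`|x|] on row vectors is the maximum norm. *)
Definition enorm (R : realType) (n : nat) (x : 'rV[R]_n) : R :=
  Num.sqrt (dotp x x).

Definition jbracket (R : realType) (t : R) : R := Num.sqrt (1 + `|t| ^+ 2).

Fixpoint pderivs (R : realType) (n : nat) (s : seq 'I_n)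
    (f : 'rV[R]_n -> R) : 'rV[R]_n -> R :=
  if s is i :: s' then 'D_(delta_mx 0 i) (pderivs s' f) else f.

(* Meant for open [U]: the derivatives at a point of [U] then depend only on
   the restriction of [f] to [U]. *)
Definition smooth_on (R : realType) (n : nat) (U : set 'rV[R]_n)
    (f : 'rV[R]_n -> R) : Prop :=
  forall (s : seq 'I_n) (x : 'rV[R]_n), U x ->
    {for x, continuous (pderivs s f)} /\
    forall i : 'I_n, derivable (pderivs s f) x (delta_mx 0 i).

(* The Borel sigma-algebra of R^n, generated by the coordinates. *)
Definition rV_display : measure_display. Proof. exact: default_measure_display. Qed.

Section rV_measurable.
Context (R : realType) (n : nat).

Definition rV_coord (i : 'I_n) (x : 'rV[R]_n) : measurableTypeR R := x 0 i.

Let rV_measurable0 : g_sigma_preimage rV_coord set0.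
Proof. exact: sigma_algebra0. Qed.

Let rV_measurableC A : g_sigma_preimage rV_coord A ->
  g_sigma_preimage rV_coord (~` A).
Proof. exact: sigma_algebraC. Qed.

Let rV_measurable_bigcup (F : (set 'rV[R]_n)^nat) :
  (forall i, g_sigma_preimage rV_coord (F i)) ->
  g_sigma_preimage rV_coord (\bigcup_i (F i)).
Proof. exact: sigma_algebra_bigcup. Qed.

HB.instance Definition _ := @isMeasurable.Build rV_display 'rV[R]_n
  (g_sigma_preimage rV_coord) rV_measurable0 rV_measurableC
  rV_measurable_bigcup.

End rV_measurable.

Section rV_cons.
Context (R : realType) (n : nat).

Definition rV_cons (z : measurableTypeR R * 'rV[R]_n) : 'rV[R]_n.+1 :=
  \row_i (if unlift ord0 i is Some j then z.2 0 j else z.1).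

Definition rV_uncons (x : 'rV[R]_n.+1) : measurableTypeR R * 'rV[R]_n :=
  (x 0 ord0, \row_j x 0 (lift ord0 j)).

Lemma rV_consK : cancel rV_cons rV_uncons.
Proof.
move=> [a v]; rewrite /rV_uncons mxE unlift_none; congr pair.
by apply/rowP => j; rewrite !mxE liftK.
Qed.

End rV_cons.

Lemma measurable_rV_coord (R : realType) (n : nat) (i : 'I_n) :
  measurable_fun [set: 'rV[R]_n] (@rV_coord R n i).
Proof.
move=> _ Y mY; rewrite setTI; apply: sub_sigma_algebra => /=.
rewrite -bigcup_seq/=; exists i => /=; first by rewrite mem_index_enum.
by exists Y => //; rewrite setTI.
Qed.

Lemma measurable_fun_rV (R : realType) (n : nat) (d : measure_display)
    (T : measurableType d) (f : T -> 'rV[R]_n) :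
  (forall i, measurable_fun [set: T] (@rV_coord R n i \o f)) ->
  measurable_fun [set: T] f.
Proof.
move=> mf _ A mA; rewrite setTI.
suff /(_ (f @^-1` A)) : g_sigma_preimage (fun i => @rV_coord R n i \o f)
    `<=` measurable.
  by apply; rewrite g_sigma_preimage_comp; exists A => //; rewrite setTI.
apply: smallest_sub; first exact: sigma_algebra_measurable.
rewrite -bigcup_seq; apply: bigcup_sub => i _ B [C mC <-].
exact: mf.
Qed.

Lemma measurable_rV_cons (R : realType) (n : nat) :
  measurable_fun [set: measurableTypeR R * 'rV[R]_n] (@rV_cons R n).
Proof.
apply: measurable_fun_rV => i.
have [j ->|->] := unliftP ord0 i.
  rewrite (_ : _ \o _ = @rV_coord R n j \o snd); last first.
    by apply/funext => z; rewrite /= /rV_coord /rV_cons mxE liftK.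
  exact: measurableT_comp (measurable_rV_coord j) measurable_snd.
rewrite (_ : _ \o _ = fst)//; apply/funext => z.
by rewrite /= /rV_coord /rV_cons mxE unlift_none.
Qed.

HB.instance Definition _ (R : realType) (n : nat) :=
  isMeasurableFun.Build _ _ _ _ (@rV_cons R n) (@measurable_rV_cons R n).

Lemma measurable_rV_uncons (R : realType) (n : nat) :
  measurable_fun [set: 'rV[R]_n.+1] (@rV_uncons R n).
Proof.
apply/measurable_fun_pairP; split; first exact: measurable_rV_coord ord0.
apply: measurable_fun_rV => i.
rewrite (_ : _ \o _ = @rV_coord R n.+1 (lift ord0 i)).
  exact: measurable_rV_coord.
by apply/funext => x; rewrite /= /rV_coord mxE.
Qed.

Section lebesgue_rV_step.
Context (R : realType) (n : nat).
Variable mu : {sigma_finite_measure set 'rV[R]_n -> \bar R}.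

Definition lebesgue_rV_step : set 'rV[R]_n.+1 -> \bar R :=
  pushforward (@lebesgue_measure R \x mu)%E (@rV_cons R n).

Let lebesgue_rV_step0 : lebesgue_rV_step set0 = 0%E.
Proof. by rewrite /lebesgue_rV_step /pushforward preimage_set0 measure0. Qed.

Let lebesgue_rV_step_ge0 A : (0 <= lebesgue_rV_step A)%E.
Proof.
by rewrite /lebesgue_rV_step /pushforward; exact: measure_ge0.
Qed.

Let lebesgue_rV_step_sigma_additive : semi_sigma_additive lebesgue_rV_step.
Proof.
exact: measure_semi_sigma_additive.
Qed.

HB.instance Definition _ := isMeasure.Build _ _ _ lebesgue_rV_step
  lebesgue_rV_step0 lebesgue_rV_step_ge0 lebesgue_rV_step_sigma_additive.

Let lebesgue_rV_step_sigma_finite : sigma_finite setT lebesgue_rV_step.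
Proof.
have /sigma_finiteP[F [TF ndF Foo]] := sigma_finiteT (@lebesgue_measure R).
have /sigma_finiteP[G [TG ndG Goo]] := sigma_finiteT mu.
exists (fun k => @rV_uncons R n @^-1` (F k `*` G k)).
  apply/seteqP; split => // x _.
  have [i _ Fi] : (\bigcup_k F k) (@rV_uncons R n x).1 by rewrite -TF.
  have [k _ Gk] : (\bigcup_k G k) (@rV_uncons R n x).2 by rewrite -TG.
  exists (maxn i k) => //; split.
  - by move: Fi; apply/subsetPset/ndF/leq_maxl.
  - by move: Gk; apply/subsetPset/ndG/leq_maxr.
move=> k; have [mFk Fk] := Foo k; have [mGk Gk] := Goo k; split.
  rewrite -[X in measurable X]setTI.
  by apply: measurable_rV_uncons => //; exact: measurableX.
rewrite /lebesgue_rV_step /pushforward -comp_preimage.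
rewrite (_ : _ \o _ = id); last by apply/funext => z; exact: rV_consK.
by rewrite preimage_id product_measure1E// lte_mul_pinfty// ge0_fin_numE.
Qed.

HB.instance Definition _ := Measure_isSigmaFinite.Build _ _ _ lebesgue_rV_step
  lebesgue_rV_step_sigma_finite.

End lebesgue_rV_step.

Fixpoint lebesgue_rV (R : realType) (n : nat) :
    {sigma_finite_measure set 'rV[R]_n -> \bar R} :=
  if n is m.+1 then lebesgue_rV_step (lebesgue_rV R m) else \d_(0 : 'rV[R]_0).

Lemma lebesgue_rV_box (R : realType) (n : nat) (A : 'I_n -> set R) :
  (forall i, measurable (A i)) ->
  lebesgue_rV R n [set x | forall i, A i (x 0 i)] =
  (\prod_(i < n) @lebesgue_measure R (A i))%E.
Proof.
elim: n A => [|n ih] A mA.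
  by rewrite big_ord0 /= diracE mem_set// => -[].
rewrite big_ord_recl -ih//= /lebesgue_rV_step /pushforward.
have mB : measurable [set v : 'rV[R]_n | forall i, A (lift ord0 i) (v 0 i)].
  rewrite (_ : mkset _ =
      \bigcap_(i in [set: 'I_n]) (@rV_coord R n i @^-1` A (lift ord0 i))).
    apply: fin_bigcap_measurable => // i _; rewrite -[X in measurable X]setTI.
    by apply: measurable_rV_coord => //; exact: mA.
  by apply/seteqP; split => [x xA i _|x xA i]; exact: xA.
rewrite -product_measure1E//; last exact: mA.
congr (product_measure1 _ _ _); apply/seteqP; split => -[a v] /= Av.
  split; first by have := Av ord0; rewrite mxE unlift_none.
  by move=> i; have := Av (lift ord0 i); rewrite mxE liftK.
move=> i; rewrite mxE; have [j ->|->] := unliftP ord0 i.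
  exact: Av.2.
exact: Av.1.
Qed.

Definition cis (R : realType) (a : R) : R[i] := cos a +i* sin a.

Definition cintegral (R : realType) (n : nat) (g : 'rV[R]_n -> R[i]) : R[i] :=
  (\int[lebesgue_rV R n]_x complex.Re (g x))
  +i* (\int[lebesgue_rV R n]_x complex.Im (g x)).

Definition fourier (R : realType) (n : nat) (f : 'rV[R]_n -> R[i])
    (xi : 'rV[R]_n) : R[i] :=
  ((2 * pi) ^- n)%:C * cintegral (fun x => f x * cis (- dotp xi x)).

Definition multiplier (R : realType) (n : nat) (Phi : 'rV[R]_n -> R) (t : R)
    (f : 'rV[R]_n -> R[i]) (x : 'rV[R]_n) : R[i] :=
  cintegral (fun xi => cis (t * Phi xi + dotp xi x) * fourier f xi).

Definition schwartz_real (R : realType) (n : nat) (f : 'rV[R]_n -> R) : Prop :=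
  smooth_on setT f /\
  forall (N : nat) (s : seq 'I_n), exists C : R, forall x : 'rV[R]_n,
    enorm x ^+ N * `|pderivs s f x| <= C.

Definition schwartz (R : realType) (n : nat) (f : 'rV[R]_n -> R[i]) : Prop :=
  schwartz_real (fun x => complex.Re (f x)) /\
  schwartz_real (fun x => complex.Im (f x)).

Definition cLnorm (R : realType) (n : nat) (p : R) (g : 'rV[R]_n -> R[i]) :
    \bar R :=
  Lnorm (lebesgue_rV R n) p%:E (fun x => (Normc.normc (g x))%:E).

(* Schwartz functions being dense in L^p for finite p >= 1, this is the norm of
   the bounded extension of the multiplier to L^p. *)
Definition multiplier_norm (R : realType) (n : nat) (p : R)
    (Phi : 'rV[R]_n -> R) (t : R) : \bar R :=
  ereal_sup [set (cLnorm p (multiplier Phi t f) / cLnorm p f)%E |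
             f in [set f : 'rV[R]_n -> R[i] | schwartz f /\ f <> cst 0]].

(* A function on R^n minus the origin is encoded as a total function whose
   value at 0 is ignored. *)
Definition homogeneous0 (R : realType) (n : nat) (Phi : 'rV[R]_n -> R) : Prop :=
  forall (l : R) (xi : 'rV[R]_n), 0 < l -> xi != 0 -> Phi (l *: xi) = Phi xi.

Definition nonconstant (R : realType) (n : nat) (Phi : 'rV[R]_n -> R) : Prop :=
  exists xi eta : 'rV[R]_n, [/\ xi != 0, eta != 0 & Phi xi != Phi eta].

(* The unit sphere of R^n, of dimension n.-1. *)
Definition sphere (R : realType) (n : nat) : Type :=
  {x : 'rV[R]_n | enorm x == 1}.

Definition sphere_ext0 (R : realType) (n : nat) (phi : sphere R n -> R)
    (x : 'rV[R]_n) : R :=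
  if insub x is Some u then phi u else 0.

Definition homogeneous_ext (R : realType) (n : nat) (phi : sphere R n -> R)
    (xi : 'rV[R]_n) : R :=
  sphere_ext0 phi ((enorm xi)^-1 *: xi).

Definition open_disk (R : realType) (m : nat) : set 'rV[R]_m :=
  [set y | enorm y < 1].
Arguments open_disk : clear implicits.

(* Inverse of the chart that forgets the j-th coordinate on the open
   hemisphere x_j > 0 (if b is false) or x_j < 0 (if b is true). These 2n
   charts, with image the open unit disk, form an atlas of the sphere. *)
Definition hemisphere (R : realType) (n : nat) (j : 'I_n) (b : bool)
    (y : 'rV[R]_n.-1) : 'rV[R]_n :=
  \row_i (if unlift j i is Some k then y 0 k
          else (-1) ^+ b * Num.sqrt (1 - dotp y y)).

Lemma enorm_hemisphere (R : realType) (n : nat) (j : 'I_n) (b : bool)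
    (y : 'rV[R]_n.-1) : open_disk R n.-1 y -> enorm (hemisphere j b y) = 1.
Proof.
rewrite /open_disk /= /enorm => y1.
have {}y1 : dotp y y <= 1.
  by rewrite -ler_sqrt // sqrtr1; exact: ltW.
case: n j y y1 => [[]//|n] j y y1.
rewrite (_ : dotp _ _ = 1) ?sqrtr1// {1}/dotp (bigD1_ord j)//= !mxE unlift_none.
under eq_bigr do rewrite !mxE liftK.
by rewrite mulrACA -!expr2 sqrr_sign mul1r sqr_sqrtr ?subr_ge0// subrK.
Qed.

Definition local_rep (R : realType) (n : nat) (j : 'I_n) (b : bool)
    (phi : sphere R n -> R) (y : 'rV[R]_n.-1) : R :=
  sphere_ext0 phi (hemisphere j b y).

Record smooth_sphere (R : realType) (n : nat) := SmoothSphere {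
  smooth_sphere_fun :> sphere R n -> R;
  smooth_sphereP : forall (j : 'I_n) (b : bool),
    smooth_on (open_disk R n.-1) (local_rep j b smooth_sphere_fun) }.

HB.instance Definition _ (R : realType) (n : nat) :=
  gen_eqMixin (smooth_sphere R n).
HB.instance Definition _ (R : realType) (n : nat) :=
  gen_choiceMixin (smooth_sphere R n).

Definition whitney_subbasic (R : realType) (n : nat) (phi : smooth_sphere R n)
    (j : 'I_n) (b : bool) (K : set 'rV[R]_n.-1) (r : nat) (e : R) :
    set (smooth_sphere R n) :=
  [set psi | forall (s : seq 'I_n.-1) (y : 'rV[R]_n.-1), (size s <= r)%N -> K y ->
    `|pderivs s (local_rep j b psi) y - pderivs s (local_rep j b phi) y| < e].

Definition whitney_subbase (R : realType) (n : nat) :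
    set (set (smooth_sphere R n)) :=
  [set V | exists phi j b K r e, [/\ compact K, K `<=` open_disk R n.-1, 0 < e &
    V = whitney_subbasic phi j b K r e]].

HB.instance Definition _ (R : realType) (n : nat) :=
  isSubBaseTopological.Build (smooth_sphere R n)
    (@whitney_subbase R n) id.

(* Main.v *)
(* Suppose that the Hessian of Phi is invertible at some point c. Let f_s be the
   inverse Fourier transform of chi e^{i s Phi}, where chi is a bump supported
   near c. Then T^t f_s is a constant multiple of f_{s+t}, the L^2 norm of f_s
   does not depend on s (Plancherel), and its sup norm is O(<s>^{-n/2})
   (dispersion). Hence the p-th power of the L^p norm of f_s is at most, for
   p >= 2, and at least, for p <= 2, a constant times <s>^{-n(p-2)/2}, and the
   lower bound on T^t is seen on f_{-t}, respectively on f_0. For the dispersive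
   bound, |f_s|^2 is the Fourier transform of the autocorrelation of
   chi e^{i s Phi}, whose value at h is O((1 + |s h|)^{-2n}) by repeated
   integration by parts; integrating over h gives |f_s|^2 = O(|s|^{-n}).

   In the plane, Euler's relations force the Hessian of a 0-homogeneous function
   to be invertible wherever its gradient does not vanish. In dimension at least
   3, the Hessian of Phi at e_0 is the Hessian H of phi in a chart bordered by its
   gradient g, namely [[0, -g], [-g, H]]. Its invertibility is an open condition
   on the 2-jet of phi, and adding to phi a small multiple of one explicit
   function makes it hold. *)
From HB Require Import structures.
Require Import Defs.
From mathcomp Require Import all_boot all_order all_algebra.
From mathcomp Require Import all_classical all_reals all_analysis.
From mathcomp Require Import complex ring lra measurable_realfun.
Set Implicit Arguments.
Unset Strict Implicit.
Unset Printing Implicit Defensive.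
Import Order.TTheory GRing.Theory Num.Theory.
Import numFieldNormedType.Exports.
Local Open Scope classical_set_scope.
Local Open Scope ring_scope.

(** * Integration on R^n *)

Section euclidean_integration.
Context {R : realType}.
Local Notation lam n := (lebesgue_rV R n).

(** Squaring removes the stationary point. Near a point with invertible Hessian, the gradient of y
    |-> [Phi (y + h) - Phi y] is at least a multiple of |h|, so for h != 0 integration by parts is
    enough. The difficulty is uniformity as h tends to 0: the difference is divided by |h|, and all
    derivatives of the quotient, and of its inverse, are bounded at once for all h. Invertibility
    provides only one large coordinate of that gradient, so the variable in which one integrates by
    parts depends on h.

    Complex exponentials are carried as cosines with a phase [th], a quarter period standing for a
    factor i, so that the analysis concerns real integrals. Fourier inversion is proved for test
    functions up to a constant, which is the same for all of them by a symmetry argument.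

    The cases p >= 2 and p <= 2 are not linked by duality. Both come from inserting the sup bound
    into a factorisation of a power of |f_s|^2, which bounds the L^p norm from above in one case and
    from below in the other.

    In dimension at least 3 the open dense set asks for nondegeneracy at the single point e_0, near
    which the packets have their frequencies. *)

Lemma ballrV n (x y : 'rV[R]_n) (e : R) :
  ball x e y <-> 0 < e /\ forall i, `|x 0 i - y 0 i| < e.
Proof.
split=> [[e0 xy]|[e0 xy]]; split=> //; first by move=> i; exact: xy.
by move=> i j; rewrite (ord1 i); exact: xy.
Qed.

(** The sigma-algebra is generated by the coordinates, so an open set is written as a countable
    union of open cubes with rational centres and radii 1/(k+1); a cube is a finite intersection of
    preimages under coordinates. *)
Lemma open_measurable_rV n (U : set 'rV[R]_n) : open U -> measurable U.
Proof.
move=> oU.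
pose q (c : 'rV[rat]_n) : 'rV[R]_n := \row_i ratr (c 0 i).
pose B (ck : 'rV[rat]_n * nat) : set 'rV[R]_n := ball (q ck.1) (ck.2.+1%:R^-1).
pose P := [set ck | B ck `<=` U].
have -> : U = \bigcup_(ck in P) B ck.
  apply/seteqP; split => [x Ux|x [ck Pck] Bx]; last exact: Pck.
  have /nbhs_ballP[e /= e0 xU] : nbhs x U by exact: open_nbhs_nbhs.
  have [k ke] : exists k : nat, k.+1%:R^-1 < e / 2.
    have e20 : 0 < e / 2 by rewrite divr_gt0.
    exists (Num.truncn (e / 2)^-1).
    by rewrite invf_plt ?posrE// truncnS_gt.
  have k0 : (0 : R) < k.+1%:R^-1 by rewrite invr_gt0.
  move: k0 ke; set r := _.+1%:R^-1 => k0 ke.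
  have /choice[c cP] : forall i, exists r0 : rat,
      `|ratr r0 - x 0 i| < r.
    move=> i; have [r0] : exists r0 : rat,
        ratr r0 \in `]x 0 i - r, x 0 i + r[.
      by apply: rat_in_itvoo; lra.
    rewrite in_itv/= => /andP[a b]; exists r0.
    by rewrite ltr_norml; apply/andP; split; lra.
  exists (\row_i c i, k); last first.
    by apply/ballrV; split => //= i; rewrite !mxE; exact: cP.
  move=> y /ballrV[_ /= Hy]; apply: xU; apply/ballrV; split => // i.
  have := Hy i; rewrite !mxE /= => yc.
  rewrite -(subrK (ratr (c i)) (x 0 i)) -addrA (le_lt_trans (ler_normD _ _))//.
  by rewrite [ltRHS]splitr ltrD ?(lt_trans _ ke)// distrC.
rewrite bigcup_mkcond; apply: countable_bigcupT_measurable => [|ck]; first exact: countableP.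
case: ifP => // _.
rewrite (_ : B ck = \bigcap_(i in [set: 'I_n])
   ((@rV_coord R n i) @^-1` (ball (q ck.1 0 i) ck.2.+1%:R^-1))).
  apply: fin_bigcap_measurable => // i _; rewrite -[X in measurable X]setTI.
  apply: measurable_rV_coord => //; apply: open_measurable.
  exact: ball_open.
apply/seteqP; split => [x /ballrV[_ Bx] i _|x Bx]; first exact: Bx.
by apply/ballrV; split => [//|i]; exact: (Bx i).
Qed.

Lemma continuous_measurable_rV n (f : 'rV[R]_n -> R) :
  continuous f -> measurable_fun setT f.
Proof.
move=> cf; apply: (measurability _ (RGenOpens.measurableE R)).
move=> _ [_ [a [b ->] <-]]; rewrite setTI.
apply: open_measurable_rV; apply: open_comp; last exact: interval_open.
by move=> x _; exact: cf.
Qed.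

Lemma measurable_rV_affine n (a : R) (v : 'rV[R]_n) :
  measurable_fun setT (fun x : 'rV[R]_n => a *: x + v).
Proof.
apply: measurable_fun_rV => i.
rewrite (_ : _ \o _ = (fun x : 'rV[R]_n => a * rV_coord i x + v 0 i)).
  apply: measurable_funD => //; apply: measurable_funM => //.
  exact: measurable_rV_coord.
by apply/funext => x; rewrite /rV_coord /= !mxE.
Qed.

(** As a function of [A] the left side is a measure, and it agrees with Lebesgue measure on
    half-open intervals. For negative [a] the preimage of such an interval is open at the other end,
    hence the two cases. *)
Lemma lebesgue_measure_affine (a b : R) (A : set (measurableTypeR R)) :
  a != 0 -> measurable A ->
  (`|a|%:E * lebesgue_measure ((fun x => (a * x + b)%R) @^-1` A))%E =
  lebesgue_measure A.
Proof.
move=> a0 mA.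
pose phi : measurableTypeR R -> measurableTypeR R := fun x => a * x + b.
have mphi : measurable_fun setT phi.
  by apply: measurable_funD => //; apply: measurable_funM.
pose mu0 : {measure set measurableTypeR R -> \bar R} :=
  pushforward (@lebesgue_measure R) phi.
pose mu := mscale (NngNum (normr_ge0 a)) (mu0 mphi).
apply/esym; apply: (lebesgue_measure_unique (mu := mu)) => //.
move=> X [[x y] _ <-] /=; rewrite /mu /mscale /pushforward /=.
rewrite lebesgue_measure_itv /= lte_fin.
have [xy|yx] := ltP x y; last first.
  rewrite set_itv_ge ?preimage_set0 ?measure0 ?mule0//.
  by rewrite bnd_simp -leNgt.
move: a0; rewrite neq_lt => /orP[a0|a0].
- rewrite /pushforward (_ : _ @^-1` _ = [set` `[(y - b) / a, (x - b) / a[]).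
    rewrite lebesgue_measure_itv /= lte_fin ltr_nM2r ?invr_lt0// ltrD2r xy.
    rewrite -EFinB -EFinM ltr0_norm//; congr EFin; field; exact: ltr0_neq0.
  apply/seteqP; split=> t /=; rewrite !in_itv/= /phi ler_ndivrMr// ltr_ndivlMr//;
    rewrite mulrC => /andP[? ?]; apply/andP; split; lra.
- rewrite /pushforward (_ : _ @^-1` _ = [set` `](x - b) / a, (y - b) / a]]).
    rewrite lebesgue_measure_itv /= lte_fin ltr_pM2r ?invr_gt0// ltrD2r xy.
    rewrite -EFinB -EFinM gtr0_norm//; congr EFin; field; exact: lt0r_neq0.
  apply/seteqP; split=> t /=; rewrite !in_itv/= /phi ltr_pdivrMr// ler_pdivlMr//;
    rewrite mulrC => /andP[? ?]; apply/andP; split; lra.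
Qed.

Lemma ge0_integral_affine (a b : R) (f : measurableTypeR R -> \bar R) :
  a != 0 -> measurable_fun setT f -> (forall x, (0 <= f x)%E) ->
  (\int[lebesgue_measure]_x f (a * x + b)%R = (`|a|^-1)%:E *
    \int[lebesgue_measure]_x f x)%E.
Proof.
move=> a0 mf f0.
pose phi : measurableTypeR R -> measurableTypeR R := fun x => a * x + b.
have mphi : measurable_fun setT phi.
  by apply: measurable_funD => //; apply: measurable_funM.
have := @ge0_integral_pushforward _ _ _ _ R phi mphi lebesgue_measure setT f
  measurableT mf (fun x _ => f0 x).
rewrite preimage_setT /comp => <-.
rewrite -(ge0_integral_mscale _ measurableT (NngNum (ltW (_ : 0 < `|a|^-1))))//.
  by rewrite invr_gt0 normr_gt0.
move=> h0; apply: eq_measure_integral => A mA _ /=.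
rewrite /mscale/= -(lebesgue_measure_affine b a0 mA) muleA -EFinM.
by rewrite mulVf ?normr_eq0// mul1e.
Qed.

(** Unfolds the recursive construction of [lebesgue_rV], so that facts about integrals on R^n can be
    proved by induction on the dimension. *)
Lemma ge0_integral_rVS n (f : 'rV[R]_n.+1 -> \bar R) :
  measurable_fun setT f -> (forall x, (0 <= f x)%E) ->
  (\int[lam n.+1]_x f x =
   \int[lebesgue_measure]_z \int[lam n]_x f (rV_cons (z, x)))%E.
Proof.
move=> mf f0.
have := @ge0_integral_pushforward _ _ _ _ R (@rV_cons R n)
  (@measurable_rV_cons R n) (lebesgue_measure \x lam n)%E setT f
  measurableT mf (fun x _ => f0 x).
rewrite preimage_setT => E.
transitivity (\int[lebesgue_measure \x lam n]_x (f \o @rV_cons R n) x)%E.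
  by rewrite -E; apply: eq_measure_integral.
rewrite fubini_tonelli1// => [|x]; last exact: f0.
apply: measurableT_comp => //; exact: measurable_rV_cons.
Qed.

Lemma measurable_inner_rVS n (f : 'rV[R]_n.+1 -> \bar R) :
  measurable_fun setT f -> (forall x, (0 <= f x)%E) ->
  measurable_fun setT (fun z : measurableTypeR R =>
    \int[lam n]_x f (rV_cons (z, x)))%E.
Proof.
move=> mf f0.
apply: (@measurable_fun_fubini_tonelli_F _ _ _ _ _ _ (f \o @rV_cons R n)) => [|x].
  by apply: measurableT_comp => //; exact: measurable_rV_cons.
exact: f0.
Qed.

Lemma ge0_integral_rV_affine n (a : R) (v : 'rV[R]_n) (f : 'rV[R]_n -> \bar R) :
  a != 0 -> measurable_fun setT f -> (forall x, (0 <= f x)%E) ->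
  (\int[lam n]_x f (a *: x + v)%R = (`|a| ^- n)%:E * \int[lam n]_x f x)%E.
Proof.
move=> a0; elim: n v f => [|n ih] v f mf f0.
  rewrite expr0 invr1 mul1e; apply: eq_integral => x _; congr f.
  by apply/rowP => -[].
rewrite ge0_integral_rVS//; last first.
  by apply: measurableT_comp => //; exact: measurable_rV_affine.
pose v' : 'rV[R]_n := \row_j v 0 (lift ord0 j).
have E z x : a *: rV_cons (z, x) + v = rV_cons (a * z + v 0 ord0, a *: x + v').
  apply/rowP => i; rewrite !mxE; case: (unliftP ord0 i) => [j|] -> /=.
    by rewrite !mxE.
  by [].
under eq_integral => z _ do under eq_integral do rewrite E.
pose g z : \bar R := (\int[lam n]_x f (rV_cons (z, x)))%E.
transitivity (\int[lebesgue_measure]_z ((`|a| ^- n)%:E * g (a * z + v 0 ord0)%R))%E.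
  apply: eq_integral => z _; rewrite -(ih v' (fun x => f (rV_cons _)))//.
  apply: measurableT_comp => //.
  exact: measurableT_comp (@measurable_rV_cons R n) (pair1_measurable _).
have g0 z : (0 <= g z)%E by apply: integral_ge0 => x _.
have mg : measurable_fun setT g by exact: measurable_inner_rVS.
have i0 : (0 <= (`|a| ^- n)%:E)%E by rewrite lee_fin invr_ge0 exprn_ge0.
rewrite ge0_integralZl//=.
- rewrite (ge0_integral_affine (v 0 ord0) a0 mg)// muleA -EFinM -invfM.
  by rewrite -exprSr ge0_integral_rVS.
- by apply: measurableT_comp => //; apply: measurable_funD => //; apply: measurable_funM.
Qed.
(** Reference weight for all dominations. Its product form makes its integral split along [rV_cons],
    and it is at least (1 + |x|^2)^-n, so finitely many integrations by parts suffice to reach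
    it. *)
Definition decay n (x : 'rV[R]_n) : R := \prod_(i < n) (1 + x 0 i ^+ 2)^-1.

Lemma oneDsqr_gt0' (x : R) : 0 < 1 + x ^+ 2.
Proof. by rewrite ltr_pwDl// sqr_ge0. Qed.

Lemma decay_gt0 n (x : 'rV[R]_n) : 0 < decay x.
Proof. by apply: prodr_gt0 => i _; rewrite invr_gt0 oneDsqr_gt0'. Qed.

Lemma decay_le1 n (x : 'rV[R]_n) : decay x <= 1.
Proof.
apply: prodr_ile1 => i _; rewrite invr_ge0 ltW ?oneDsqr_gt0'//= .
by rewrite invf_le1 ?oneDsqr_gt0'// lerDl sqr_ge0.
Qed.

Lemma measurable_decay n : measurable_fun setT (@decay n).
Proof.
apply: measurable_prod => i _.
apply: (measurableT_comp (f := fun x : R => (1 + x ^+ 2)^-1)).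
  apply: continuous_measurable_fun => x; apply: cvgV.
    by rewrite gt_eqF ?oneDsqr_gt0'.
  by apply: cvgD; [exact: cvg_cst|exact: exprn_continuous].
exact: measurable_rV_coord.
Qed.

Lemma integral_decay1 :
  (\int[lebesgue_measure]_x ((1 + x ^+ 2)^-1)%:E < +oo :> \bar R)%E.
Proof.
have m1 : measurable_fun setT (fun x : R => ((1 + x ^+ 2)^-1)).
  apply: continuous_measurable_fun => x; apply: cvgV.
    by rewrite gt_eqF ?oneDsqr_gt0'.
  by apply: cvgD; [exact: cvg_cst|exact: exprn_continuous].
rewrite ge0_symfun_integralT//=.
- rewrite (_ : [set x | _] = `[0, +oo[%classic); last first.
    by apply/seteqP; split => x/=; rewrite in_itv/= andbT.
  by have := @integral0y_oneDsqr R; rewrite /oneDsqr/= => ->; rewrite -EFinM ltry.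
- by move=> x; rewrite invr_ge0 ltW ?oneDsqr_gt0'.
- move=> x; apply: cvgV.
    by rewrite gt_eqF ?oneDsqr_gt0'.
  by apply: cvgD; [exact: cvg_cst|exact: exprn_continuous].
- by move=> x; rewrite /= sqrrN.
Qed.

Lemma integrable_decay n : (lam n).-integrable setT (EFin \o @decay n).
Proof.
apply/integrableP; split.
  apply/measurable_EFinP; exact: measurable_decay.
under eq_integral => x _.
  rewrite gee0_abs ?lee_fin 1?ltW ?decay_gt0//.
  over.
elim: n => [|n ih].
  rewrite (eq_integral (cst 1%E)); last by move=> x _; rewrite /= /decay big_ord0.
  by rewrite integral_cst//= diracT mul1e ltry.
rewrite ge0_integral_rVS//; last first.
  - by move=> x; rewrite lee_fin ltW ?decay_gt0.
  - by apply/measurable_EFinP; exact: measurable_decay.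
have E z x : decay (rV_cons (z, x)) = (1 + z ^+ 2)^-1 * decay x :> R.
  rewrite /decay big_ord_recl /=; congr (_ * _); first by rewrite mxE unlift_none.
  by apply: eq_bigr => i _; rewrite mxE liftK.
under eq_integral => z _.
  under eq_integral do rewrite /= E EFinM.
  rewrite ge0_integralZl//; last first.
  - by rewrite lee_fin invr_ge0 ltW ?oneDsqr_gt0'.
  - by move=> x _; rewrite lee_fin ltW ?decay_gt0.
  - by apply/measurable_EFinP; exact: measurable_decay.
  over.
have f0 : (0 <= \int[lam n]_x (decay x)%:E)%E.
  by apply: integral_ge0 => x _; rewrite lee_fin ltW ?decay_gt0.
rewrite ge0_integralZr//.
- by rewrite lte_mul_pinfty// ?integral_decay1//;
   [apply: integral_ge0 => x _; rewrite lee_fin invr_ge0 ltW ?oneDsqr_gt0'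
   |rewrite ge0_fin_numE ?integral_decay1//; apply: integral_ge0 => x _;
    rewrite lee_fin invr_ge0 ltW ?oneDsqr_gt0'].
- apply/measurable_EFinP; apply: continuous_measurable_fun => x; apply: cvgV.
    by rewrite gt_eqF ?oneDsqr_gt0'.
  by apply: cvgD; [exact: cvg_cst|exact: exprn_continuous].
- by move=> x _; rewrite lee_fin invr_ge0 ltW ?oneDsqr_gt0'.
Qed.

Local Notation integ n f := ((lam n).-integrable setT (EFin \o f)).

Lemma decay_integrable n (f : 'rV[R]_n -> R) (C : R) :
  measurable_fun setT f -> (forall x, `|f x| <= C * decay x) -> integ n f.
Proof.
move=> mf fC; apply: (le_integrable _ _ _ (integrableZl measurableT C (integrable_decay n))) => //.
  exact/measurable_EFinP.
move=> x _ /=; by rewrite lee_fin (le_trans (fC x))// ler_norm.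
Qed.

Lemma integrable_affine n (a : R) (v : 'rV[R]_n) (f : 'rV[R]_n -> R) :
  a != 0 -> integ n f -> integ n (fun x => f (a *: x + v)).
Proof.
move=> a0 /integrableP[mf fi]; apply/integrableP; split.
  by apply: measurableT_comp mf _; exact: measurable_rV_affine.
rewrite (ge0_integral_rV_affine v a0 (f := fun x => `|(f x)%:E|%E))//.
  by rewrite lte_mul_pinfty// lee_fin invr_ge0 exprn_ge0.
exact: measurableT_comp.
Qed.

Lemma Rintegral_affine n (a : R) (v : 'rV[R]_n) (f : 'rV[R]_n -> R) :
  a != 0 -> integ n f ->
  \int[lam n]_x f (a *: x + v) = `|a| ^- n * \int[lam n]_x f x.
Proof.
move=> a0 fi; have /integrableP[mf _] := fi.
rewrite /Rintegral integralE [in RHS]integralE.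
have pf := integrable_pos_fin_num measurableT fi.
have nf := integrable_neg_fin_num measurableT fi.
have P : (\int[lam n]_x ((fun x => (f (a *: x + v)%R)%:E)^\+ x) =
  (`|a| ^- n)%:E * \int[lam n]_x ((EFin \o f)^\+ x))%E.
  rewrite -(ge0_integral_rV_affine v a0 (f := (EFin \o f)^\+%E))//.
    by apply: eq_integral => x _; rewrite !funeposE.
  exact: measurable_funepos.
have N : (\int[lam n]_x ((fun x => (f (a *: x + v)%R)%:E)^\- x) =
  (`|a| ^- n)%:E * \int[lam n]_x ((EFin \o f)^\- x))%E.
  rewrite -(ge0_integral_rV_affine v a0 (f := (EFin \o f)^\-%E))//.
    by apply: eq_integral => x _; rewrite !funenegE.
  exact: measurable_funeneg.
rewrite P N -muleBr ?fin_num_adde_defr// fineM//.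
by rewrite fin_numB; apply/andP.
Qed.

Lemma Rintegral_shift n (v : 'rV[R]_n) (f : 'rV[R]_n -> R) : integ n f ->
  \int[lam n]_x f (x + v) = \int[lam n]_x f x.
Proof.
move=> fi; have := @Rintegral_affine n 1 v f (oner_neq0 _) fi.
rewrite normr1 expr1n invr1 mul1r => <-.
by apply: eq_Rintegral => x _; rewrite scale1r.
Qed.

Lemma Rintegral_dominated n (f_ : nat -> 'rV[R]_n -> R) (f g : 'rV[R]_n -> R) :
  (forall k, measurable_fun setT (f_ k)) -> measurable_fun setT f ->
  integ n g -> (forall k x, `|f_ k x| <= g x) ->
  (forall x, f_ k x @[k --> \oo] --> f x) ->
  \int[lam n]_x f_ k x @[k --> \oo] --> \int[lam n]_x f x.
Proof.
move=> mf_ mf ig fg ff.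
have [|||||fi _ cf] := @dominated_convergence _ _ _ (lam n) setT measurableT
  (fun k x => (f_ k x)%:E) (fun x => (f x)%:E) (fun x => (g x)%:E).
- by move=> k; exact/measurable_EFinP.
- exact/measurable_EFinP.
- by apply: aeW => x _; apply/cvg_EFin; [exact: nearW|exact: ff].
- by [].
- by apply: aeW => x k _; rewrite lee_fin.
apply: fine_cvg; rewrite fineK//; exact: integrable_fin_num.
Qed.

Lemma decay2_integrable n m (F : 'rV[R]_n * 'rV[R]_m -> R) (C : R) :
  measurable_fun setT F ->
  (forall x y, `|F (x, y)| <= C * (decay x * decay y)) ->
  (lam n \x lam m)%E.-integrable setT (EFin \o F).
Proof.
move=> mF FC; apply/integrable12ltyP; first exact/measurable_EFinP.
have C0 : 0 <= C.
  have := le_trans (normr_ge0 _) (FC 0 0).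
  by rewrite pmulr_lge0// mulr_gt0 ?decay_gt0.
have fin k : (\int[lam k]_x (decay x)%:E < +oo)%E.
  have /integrableP[_] := integrable_decay k.
  rewrite (eq_integral (fun x => (decay x)%:E))// => x _.
  by rewrite /= ger0_norm// ltW// decay_gt0.
have ge0 k : (0 <= \int[lam k]_x (decay x)%:E)%E.
  by apply: integral_ge0 => x _; rewrite lee_fin ltW ?decay_gt0.
apply: (@le_lt_trans _ _ (\int[lam n]_x ((C * decay x)%:E * \int[lam m]_y (decay y)%:E))%E).
  apply: ge0_le_integral => //.
  - by move=> x _; apply: integral_ge0.
  - apply: (measurable_fun_fubini_tonelli_F (abse \o (EFin \o F))) => //=.
    by apply: measurableT_comp => //; exact/measurable_EFinP.
  - apply: emeasurable_funM => //; apply/measurable_EFinP.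
    by apply: measurable_funM => //; exact: measurable_decay.
  move=> x _; rewrite -ge0_integralZl//.
  - apply: ge0_le_integral => //.
    + apply: measurableT_comp => //; apply/measurable_EFinP.
      exact: measurableT_comp mF (pair1_measurable _).
    + apply/measurable_EFinP; apply: measurable_funM => //; exact: measurable_decay.
    + by move=> y _; rewrite -EFinM lee_fin -mulrA.
  - by apply/measurable_EFinP; exact: measurable_decay.
  - by move=> y _; rewrite lee_fin ltW ?decay_gt0.
  - by rewrite lee_fin mulr_ge0// ltW// decay_gt0.
rewrite ge0_integralZr//.
- have I0 : (0 <= \int[lam n]_x (C * decay x)%:E)%E.
    by apply: integral_ge0 => x _; rewrite lee_fin mulr_ge0// ltW// decay_gt0.
  have Ioo : (\int[lam n]_x (C * decay x)%:E < +oo)%E.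
    under eq_integral do rewrite EFinM.
    rewrite ge0_integralZl ?lee_fin//.
    + by rewrite lte_mul_pinfty.
    + by apply/measurable_EFinP; exact: measurable_decay.
    + by move=> x _; rewrite lee_fin ltW// decay_gt0.
  by rewrite lte_mul_pinfty// ge0_fin_numE.
- apply/measurable_EFinP; apply: measurable_funM => //; exact: measurable_decay.
- by move=> x _; rewrite lee_fin mulr_ge0// ltW// decay_gt0.
Qed.

Lemma Rintegral_fubini n m (F : 'rV[R]_n * 'rV[R]_m -> R) (C : R) :
  measurable_fun setT F ->
  (forall x y, `|F (x, y)| <= C * (decay x * decay y)) ->
  \int[lam n]_x (\int[lam m]_y F (x, y)) = \int[lam m]_y (\int[lam n]_x F (x, y)).
Proof.
move=> mF FC; have iF := decay2_integrable mF FC.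
have i1 x : (lam m).-integrable setT (fun y => (F (x, y))%:E).
  apply: (@decay_integrable _ (fun y => F (x, y)) (C * decay x)).
    exact: measurableT_comp mF (pair1_measurable _).
  by move=> y; rewrite -mulrA.
have i2 y : (lam n).-integrable setT (fun x => (F (x, y))%:E).
  apply: (@decay_integrable _ (fun x => F (x, y)) (C * decay y)).
    exact: measurableT_comp mF (pair2_measurable _).
  by move=> x; rewrite -mulrA [decay y * _]mulrC.
rewrite /Rintegral; under eq_integral do rewrite fineK ?integrable_fin_num//.
under [in RHS]eq_integral do rewrite fineK ?integrable_fin_num//.
by congr fine; exact: (Fubini iF).
Qed.

Lemma measurable_Rintegral2 n m (F : 'rV[R]_n * 'rV[R]_m -> R) (C : R) :
  measurable_fun setT F ->
  (forall x y, `|F (x, y)| <= C * (decay x * decay y)) ->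
  measurable_fun setT (fun x => \int[lam m]_y F (x, y)).
Proof.
move=> mF FC; have iF := decay2_integrable mF FC.
apply: measurableT_comp; first exact: fine_measurable.
exact: (measurable_fubini_F iF).
Qed.
End euclidean_integration.
(** * Smooth functions *)

Section directional_derivatives.
Context {R : realType} {V : normedModType R}.
Implicit Types (g f : V -> R) (x v : V).

Lemma is_derive_line g x v (h0 d : R) :
  is_derive (h0 *: v + x) v g d <-> is_derive h0 1 (fun h : R => g (h *: v + x)) d.
Proof.
have E : (fun h : R => h^-1 *: (((fun h : R => g (h *: v + x)) \o shift h0) (h *: 1) - g (h0 *: v + x)))
    = (fun h : R => h^-1 *: ((g \o shift (h0 *: v + x)) (h *: v) - g (h0 *: v + x))).
  apply/funext => h; congr (_ *: (_ - _)) => /=.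
  by rewrite addrA -scalerDl [h *: 1]mulr1.
split=> -[gd <-]; split.
- by move: gd; rewrite /derivable /= E.
- by rewrite /derive /= E.
- by move: gd; rewrite /derivable /= E.
- by rewrite /derive /= E.
Qed.

Lemma is_derive_line0 g x v (d : R) :
  is_derive x v g d <-> is_derive (0 : R) (1 : R) (fun h : R => g (h *: v + x)) d.
Proof. by rewrite -is_derive_line scale0r add0r. Qed.

Lemma is_derive_chain1 (psi : R -> R) g x v (a b : R) :
  is_derive (g x) 1 psi a -> is_derive x v g b ->
  is_derive x v (psi \o g) (a * b).
Proof.
move=> da /is_derive_line0 db; apply/is_derive_line0.
apply: (is_derive1_comp (f := psi) (g := fun h : R => g (h *: v + x))) => //.
by rewrite scale0r add0r.
Qed.

Lemma near_is_derive g f x v (d : R) :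
  (\near x, g x = f x) -> is_derive x v g d -> is_derive x v f d.
Proof.
move=> gf [gd <-]; split; first exact: near_eq_derivable gd.
by apply/esym/near_eq_derive.
Qed.

Lemma MVT_line g (dg : R -> R) x v :
  (forall h : R, 0 <= h <= 1 -> is_derive (h *: v + x) v g (dg h)) ->
  exists2 c : R, 0 < c < 1 & g (v + x) - g x = dg c.
Proof.
move=> gd; pose f (h : R) := g (h *: v + x).
have fd (h : R) : 0 <= h <= 1 -> is_derive h 1 f (dg h).
  by move=> h01; apply/is_derive_line; exact: gd.
have [||c] := @MVT R f dg 0 1 ltr01.
- by move=> h; rewrite in_itv/= => /andP[? ?]; apply: fd; rewrite !ltW.
- apply: derivable_within_continuous => h; rewrite in_itv/= => h01.
  by have [] := fd h h01.
rewrite in_itv/= => c01; rewrite /f scale1r scale0r add0r subr0 mulr1 => E.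
by exists c.
Qed.

End directional_derivatives.

Section differentiability_classes.
Context {R : realType} {n : nat} {T D : Type}.
Variable dir : D -> T -> 'rV[R]_n.
Variable W : T -> set 'rV[R]_n.
Hypothesis oW : forall t, open (W t).
Variable B : (T -> 'rV[R]_n -> R) -> Prop.
Hypothesis Bext : forall f g : T -> 'rV[R]_n -> R,
  (forall t x, W t x -> f t x = g t x) -> B f -> B g.
Hypothesis BD : forall f g : T -> 'rV[R]_n -> R,
  B f -> B g -> B (fun t x => f t x + g t x).
Hypothesis BM : forall f g : T -> 'rV[R]_n -> R,
  B f -> B g -> B (fun t x => f t x * g t x).

(* Families [g t] whose iterated derivatives along the directions [dir d t], up
   to order [k], all belong to the class [B]. With [B] the continuous functions
   this is smoothness; with [B] the families bounded uniformly in [t] it controls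
   the amplitudes produced by integrations by parts. *)
Fixpoint diffclass (k : nat) (g : T -> 'rV[R]_n -> R) : Prop :=
  B g /\
  if k is k'.+1 then
    forall d, (forall t x, W t x -> derivable (g t) x (dir d t)) /\
      diffclass k' (fun t x => 'D_(dir d t) (g t) x)
  else True.

Lemma diffclassB k g : diffclass k g -> B g.
Proof. by case: k => [|k] []. Qed.

Lemma near_open (U : set 'rV[R]_n) (f g : 'rV[R]_n -> R) x :
  open U -> U x -> (forall y, U y -> f y = g y) -> \near x, f x = g x.
Proof.
move=> oU Ux fg; have : nbhs x U by exact: open_nbhs_nbhs.
by apply: filterS => y; exact: fg.
Qed.

Lemma diffclass_ext k f g : (forall t x, W t x -> f t x = g t x) ->
  diffclass k f -> diffclass k g.
Proof.
elim: k f g => [|k ih] f g fg /= [Bf Df]; split=> //; try exact: Bext Bf.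
move=> d; have [df cf] := Df d; split.
  move=> t x Wx; apply: near_eq_derivable (df t x Wx).
  exact: near_open Wx (fg t).
apply: ih cf => t x Wx; apply: near_eq_derive.
exact: near_open Wx (fg t).
Qed.

Lemma diffclassW k f : diffclass k.+1 f -> diffclass k f.
Proof.
elim: k f => [|k ih] f [Bf Df] //=; split => // d.
by have [df cf] := Df d; split => //; exact: ih.
Qed.

Lemma diffclassD k f g : diffclass k f -> diffclass k g ->
  diffclass k (fun t x => f t x + g t x).
Proof.
elim: k f g => [|k ih] f g [Bf Df] [Bg Dg] /=; split=> //; try exact: BD.
move=> d; have [df cf] := Df d; have [dg cg] := Dg d; split.
  by move=> t x Wx; apply: derivableD; [exact: df|exact: dg].
apply: diffclass_ext (ih _ _ cf cg) => t x Wx.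
by rewrite -deriveD//; [exact: df|exact: dg].
Qed.

Lemma diffclassM k f g : diffclass k f -> diffclass k g ->
  diffclass k (fun t x => f t x * g t x).
Proof.
elim: k f g => [|k ih] f g Cf Cg.
  by split=> //; apply: BM; [exact: diffclassB Cf|exact: diffclassB Cg].
have [Bf Df] := Cf; have [Bg Dg] := Cg; split; first exact: BM.
move=> d; have [df cf] := Df d; have [dg cg] := Dg d; split.
  by move=> t x Wx; apply: derivableM; [exact: df|exact: dg].
apply: diffclass_ext (diffclassD (ih _ _ (diffclassW Cf) cg)
  (ih _ _ (diffclassW Cg) cf)) => t x Wx.
by rewrite [RHS](@deriveM _ _ (f t) (g t))//; [exact: df|exact: dg].
Qed.

(** The outer function comes with the whole sequence of its derivatives: differentiating
    [psi j (g t x)] produces [psi j.+1], so the induction on [k] must carry every [j]. *)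
Lemma diffclass_comp k (psi : nat -> R -> R) (g : T -> 'rV[R]_n -> R) :
  (forall t x, W t x -> forall j, is_derive (g t x) 1 (psi j) (psi j.+1 (g t x))) ->
  (forall j, B (fun t x => psi j (g t x))) ->
  diffclass k g -> forall j, diffclass k (fun t x => psi j (g t x)).
Proof.
move=> dpsi Bpsi; elim: k => [|k ih] Cg j; first by split.
split; first exact: Bpsi.
have [Bg Dg] := Cg => d; have [dg cg] := Dg d.
have cd t x : W t x ->
    is_derive x (dir d t) (psi j \o g t) (psi j.+1 (g t x) * 'D_(dir d t) (g t) x).
  move=> Wx; apply: is_derive_chain1; first exact: dpsi.
  by split=> //; exact: dg.
split; first by move=> t x Wx; have [] := cd t x Wx.
apply: diffclass_ext (diffclassM (ih (diffclassW Cg) j.+1) cg) => t x Wx.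
by have [_ ->] := cd t x Wx.
Qed.

Lemma diffclassS k g : diffclass k.+1 g ->
  forall d, (forall t x, W t x -> derivable (g t) x (dir d t)) /\
      diffclass k (fun t x => 'D_(dir d t) (g t) x).
Proof. by case. Qed.

Lemma diffclass_cst k (a : T -> R) : B (fun t x => a t) -> B (fun t x => 0) ->
  diffclass k (fun t x => a t).
Proof.
move=> Ba B0; elim: k a Ba => [|k ih] a Ba //=; split=> // d; split.
  by move=> t x _; exact: derivable_cst.
apply: diffclass_ext (ih (fun=> 0) B0) => t x Wx.
by rewrite derive_cst.
Qed.

End differentiability_classes.
Section smooth_functions.
Context {R : realType} {n : nat}.
Implicit Types (U : set 'rV[R]_n) (f g : 'rV[R]_n -> R) (x y : 'rV[R]_n).
Local Notation e_ i := (delta_mx 0 i : 'rV[R]_n).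

(** The instance of [diffclass] with a one-point parameter space, the coordinate directions, and
    continuity on [U] as the base class. *)
Definition smoothclass U (k : nat) f :=
  diffclass (fun (i : 'I_n) (_ : unit) => e_ i) (fun=> U)
    (fun h : unit -> 'rV[R]_n -> R => forall x, U x -> {for x, continuous (h tt)}) k (fun=> f).

Lemma smooth_onP U f : open U -> smooth_on U f <-> forall k, smoothclass U k f.
Proof.
move=> oU; split=> [sf k|cf].
- suff : forall s, smoothclass U k (pderivs s f) by move/(_ [::]).
  elim: k => [|k ih] s; split.
  + by move=> x Ux; have [] := sf s x Ux.
  + by [].
  + by move=> x Ux; have [] := sf s x Ux.
  + move=> i; split; first by move=> [] x Ux; have [_] := sf s x Ux.
    exact: (ih (i :: s)).
- suff H : forall s k, smoothclass U k (pderivs s f).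
    move=> s x Ux; have [Bf Df] := H s 1%N; split; first exact: Bf.
    by move=> i; have [+ _] := Df i; exact.
  elim=> [|i s ih] k //=.
  by have [_ /(_ i)[_]] := ih k.+1.
Qed.

Let Bext U : open U -> forall f g : unit -> 'rV[R]_n -> R,
  (forall t x, U x -> f t x = g t x) ->
  (forall x, U x -> {for x, continuous (f tt)}) ->
  (forall x, U x -> {for x, continuous (g tt)}).
Proof.
move=> oU f g fg cf x Ux.
have E : \near x, f tt x = g tt x.
  have : nbhs x U by exact: open_nbhs_nbhs.
  by apply: filterS => y Uy; exact: fg.
rewrite /prop_for /continuous_at -(fg tt x Ux).
by apply: cvg_trans (cf x Ux); exact: (near_eq_cvg E).
Qed.

Let BD U : forall f g : unit -> 'rV[R]_n -> R,
  (forall x, U x -> {for x, continuous (f tt)}) ->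
  (forall x, U x -> {for x, continuous (g tt)}) ->
  (forall x, U x -> {for x, continuous (fun x => f tt x + g tt x)}).
Proof. by move=> f g cf cg x Ux; exact: (cvgD (cf x Ux) (cg x Ux)). Qed.

Let BM U : forall f g : unit -> 'rV[R]_n -> R,
  (forall x, U x -> {for x, continuous (f tt)}) ->
  (forall x, U x -> {for x, continuous (g tt)}) ->
  (forall x, U x -> {for x, continuous (fun x => f tt x * g tt x)}).
Proof. by move=> f g cf cg x Ux; exact: (cvgM (cf x Ux) (cg x Ux)). Qed.

Lemma smoothclass_ext U k f g : open U -> (forall x, U x -> f x = g x) ->
  smoothclass U k f -> smoothclass U k g.
Proof.
by move=> oU fg; apply: diffclass_ext => //; exact: Bext.
Qed.

Lemma smoothclassD U k f g : open U -> smoothclass U k f -> smoothclass U k g ->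
  smoothclass U k (fun x => f x + g x).
Proof.
move=> oU cf cg; apply: (diffclassD _ _ _ cf cg) => //; [exact: Bext|exact: BD].
Qed.

Lemma smoothclassM U k f g : open U -> smoothclass U k f -> smoothclass U k g ->
  smoothclass U k (fun x => f x * g x).
Proof.
move=> oU cf cg.
apply: (diffclassM _ _ _ _ cf cg) => //; [exact: Bext|exact: BD|exact: BM].
Qed.

Lemma smooth_on_ext U f g : open U -> (forall x, U x -> f x = g x) ->
  smooth_on U f -> smooth_on U g.
Proof.
move=> oU fg /smooth_onP -/(_ oU) cf; apply/smooth_onP => // k.
exact: smoothclass_ext (cf k).
Qed.

Lemma smooth_onD U f g : open U -> smooth_on U f -> smooth_on U g ->
  smooth_on U (fun x => f x + g x).
Proof.
move=> oU /smooth_onP -/(_ oU) cf /smooth_onP -/(_ oU) cg.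
by apply/smooth_onP => // k; exact: smoothclassD.
Qed.

Lemma smooth_onM U f g : open U -> smooth_on U f -> smooth_on U g ->
  smooth_on U (fun x => f x * g x).
Proof.
move=> oU /smooth_onP -/(_ oU) cf /smooth_onP -/(_ oU) cg.
by apply/smooth_onP => // k; exact: smoothclassM.
Qed.

Lemma smooth_on_continuous U f x : smooth_on U f -> U x -> {for x, continuous f}.
Proof. by move=> sf Ux; have [] := sf [::] x Ux. Qed.

Lemma smooth_on_derivable U f x i : smooth_on U f -> U x -> derivable f x (e_ i).
Proof. by move=> sf Ux; have [_] := sf [::] x Ux. Qed.

Lemma smooth_on_comp U (psi : nat -> R -> R) g : open U ->
  (forall x, U x -> forall j, is_derive (g x) 1 (psi j) (psi j.+1 (g x))) ->
  smooth_on U g -> forall j, smooth_on U (fun x => psi j (g x)).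
Proof.
move=> oU dpsi sg j; have /smooth_onP -/(_ oU) cg := sg.
apply/smooth_onP => // k.
apply: (@diffclass_comp _ _ _ _ _ _ _ _ _ _ _ _ psi (fun=> g)) => //.
- exact: Bext.
- exact: BD.
- exact: BM.
- move=> j0 x Ux; apply: continuous_comp; first exact: (smooth_on_continuous sg).
  apply: differentiable_continuous; apply/derivable1_diffP.
  by have [] := dpsi x Ux j0.
- exact: cg.
Qed.

Lemma smooth_on_cst U (a : R) : open U -> smooth_on U (fun=> a).
Proof.
move=> oU; apply/smooth_onP => // k.
apply: (@diffclass_cst _ _ _ _ _ _ _ _ _ k (fun=> a)) => //; first exact: Bext.
- by move=> x _; apply: cst_continuous.
- by move=> x _; apply: cst_continuous.
Qed.

Lemma smooth_onN U f : open U -> smooth_on U f -> smooth_on U (fun x => - f x).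
Proof.
move=> oU sf; apply: (@smooth_on_ext _ (fun x => (-1) * f x)) => //.
  by move=> x _; rewrite mulN1r.
exact (smooth_onM oU (smooth_on_cst _ oU) sf).
Qed.

Lemma smooth_onB U f g : open U -> smooth_on U f -> smooth_on U g ->
  smooth_on U (fun x => f x - g x).
Proof. by move=> oU sf sg; exact (smooth_onD oU sf (smooth_onN oU sg)). Qed.

Lemma smooth_on_sum U (I : Type) (r : seq I) (F : I -> 'rV[R]_n -> R) :
  open U -> (forall i, smooth_on U (F i)) ->
  smooth_on U (fun x => \sum_(i <- r) F i x).
Proof.
move=> oU sF; elim: r => [|i r ih].
  apply: (smooth_on_ext oU _ (smooth_on_cst 0 oU)) => x _; by rewrite big_nil.
apply: (smooth_on_ext oU _ (smooth_onD oU (sF i) ih)) => x _; by rewrite big_cons.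
Qed.

Lemma smooth_on_prod U (I : Type) (r : seq I) (F : I -> 'rV[R]_n -> R) :
  open U -> (forall i, smooth_on U (F i)) ->
  smooth_on U (fun x => \prod_(i <- r) F i x).
Proof.
move=> oU sF; elim: r => [|i r ih].
  apply: (smooth_on_ext oU _ (smooth_on_cst 1 oU)) => x _; by rewrite big_nil.
apply: (smooth_on_ext oU _ (smooth_onM oU (sF i) ih)) => x _; by rewrite big_cons.
Qed.

Lemma pderivs_rcons s i f : pderivs (rcons s i) f = pderivs s ('D_(e_ i) f).
Proof. by elim: s => //= j s ->. Qed.

Lemma smooth_on_pderiv U f i : smooth_on U f -> smooth_on U ('D_(e_ i) f).
Proof. by move=> sf s x Ux; have := sf (rcons s i) x Ux; rewrite pderivs_rcons. Qed.

Lemma smooth_on_pderivs U f s : smooth_on U f -> smooth_on U (pderivs s f).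
Proof.
by move=> sf; elim: s => [//|i s ih]; exact: smooth_on_pderiv ih.
Qed.

Lemma smooth_on_sub U V f : V `<=` U -> smooth_on U f -> smooth_on V f.
Proof. by move=> VU sf s x Vx; apply: sf; exact: VU. Qed.

Lemma smooth_on_setU U V f : smooth_on U f -> smooth_on V f -> smooth_on (U `|` V) f.
Proof. by move=> sU sV s x []; [exact: sU|exact: sV]. Qed.

Lemma is_derive_coord (i : 'I_n) x (v : 'rV[R]_n) :
  is_derive x v (fun y : 'rV[R]_n => y 0 i) (v 0 i).
Proof.
apply/is_derive_line0.
have -> : (fun h : R => (h *: v + x) 0 i) = (fun h : R => h * v 0 i + x 0 i).
  by apply/funext => h; rewrite !mxE.
apply: is_derive_eq; rewrite ?addr0 ?scaler0 ?add0r.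
by rewrite [_%:A]mulr1.
Qed.

Lemma smooth_on_coord U (i : 'I_n) : open U -> smooth_on U (fun x => x 0 i).
Proof.
move=> oU; apply/smooth_onP => // -[|k]; split => //.
- by move=> x Ux; exact: coord_continuous.
- by move=> x Ux; exact: coord_continuous.
- move=> j; split; first by move=> _ x _; have [] := is_derive_coord i x (e_ j).
  have /smooth_onP -/(_ oU k) := @smooth_on_cst U (e_ j 0 i) oU.
  apply: diffclass_ext => //; first exact: Bext.
  by move=> _ x Ux; have [_ ->] := is_derive_coord i x (e_ j).
Qed.

Lemma smooth_on_cos U f : open U -> smooth_on U f -> smooth_on U (fun x => cos (f x)).
Proof.
move=> oU sf.
(* The j-th derivative of the cosine is the cosine advanced by j quarter periods. *)
pose psi j (y : R) := cos (y + j%:R * (pi / 2)).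
suff : smooth_on U (fun x => psi 0%N (f x)).
  by apply: smooth_on_ext => // x _; rewrite /psi mul0r addr0.
apply: (smooth_on_comp oU) => // x _ j.
rewrite /psi; apply: is_derive_eq.
by rewrite -[in RHS]natr1 [in RHS]mulrDl mul1r addrA cosDpihalf addr0 mulr1.
Qed.

Lemma smooth_on_sin U f : open U -> smooth_on U f -> smooth_on U (fun x => sin (f x)).
Proof.
move=> oU sf.
apply: (@smooth_on_ext _ (fun x => cos (f x - pi / 2))) => //.
  by move=> x _; rewrite cosB cos_pihalf sin_pihalf mulr0 add0r mulr1.
exact (smooth_on_cos oU (smooth_onB oU sf (smooth_on_cst _ oU))).
Qed.

(** The sequence (-1)^j j! / z^(j+1) lists the successive derivatives of 1/z, in the form that the
    composition lemmas expect. *)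
Lemma is_derive_invpow j (z : R) : z != 0 ->
  is_derive z 1 (fun y : R => (-1) ^+ j * j`!%:R * (y ^+ j.+1)^-1)
    ((-1) ^+ j.+1 * j.+1`!%:R * (z ^+ j.+2)^-1).
Proof.
move=> z0; have zj0 : z ^+ j.+1 != 0 by rewrite expf_neq0.
have d1 : is_derive z 1 (fun y : R => y ^+ j.+1) (j.+1%:R * z ^+ j).
  have := is_deriveX j.+1 (is_derive_id z (1 : R)).
  by rewrite exprfctE /GRing.scale /= mulr1.
have d2 : is_derive z 1 (fun y : R => (y ^+ j.+1)^-1) (- (z ^+ j.+1) ^- 2 *: (j.+1%:R * z ^+ j)).
  exact: is_deriveV.
have d3 := @is_deriveZ _ _ _ _ ((-1) ^+ j * j`!%:R) _ _ _ d2.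
apply: (is_derive_eq d3).
rewrite factS natrM /GRing.scale /= !exprS.
have : z ^+ j != 0 by rewrite expf_neq0.
move: (z ^+ j) (j`!%:R : R) ((-1) ^+ j : R) (j.+1%:R : R) => a b c e a0; field.
by rewrite z0 a0.
Qed.

Lemma smooth_on_inv U f : open U -> (forall x, U x -> f x != 0) ->
  smooth_on U f -> smooth_on U (fun x => (f x)^-1).
Proof.
move=> oU f0 sf.
pose psi j (y : R) := (-1) ^+ j * j`!%:R * (y ^+ j.+1)^-1.
suff : smooth_on U (fun x => psi 0%N (f x)).
  by apply: smooth_on_ext => // x _; rewrite /psi fact0 expr0 !mul1r expr1.
apply: (smooth_on_comp oU) => // x Ux j; exact: is_derive_invpow (f0 x Ux).
Qed.

End smooth_functions.
(** The conjunct [0 < e] carries the content when [n = 0], where the condition on the coordinates is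
    void. *)
Lemma rV_norm_lt (R : realType) n (x : 'rV[R]_n) (e : R) :
  `|x| < e <-> 0 < e /\ forall i, `|x 0 i| < e.
Proof.
have -> : (`|x| < e) = (ball (0 : 'rV[R]_n) e x) :> Prop.
  by rewrite mx_norm_ball /ball_ /= sub0r normrN.
split=> [/ballrV[e0 H]|[e0 H]]; last apply/ballrV; split => // i.
  by have := H i; rewrite mxE sub0r normrN.
by rewrite mxE sub0r normrN.
Qed.

Lemma rV_norm_le (R : realType) n (x : 'rV[R]_n) (e : R) :
  `|x| <= e <-> 0 <= e /\ forall i, `|x 0 i| <= e.
Proof.
split=> [xe|[e0 H]].
  split=> [|i]; first exact: le_trans xe.
  have : forall r, 0 < r -> `|x 0 i| < e + r.
    move=> r r0; have /rV_norm_lt[_] : `|x| < e + r by rewrite (le_lt_trans xe)// ltrDl.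
    exact.
  by move=> h; apply/ler_addgt0Pr => r r0; exact/ltW/h.
apply/ler_addgt0Pr => r r0; apply/ltW/rV_norm_lt; split; first by rewrite ltr_wpDl.
by move=> i; rewrite (le_lt_trans (H i))// ltrDl.
Qed.

Lemma rV_norm_coord (R : realType) n (x : 'rV[R]_n) i : `|x 0 i| <= `|x|.
Proof. by have /rV_norm_le[] := lexx `|x|. Qed.

Lemma cvg_rsum (R : realType) (T I : Type) (F : set_system T) (FF : Filter F)
    (r : seq I) (f : I -> T -> R) (a : I -> R) :
  (forall i, f i x @[x --> F] --> a i) ->
  \sum_(i <- r) f i x @[x --> F] --> \sum_(i <- r) a i.
Proof.
move=> fa; elim: r => [|i r ih].
  by rewrite big_nil; under eq_fun do rewrite big_nil; exact: cvg_cst.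
rewrite big_cons; under eq_fun do rewrite big_cons.
by apply: cvgD; [exact: fa|exact: ih].
Qed.

(** * Mean value theorem and chain rule from partial derivatives *)

Section mean_value.
Context {R : realType} {n : nat}.
Local Notation e_ i := (delta_mx 0 i : 'rV[R]_n).

(** Walks from [x] to [y] parallel to the axes, changing one coordinate at a time, so that only
    partial derivatives enter; the increments telescope. The bound on [z k] keeps these points in
    every ball around [x] that contains [y]. *)
Lemma rV_mvt (F : 'rV[R]_n -> R) (x y : 'rV[R]_n) (e : R) :
  (forall z, ball x e z -> forall i, derivable F z (e_ i)) -> ball x e y ->
  exists z : 'I_n -> 'rV[R]_n,
    (forall k i, `|z k 0 i - x 0 i| <= `|y 0 i - x 0 i|) /\
    F y - F x = \sum_k (y 0 k - x 0 k) * 'D_(e_ k) F (z k).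
Proof.
move=> dF /ballrV[e0 xy].
pose p (j : nat) : 'rV[R]_n := \row_i (if (i < j)%N then y 0 i else x 0 i).
have H (k : 'I_n) : exists z : 'rV[R]_n,
    (forall i, `|z 0 i - x 0 i| <= `|y 0 i - x 0 i|) /\
    F (p k.+1) - F (p k) = (y 0 k - x 0 k) * 'D_(e_ k) F z.
  pose q (h : R) : 'rV[R]_n := h *: ((y 0 k - x 0 k) *: e_ k) + p k.
  have pE : p k.+1 = (y 0 k - x 0 k) *: e_ k + p k.
    apply/rowP => i; rewrite !mxE eqxx /= ltnS leq_eqVlt.
    have [->|ik] := eqVneq i k; first by rewrite eqxx ltnn mulr1 /=; lra.
    by rewrite (negbTE (ik : val i != val k)) /= mulr0 add0r.
  have qxy h i : 0 <= h <= 1 -> `|q h 0 i - x 0 i| <= `|y 0 i - x 0 i|.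
    move=> /andP[h0 h1]; rewrite !mxE eqxx /=.
    have [->|ik] := eqVneq i k.
      rewrite ltnn mulr1 addrK normrM ger0_norm//.
      by rewrite ler_piMl// normr_ge0.
    rewrite mulr0 mulr0 add0r; case: ifP => _ //.
    by rewrite subrr normr0.
  have Dq h : 0 <= h <= 1 ->
     is_derive (q h) ((y 0 k - x 0 k) *: e_ k) F ((y 0 k - x 0 k) * 'D_(e_ k) F (q h)).
    move=> h01; have dFq : derivable F (q h) (e_ k).
      apply: dF; apply/ballrV; split => // i.
      by rewrite distrC (le_lt_trans (qxy h i h01))// distrC.
    apply/is_derive_line0.
    have /is_derive_line0 d1 := derivableP dFq.
    have -> : (fun h0 : R => F (h0 *: ((y 0 k - x 0 k) *: e_ k) + q h)) =
        (fun h0 : R => F (h0 *: e_ k + q h)) \o (fun h0 => h0 * (y 0 k - x 0 k)).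
      by apply/funext => h0 /=; rewrite scalerA.
    rewrite mulrC; apply: is_derive1_comp; first by rewrite mul0r.
    have := @is_deriveM _ _ (@id R) (cst (y 0 k - x 0 k)) 0 1 _ _ (is_derive_id _ _) (is_derive_cst _ _ _).
    by move=> d2; apply: (is_derive_eq d2); rewrite scaler0 add0r /GRing.scale/= mulr1.
  have [c c01] := @MVT_line _ _ F (fun h => (y 0 k - x 0 k) * 'D_(e_ k) F (q h))
    (p k) ((y 0 k - x 0 k) *: e_ k) Dq.
  rewrite -pE => ->; exists (q c); split => // i; apply: qxy.
  by move: c01 => /andP[? ?]; rewrite !ltW.
have [z zP] := choice H; exists z; split; first by move=> k; have [] := zP k.
have py : p n = y by apply/rowP => i; rewrite mxE ltn_ord.
have px : p 0%N = x by apply/rowP => i; rewrite mxE.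
transitivity (F (p n) - F (p 0%N)); first by rewrite py px.
rewrite -(telescope_sumr (fun j => F (p j)) (leq0n n)) big_mkord.
by apply: eq_bigr => k _; have [_ ->] := zP k.
Qed.

End mean_value.

Section chain_rule.
Context {R : realType} {n : nat}.

(** The increment of [F] is expanded by [rV_mvt] at points that depend on the step [h]. These tend
    to [u x] as [h] tends to 0, and continuity of the partial derivatives of [F] gives the limit. *)
Lemma is_derive_chain (m : nat) (F : 'rV[R]_m -> R) (u : 'rV[R]_n -> 'rV[R]_m)
    (V : set 'rV[R]_m) x v (du : 'I_m -> R) :
  open V -> V (u x) -> smooth_on V F ->
  (forall k, is_derive x v (fun y => u y 0 k) (du k)) ->
  is_derive x v (F \o u) (\sum_k 'D_(delta_mx 0 k) F (u x) * du k).
Proof.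
move=> oV Vux sF Du.
have /nbhs_ballP[e /= e0 eV] : nbhs (u x) V by exact: open_nbhs_nbhs.
have cu (k : 'I_m) : (fun h : R => u (h *: v + x) 0 k) @ (0:R) --> u x 0 k.
  have /is_derive_line0[+ _] := Du k.
  move=> /derivable1_diffP/differentiable_continuous.
  by rewrite /prop_for /continuous_at /= scale0r add0r.
have ub r : 0 < r -> \forall h \near (0:R)^', ball (u x) r (u (h *: v + x)).
  move=> r0; apply: (@nbhs_dnbhs).
  have : \forall h \near (0:R), forall k : 'I_m, `|u x 0 k - u (h *: v + x) 0 k| < r.
    have cuk (k : 'I_m) : nbhs (0 : R) (fun h => `|u x 0 k - u (h *: v + x) 0 k| < r).
      by have /cvgrPdist_lt/(_ _ r0) := cu k.
    exact: (@filter_forall R _ _ (nbhs (0 : R)) _ cuk).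
  by apply: filterS => h H; apply/ballrV.
have H (h : R) : exists z : 'I_m -> 'rV[R]_m, ball (u x) e (u (h *: v + x)) ->
   (forall k i, `|z k 0 i - u x 0 i| <= `|u (h *: v + x) 0 i - u x 0 i|) /\
    F (u (h *: v + x)) - F (u x) =
   \sum_k (u (h *: v + x) 0 k - u x 0 k) * 'D_(delta_mx 0 k) F (z k).
  have [B|nB] := pselect (ball (u x) e (u (h *: v + x))); last by exists (fun=> 0).
  have [|z zP] := @rV_mvt _ _ F (u x) _ e _ B; last by exists z.
  by move=> z /eV Vz i; exact: smooth_on_derivable sF Vz.
have [z zP] := choice H.
have main : (fun h : R => h^-1 *: ((F \o u \o shift x) (h *: v) - (F \o u) x))
    @ (0:R)^' --> \sum_k 'D_(delta_mx 0 k) F (u x) * du k.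
  have E : \forall h \near (0:R)^',
    \sum_k (h^-1 *: (u (h *: v + x) 0 k - u x 0 k)) * 'D_(delta_mx 0 k) F (z h k) =
    h^-1 *: ((F \o u \o shift x) (h *: v) - (F \o u) x).
    apply: filterS (ub _ e0) => h /(zP h)[_ /= ->].
    by rewrite scaler_sumr; apply: eq_bigr => k _; rewrite scalerAl.
  apply: cvg_trans (near_eq_cvg E) _.
  apply: cvg_rsum => k; rewrite mulrC; apply: cvgM.
    have [+ <-] := Du k; rewrite /derive /derivable.
    by move=> /cvgP.
  have cD : {for u x, continuous ('D_(delta_mx 0 k) F)}.
    exact: smooth_on_continuous (smooth_on_pderiv k sF) Vux.
  apply: (cvg_comp (fun h => z h k) ('D_(delta_mx 0 k) F) _ cD).
  apply/cvgrPdist_lt => r r0 /=.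
  apply: filterS2 (ub _ e0) (ub _ r0) => h /(zP h)[zb _] /ballrV[_ Hr].
  apply/rV_norm_lt; split => // i.
  by rewrite !mxE distrC (le_lt_trans (zb k i))// distrC.
by split; [apply/cvg_ex; eexists; exact: main | exact: (cvg_lim _ main)].
Qed.

End chain_rule.

(** * Smooth cutoff functions *)

Section bump.
Context {R : realType}.

(** A class of functions that contains e^{-1/x}, extended by 0, and is closed under differentiation;
    [P] records the polynomial in 1/x in front. *)
Definition flat (P : {poly R}) (x : R) : R :=
  if 0 < x then P.[x^-1] * expR (- x^-1) else 0.

(** With u = y / (k+1), this is the inequality u e^{-u} <= 1 raised to the power k+1. *)
Lemma expRN_exp_bound (k : nat) (y : R) : 0 < y ->
  y ^+ k.+1 * expR (- y) <= k.+1%:R ^+ k.+1.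
Proof.
move=> y0; pose u := y / k.+1%:R.
have u0 : 0 < u by rewrite divr_gt0.
have -> : y = u * k.+1%:R by rewrite /u divfK// pnatr_eq0.
rewrite -mulNr expRM_natr exprMn mulrAC -exprMn ler_piMl ?exprn_ge0//.
have uE : 0 <= u * expR (- u) by rewrite mulr_ge0 ?expR_ge0// (ltW u0).
rewrite exprn_ile1// expRN ler_pdivrMr ?expR_gt0// mul1r.
by apply: le_trans (expR_ge1Dx u); rewrite lerDr.
Qed.

Lemma expRN_poly_bound (P : {poly R}) :
  exists2 C : R, 0 <= C & forall y : R, 0 < y -> `|P.[y]| * expR (- y) <= C.
Proof.
exists (\sum_(i < size P) `|P`_i| * (1 + i%:R ^+ i)).
  by apply: sumr_ge0 => i _; rewrite mulr_ge0// addr_ge0// exprn_ge0.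
move=> y y0; rewrite horner_coef.
apply: le_trans (ler_wpM2r (expR_ge0 _) (ler_norm_sum _ _ _)) _.
rewrite mulr_suml; apply: ler_sum => i _.
rewrite normrM -mulrA ler_wpM2l// ger0_norm ?exprn_ge0 ?(ltW y0)//.
case: (nat_of_ord i) => [|k].
  rewrite !expr0 mul1r; apply: (@le_trans _ _ 1); last by rewrite lerDl.
  by rewrite -expR0 ler_expR oppr_le0 (ltW y0).
by rewrite (le_trans (expRN_exp_bound k y0))// lerDr.
Qed.

(** Applying the polynomial bound to [P * 'X^2] gains the factor [x ^+ 2], which makes the
    difference quotient of [flat P] at 0 tend to 0. *)
Lemma flat_bound (P : {poly R}) :
  exists2 C : R, 0 <= C & forall x : R, `|flat P x| <= C * x ^+ 2.
Proof.
have [C C0 PC] := expRN_poly_bound (P * 'X^2).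
exists C => // x; rewrite /flat; case: ifPn => [x0|_]; last first.
  by rewrite normr0 mulr_ge0// sqr_ge0.
have xV : 0 < x^-1 by rewrite invr_gt0.
have := PC _ xV; rewrite hornerM hornerXn normrM.
rewrite (ger0_norm (exprn_ge0 2 (ltW xV))).
rewrite normrM (ger0_norm (expR_ge0 _)) exprVn mulrAC.
by rewrite ler_pdivrMr ?exprn_gt0.
Qed.

Lemma is_derive_flat (P : {poly R}) (x : R) :
  is_derive x 1 (flat P) (flat ('X^2 * (P - P^`())) x).
Proof.
have [x0|x0|x0] := ltgtP x 0.
- rewrite {2}/flat ltNge (ltW x0) /=.
  apply: (@near_is_derive _ _ (cst (0 : R)) _ x 1 0).
  have : nbhs x [set y : R | y < 0].
    by apply: open_nbhs_nbhs; split.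
  by apply: filterS => y y0; rewrite /flat ltNge (ltW y0).
- rewrite {2}/flat x0.
  have xn0 : x != 0 by rewrite gt_eqF.
  apply: (@near_is_derive _ _ ((fun y => P.[y] * expR (- y)) \o (fun y => y^-1))).
    have : nbhs x [set y : R | 0 < y].
      by apply: open_nbhs_nbhs; split.
    by apply: filterS => y y0; rewrite /flat y0.
  have d1 : is_derive x^-1 1 (fun y => P.[y] * expR (- y))
      ((P^`().[x^-1] - P.[x^-1]) * expR (- x^-1)).
    have dP := is_derive_poly P x^-1.
    have dE : is_derive x^-1 1 (fun y => expR (- y)) (- expR (- x^-1)).
      by apply: is_derive_eq; rewrite mulrN1.
    have d0 := @is_deriveM _ _ _ _ _ _ _ _ dP dE.
    by apply: (is_derive_eq d0); rewrite /GRing.scale /=; ring.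
  have d2 : is_derive x 1 (fun y : R => y^-1) (- x ^- 2).
    have := @is_deriveV R id x 1 1 xn0 (is_derive_id _ _).
    by rewrite /GRing.scale /= mulr1.
  have d3 := is_derive1_comp d1 d2.
  apply: (is_derive_eq d3).
  by rewrite hornerM hornerXn hornerD hornerN exprVn; ring.
- subst x; rewrite {2}/flat ltxx.
  have [C C0 fC] := flat_bound P.
  have f0 : flat P 0 = 0 by rewrite /flat ltxx.
  have main : (fun h : R => h^-1 *: ((flat P \o shift 0) (h *: 1) - flat P 0))
     @ (0 : R)^' --> (0 : R).
    apply/cvgrPdist_le => /= e e0.
    have : nbhs (0 : R) [set h : R | `|h| < e / (C + 1)].
      apply/nbhs_ballP; exists (e / (C + 1)); first by rewrite /= divr_gt0// ltr_wpDl.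
      by move=> h; rewrite /ball /= sub0r normrN.
    move=> /nbhs_dnbhs; apply: filterS2 (nbhs_dnbhs_neq (0 : R)) => h h0 /= he.
    rewrite sub0r normrN f0 subr0 addr0 [h *: 1]mulr1 /GRing.scale /= normrM normfV.
    rewrite mulrC ler_pdivrMr ?normr_gt0//.
    apply: le_trans (fC h) _.
    rewrite -[h ^+ 2]real_normK ?num_real// expr2 mulrA ler_wpM2r//.
    rewrite (le_trans (ler_wpM2l C0 (ltW he)))// mulrCA ler_piMr ?(ltW e0)//.
    by rewrite ler_pdivrMr ?ltr_wpDl// mul1r lerDl.
  by split; [apply/cvg_ex; eexists; exact: main | exact: (cvg_lim _ main)].
Qed.

(* The derivative of P(1/x) e^{-1/x} is Q(1/x) e^{-1/x} with Q = X^2 (P - P'). *)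
Definition flatseq (j : nat) : {poly R} := iter j (fun P => 'X^2 * (P - P^`())) 1.

Definition bump1 (x : R) : R := flat 1 (1 - x) * flat 1 (1 + x).

Lemma flat_ge0 (x : R) : 0 <= flat 1 x.
Proof. by rewrite /flat; case: ifP => // _; rewrite hornerC mul1r expR_ge0. Qed.

Lemma bump1_ge0 x : 0 <= bump1 x.
Proof. by rewrite mulr_ge0 ?flat_ge0. Qed.

Lemma bump1_eq0 x : 1 <= `|x| -> bump1 x = 0.
Proof.
rewrite ler_normr /bump1 /flat => /orP[x1|x1].
  by rewrite (_ : 0 < 1 - x = false) ?mul0r//; apply/negbTE; rewrite -leNgt subr_le0.
rewrite (_ : 0 < 1 + x = false) ?mulr0//; apply/negbTE.
by rewrite -leNgt -(opprK x) subr_le0.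
Qed.

Lemma bump1_gt0 : 0 < bump1 0.
Proof. by rewrite /bump1 /flat subr0 addr0 ltr01 hornerC mul1r mulr_gt0 ?expR_gt0. Qed.

Context {n : nat}.
Implicit Types U : set 'rV[R]_n.

Lemma smooth_on_flat U f : open U -> smooth_on U f ->
  smooth_on U (fun x => flat 1 (f x)).
Proof.
move=> oU sf.
apply: (@smooth_on_comp _ _ U (fun j => flat (flatseq j)) f oU _ sf 0%N) => x _ j.
exact: is_derive_flat.
Qed.

Definition bump (x0 : 'rV[R]_n) (r : R) (x : 'rV[R]_n) : R :=
  \prod_(i < n) bump1 ((x 0 i - x0 0 i) / r).

Lemma smooth_bump U x0 r : open U -> smooth_on U (bump x0 r).
Proof.
move=> oU; apply: (smooth_on_prod _ oU) => i.
have s1 : smooth_on U (fun x => (x 0 i - x0 0 i) / r).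
  exact (smooth_onM oU (smooth_onB oU (smooth_on_coord i oU) (smooth_on_cst _ oU))
    (smooth_on_cst _ oU)).
exact (smooth_onM oU
  (smooth_on_flat oU (smooth_onB oU (smooth_on_cst _ oU) s1))
  (smooth_on_flat oU (smooth_onD oU (smooth_on_cst _ oU) s1))).
Qed.

Lemma bump_ge0 x0 r x : 0 <= bump x0 r x.
Proof. by apply: prodr_ge0 => i _; exact: bump1_ge0. Qed.

Lemma bump_gt0 x0 r : 0 < bump x0 r x0.
Proof. by apply: prodr_gt0 => i _; rewrite subrr mul0r bump1_gt0. Qed.

Lemma bump_eq0 x0 r x : 0 < r -> r <= `|x - x0| -> bump x0 r x = 0.
Proof.
move=> r0 rx; have [i xi] : exists i, r <= `|x 0 i - x0 0 i|.
  apply: contrapT => /forallNP H.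
  suff : `|x - x0| < r by rewrite ltNge rx.
  apply/rV_norm_lt; split => // i; rewrite !mxE ltNge; apply/negP; exact: H.
rewrite /bump (bigD1 i)//= bump1_eq0 ?mul0r//.
by rewrite normrM normfV (gtr0_norm r0) ler_pdivlMr// mul1r.
Qed.

End bump.
(** * Fourier inversion for test functions *)

Section dotp_theory.
Context {R : realType} {n : nat}.
Implicit Types x y v : 'rV[R]_n.
Local Notation e_ i := (delta_mx 0 i : 'rV[R]_n).

Lemma dotpC x y : dotp x y = dotp y x.
Proof. by apply: eq_bigr => i _; rewrite mulrC. Qed.

Lemma dotpDr x y v : dotp x (y + v) = dotp x y + dotp x v.
Proof. by rewrite -big_split; apply: eq_bigr => i _; rewrite mxE mulrDr. Qed.

Lemma dotpZr x a y : dotp x (a *: y) = a * dotp x y.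
Proof. by rewrite mulr_sumr; apply: eq_bigr => i _; rewrite mxE mulrCA. Qed.

Lemma dotpNr x y : dotp x (- y) = - dotp x y.
Proof. by rewrite -scaleN1r dotpZr mulN1r. Qed.

Lemma dotpDl x y v : dotp (x + y) v = dotp x v + dotp y v.
Proof. by rewrite dotpC dotpDr ![dotp v _]dotpC. Qed.

Lemma dotpZl x a y : dotp (a *: x) y = a * dotp x y.
Proof. by rewrite dotpC dotpZr dotpC. Qed.

Lemma dotpNl x y : dotp (- x) y = - dotp x y.
Proof. by rewrite dotpC dotpNr dotpC. Qed.

Lemma dotp_delta x i : dotp x (e_ i) = x 0 i.
Proof.
rewrite /dotp (bigD1 i)//= big1 ?addr0 ?mxE ?eqxx ?mulr1// => j ji.
by rewrite mxE (negbTE ji) andbF mulr0.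
Qed.

Lemma is_derive_dotp x y v : is_derive y v (dotp x) (dotp x v).
Proof.
apply/is_derive_line0.
have -> : (fun h : R => dotp x (h *: v + y)) = (fun h : R => h * dotp x v + dotp x y).
  by apply/funext => h; rewrite dotpDr dotpZr.
apply: is_derive_eq; rewrite ?addr0 ?scaler0 ?add0r.
by rewrite [_%:A]mulr1.
Qed.

Lemma smooth_on_dotp U x : open U -> smooth_on U (dotp x).
Proof.
move=> oU; apply: (smooth_on_sum _ oU) => i.
exact (smooth_onM oU (smooth_on_cst _ oU) (smooth_on_coord i oU)).
Qed.

Lemma smooth_on_phase U x th : open U -> smooth_on U (fun y => dotp x y + th).
Proof. by move=> oU; exact (smooth_onD oU (smooth_on_dotp x oU) (smooth_on_cst _ oU)). Qed.

Lemma measurable_dotp : measurable_fun setT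
  (fun z : 'rV[R]_n * 'rV[R]_n => dotp z.1 z.2).
Proof.
rewrite (_ : (fun _ => _) = (fun z : 'rV[R]_n * 'rV[R]_n =>
  \sum_(i <- index_enum 'I_n) (rV_coord i z.1 * rV_coord i z.2)))//.
apply: measurable_sum => i; apply: measurable_funM.
  exact: measurableT_comp (measurable_rV_coord i) measurable_fst.
exact: measurableT_comp (measurable_rV_coord i) measurable_snd.
Qed.

End dotp_theory.

Section test_functions.
Context {R : realType} {n : nat}.
Implicit Types (x y v : 'rV[R]_n) (G f : 'rV[R]_n -> R).
Local Notation e_ i := (delta_mx 0 i : 'rV[R]_n).
Local Notation lam := (lebesgue_rV R n).
Local Notation integ f := (lam.-integrable setT (EFin \o f)).

Definition test G := smooth_on setT G /\
  exists r : R, forall x, r <= `|x| -> G x = 0.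

Lemma support_decay (M r : R) f : 0 <= M -> (forall x, `|f x| <= M) ->
  (forall x, r <= `|x| -> f x = 0) ->
  forall x, `|f x| <= M * (1 + r ^+ 2) ^+ n * decay x.
Proof.
move=> M0 fM f0 x; have [rx|xr] := leP r `|x|.
  rewrite f0// normr0 mulr_ge0// ?(ltW (decay_gt0 _))// mulr_ge0// exprn_ge0//.
  by rewrite ltW// oneDsqr_gt0'.
apply: (le_trans (fM x)); rewrite -mulrA ler_peMr// /decay prodfV.
rewrite ler_pdivlMr ?mul1r; last by apply: prodr_gt0 => i _; exact: oneDsqr_gt0'.
rewrite -[X in _ <= _ ^+ X]card_ord -prodr_const; apply: ler_prod => i _.
rewrite ltW ?oneDsqr_gt0'//= lerD2l -[x 0 i ^+ 2]real_normK ?num_real//.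
have xi := rV_norm_coord x i.
by rewrite lerXn2r ?nnegrE// ?(le_trans xi (ltW xr))// (le_trans _ (ltW xr)).
Qed.

Lemma continuous_ball_bounded f (r : R) : continuous f ->
  exists2 M : R, 0 <= M & forall x, `|x| <= r -> `|f x| <= M.
Proof.
move=> cf.
have K : compact [set x : 'rV[R]_n | forall i, [set` `[- r, r]] (x ord0 i)].
  by apply: (@rV_compact R n (fun=> [set` `[- r, r]])) => i; exact: segment_compact.
have : compact (f @` [set x : 'rV[R]_n | forall i, [set` `[- r, r]] (x ord0 i)]).
  by apply: continuous_compact => //; exact: continuous_subspaceT.
move=> /compact_bounded[M [_ HM]]; exists (`|M| + 1); first by rewrite addr_ge0.
move=> x xr; apply: (HM (`|M| + 1)); first by rewrite ltr_pwDr// ler_norm.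
exists x => // i /=; rewrite in_itv/= -ler_norml.
exact: le_trans (rV_norm_coord x i) xr.
Qed.

Lemma smooth_continuous f : smooth_on setT f -> continuous f.
Proof. by move=> sf x; exact: smooth_on_continuous sf I. Qed.

Lemma test_support G : test G -> exists2 r : R, 0 <= r & forall x, r <= `|x| -> G x = 0.
Proof.
move=> [_ [r Gr]]; exists `|r| => // x rx; apply: Gr.
exact: le_trans (ler_norm _) rx.
Qed.

Lemma test_bounded G : test G -> exists2 M : R, 0 <= M & forall x, `|G x| <= M.
Proof.
move=> tG; have [r r0 Gr] := test_support tG.
have [M M0 GM] := continuous_ball_bounded r (smooth_continuous tG.1).
exists M => // x; have [xr|/ltW/Gr->] := leP `|x| r; first exact: GM.
by rewrite normr0.
Qed.

Lemma test_decay G : test G -> exists2 C : R, 0 <= C & forall x, `|G x| <= C * decay x.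
Proof.
move=> tG; have [r r0 Gr] := test_support tG; have [M M0 GM] := test_bounded tG.
exists (M * (1 + r ^+ 2) ^+ n); last exact: support_decay.
by rewrite mulr_ge0// exprn_ge0// ltW// oneDsqr_gt0'.
Qed.

Lemma test_measurable G : test G -> measurable_fun setT G.
Proof. by move=> [sG _]; apply: continuous_measurable_rV; exact: smooth_continuous. Qed.

Lemma test_integrable G : test G -> integ G.
Proof.
move=> tG; have [C _ GC] := test_decay tG.
exact: decay_integrable (test_measurable tG) GC.
Qed.

Lemma testM G f : test G -> smooth_on setT f -> test (fun x => G x * f x).
Proof.
move=> [sG [r Gr]] sf; split; first exact (smooth_onM openT sG sf).
by exists r => x rx; rewrite Gr// mul0r.
Qed.

Lemma norm_gt_open (r : R) : open [set x : 'rV[R]_n | r < `|x|].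
Proof.
have : open ((fun x : 'rV[R]_n => `|x|) @^-1` [set y : R | r < y]); last exact.
by apply: open_comp => [x _|]; [exact: norm_continuous|exact: open_gt].
Qed.

Lemma test_pderiv G i : test G -> test ('D_(e_ i) G).
Proof.
move=> [sG [r Gr]]; split; first exact: smooth_on_pderiv.
exists (r + 1) => x rx; rewrite -(derive_cst (0 : R) x (e_ i)).
apply: near_eq_derive.
have : nbhs x [set y | r < `|y|].
  apply: open_nbhs_nbhs; split; first exact: norm_gt_open.
  by rewrite /= (lt_le_trans _ rx)// ltrDl.
by apply: filterS => y /= /ltW ry; rewrite Gr.
Qed.

Lemma pderivs_shift l f v :
  pderivs l (fun x => f (x + v)) = (fun x => pderivs l f (x + v)).
Proof.
elim: l => [//|i l ih] /=; rewrite ih; apply/funext => x.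
rewrite /derive; set a := (fun h : R => _); set b := (fun h : R => _).
by suff -> : a = b by []; apply/funext => h; rewrite /a /b /= addrA.
Qed.

Lemma smooth_on_shift U f v : smooth_on U f ->
  smooth_on [set x | U (x + v)] (fun x => f (x + v)).
Proof.
move=> sf l x Ux; rewrite pderivs_shift; have [c d] := sf l (x + v) Ux; split.
  apply: (@continuous_comp _ _ _ (fun x => x + v) (pderivs l f)) => //.
  exact: (cvgD cvg_id (cvg_cst v)).
move=> i; move: (d i); rewrite /derivable.
have -> // : (fun h : R => h^-1 *: ((pderivs l f \o shift (x + v)) (h *: e_ i) - pderivs l f (x + v)))
  = (fun h : R => h^-1 *: (((fun x => pderivs l f (x + v)) \o shift x) (h *: e_ i) - pderivs l f (x + v))).
by apply/funext => h /=; rewrite addrA.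
Qed.

Lemma test_shift G v : test G -> test (fun x => G (x + v)).
Proof.
move=> tG; have [r r0 Gr] := test_support tG; split.
  by apply: (smooth_on_sub _ (smooth_on_shift (v := v) tG.1)) => x _.
exists (r + `|v|) => x rx; apply: Gr.
rewrite -(lerD2r `|v|) (le_trans rx)//.
by rewrite -{1}(addrK v x) (le_trans (ler_normB _ _)).
Qed.

Lemma is_derive_Rintegral (f df : R -> 'rV[R]_n -> R) (g : 'rV[R]_n -> R) :
  (forall h, `|h| < 1 -> integ (f h)) ->
  (forall h x, `|h| < 1 -> is_derive h (1 : R) (f ^~ x) (df h x)) ->
  integ g -> (forall h x, `|h| < 1 -> `|df h x| <= g x) ->
  is_derive (0 : R) (1 : R) (fun h => \int[lam]_x f h x) (\int[lam]_x df 0 x).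
Proof.
move=> fi fd gi dfg.
have I01 (h : R) : `]-1, 1[%classic h -> `|h| < 1.
  by move=> /=; rewrite in_itv/= => /andP[a b]; rewrite ltr_norml a b.
have I0 : `]-1, 1[%classic (0 : R) by rewrite /= in_itv/= ltrN10 ltr01.
have g0 x : 0 <= g x by apply: le_trans (dfg 0 x _); rewrite ?normr0.
have E h x : `|h| < 1 -> partial1of2 f h x = df h x.
  by move=> h1; rewrite partial1of2E; have [_ ->] := fd h x h1.
have H := @cvg_differentiation_under_integral R _ _ lam f setT measurableT 0 (-1) 1
  I0 (fun h Ih => fi h (I01 h Ih))
  (fun h x Ih _ => @ex_derive _ _ _ _ _ _ _ (fd h x (I01 h Ih))) g g0 gi.
have {}H : h^-1 *: (\int[lam]_x f (h + 0) x - \int[lam]_x f 0 x) @[h --> 0^'] -->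
    \int[lam]_x df 0 x.
  have E0 : \int[lam]_x partial1of2 f 0 x = \int[lam]_x df 0 x.
    by apply: eq_Rintegral => x _; rewrite E// normr0.
  rewrite -E0; apply: H => h x Ih _; rewrite E ?I01//; apply: dfg; exact: I01.
have {}H : h^-1 *: (((fun h => \int[lam]_x f h x) \o shift 0) (h *: 1) - \int[lam]_x f 0 x) @[h --> 0^'] -->
    \int[lam]_x df 0 x.
  apply: cvg_trans H; apply: near_eq_cvg; near=> h => /=.
  by rewrite [h *: 1]mulr1.
by split; [apply/cvg_ex; eexists; exact: H | exact: (cvg_lim _ H)].
Unshelve. all: by end_near. Qed.

(** By translation invariance the integral of [G] shifted by h along the i-th axis does not depend
    on h; differentiating under the integral at h = 0 gives the claim. The radius r + 1 in the
    domination covers all shifts with |h| < 1. *)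
Lemma Rintegral_pderiv G i : test G -> \int[lam]_x ('D_(e_ i) G x) = 0.
Proof.
move=> tG; have tD := test_pderiv i tG.
have [r r0 Dr] := test_support tD; have [M M0 DM] := test_bounded tD.
have dG x : derivable G x (e_ i) by exact: smooth_on_derivable tG.1 I.
pose f (h : R) x := G (h *: e_ i + x).
have fE h : f h = fun x => G (x + h *: e_ i).
  by apply/funext => x; rewrite /f addrC.
have fi h : integ (f h) by rewrite fE; apply: test_integrable; exact: test_shift.
have df h x : is_derive h (1 : R) (f ^~ x) ('D_(e_ i) G (h *: e_ i + x)).
  exact: (proj1 (is_derive_line G x (e_ i) h _) (derivableP (dG _))).
have n1 (h : R) : `|h| < 1 -> `|h *: e_ i| <= 1.
  move=> h1; apply/rV_norm_le; split => // j; rewrite !mxE normrM.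
  by rewrite -[leRHS]mulr1 ler_pM// ?(ltW h1)//; case: (_ && _); rewrite ?normr1 ?normr0.
have H := @is_derive_Rintegral f (fun h x => 'D_(e_ i) G (h *: e_ i + x))
   (fun x => M * (1 + (r + 1) ^+ 2) ^+ n * decay x)
   (fun h _ => fi h) (fun h x _ => df h x).
have {}H : is_derive (0 : R) (1 : R) (fun h => \int[lam]_x f h x)
    (\int[lam]_x 'D_(e_ i) G (0 *: e_ i + x)).
  apply: H.
    apply: (@decay_integrable _ _ _ (M * (1 + (r + 1) ^+ 2) ^+ n)).
      apply: measurable_funM => //; exact: measurable_decay.
    move=> x; rewrite ger0_norm// mulr_ge0// ?(ltW (decay_gt0 _))//.
    by rewrite mulr_ge0// exprn_ge0// ltW// oneDsqr_gt0'.
  move=> h x h1.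
  have := @support_decay M (r + 1) (fun x => 'D_(e_ i) G (h *: e_ i + x)) M0.
  apply=> [{}x|{}x rx]; first exact: DM.
  apply: Dr; rewrite -(lerD2r 1) (le_trans rx)//.
  rewrite -{1}(addKr (h *: e_ i) x) addrC (le_trans (ler_normB _ _))//.
  by rewrite lerD2l n1.
have {H}[_ H] := H.
have E : (fun h => \int[lam]_x f h x) = cst (\int[lam]_x G x).
  by apply/funext => h; rewrite fE Rintegral_shift//; exact: test_integrable.
move: H; rewrite E derive_cst => ->.
by apply: eq_Rintegral => x _; rewrite scale0r add0r.
Qed.

End test_functions.

(** * Fourier integrals of test functions: smoothness, decay and inversion *)

Section oscillatory_integral.
Context {R : realType} {n : nat}.
Implicit Types (x y v : 'rV[R]_n) (G f : 'rV[R]_n -> R) (th : R).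
Local Notation e_ i := (delta_mx 0 i : 'rV[R]_n).
Local Notation lam := (lebesgue_rV R n).
Local Notation integ f := (lam.-integrable setT (EFin \o f)).

(* The real part of the Fourier integral of [G] for [th = 0], and its imaginary
   part for [th = - pi / 2]. *)
Definition oscint th G x : R := \int[lam]_y (G y * cos (dotp x y + th)).

Lemma smooth_phase_cos x th : smooth_on setT (fun y => cos (dotp x y + th)).
Proof. exact (smooth_on_cos openT (smooth_on_phase x th openT)). Qed.

Lemma test_oscint x th G : test G -> test (fun y => G y * cos (dotp x y + th)).
Proof. by move=> tG; exact (testM tG (smooth_phase_cos x th)). Qed.

Lemma test_coord G i : test G -> test (fun y => G y * y 0 i).
Proof. by move=> tG; exact (testM tG (smooth_on_coord i openT)). Qed.

Lemma norm_cos_le1 (a : R) : `|cos a| <= 1.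
Proof. by rewrite ler_norml cos_geN1 cos_le1. Qed.

Lemma oscint_bound th G x : test G -> `|oscint th G x| <= \int[lam]_y `|G y|.
Proof.
move=> tG; have iG := test_integrable (test_oscint x th tG).
apply: le_trans (le_normr_Rintegral measurableT iG) _.
apply: le_Rintegral => //.
- exact: integrable_norm iG.
- exact: integrable_norm (test_integrable tG).
- by move=> y _; rewrite normrM ler_piMr// norm_cos_le1.
Qed.

(** The minus sine that appears is a cosine advanced by a quarter period, so the family of functions
    [oscint] is closed under differentiation. *)
Lemma is_derive_oscint th G x i : test G ->
  is_derive x (e_ i) (oscint th G) (oscint (th + pi / 2) (fun y => G y * y 0 i) x).
Proof.
move=> tG; have tGi := test_coord i tG.
have H := @is_derive_Rintegral R n (fun h y => G y * cos (dotp (h *: e_ i + x) y + th))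
  (fun h y => G y * y 0 i * cos (dotp (h *: e_ i + x) y + (th + pi / 2)))
  (fun y => `|G y * y 0 i|).
apply/is_derive_line0.
rewrite (_ : oscint _ _ x = \int[lam]_y (G y * y 0 i * cos (dotp (0 *: e_ i + x) y + (th + pi / 2)))); last first.
  by rewrite scale0r add0r.
apply: H.
- by move=> h _; apply: test_integrable; exact: test_oscint.
- move=> h y _.
  have -> : (fun h : R => G y * cos (dotp (h *: e_ i + x) y + th)) =
    (fun h => G y * cos (h * y 0 i + (dotp x y + th))).
    by apply/funext => k; rewrite dotpDl dotpZl [dotp (e_ i) _]dotpC dotp_delta addrA.
  rewrite dotpDl dotpZl [dotp (e_ i) _]dotpC dotp_delta addrA cosDpihalf.
  have d1 : is_derive h 1 (fun h : R => h * y 0 i + (dotp x y + th)) (y 0 i).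
    apply: is_derive_eq; rewrite ?addr0 ?scaler0 ?add0r.
    by rewrite [_%:A]mulr1.
  have d2 := is_derive1_comp (is_derive_cos _) d1.
  have d3 := @is_deriveZ _ _ _ _ (G y) _ _ _ d2.
  by apply: (is_derive_eq d3); rewrite /GRing.scale /= addrA; ring.
- exact: integrable_norm (test_integrable tGi).
- by move=> h y _; rewrite normrM ler_piMr// norm_cos_le1.
Qed.

(** Integration by parts: the partial derivative of [G] times the sine of the phase is a total
    derivative of a test function, so its integral vanishes. *)
Lemma oscint_coord th G x i : test G ->
  x 0 i * oscint th G x = oscint (th + pi / 2) ('D_(e_ i) G) x.
Proof.
move=> tG; have tD := test_pderiv i tG.
pose s y := sin (dotp x y + th).
have ss : smooth_on setT s by exact (smooth_on_sin openT (smooth_on_phase x th openT)).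
have tH := testM tG ss.
have dH y : 'D_(e_ i) (fun y => G y * s y) y =
    x 0 i * (G y * cos (dotp x y + th)) - 'D_(e_ i) G y * cos (dotp x y + (th + pi / 2)).
  have dG : is_derive y (e_ i) G ('D_(e_ i) G y).
    exact: (derivableP (smooth_on_derivable tG.1 I)).
  have dd : is_derive y (e_ i) (fun y => dotp x y + th) (x 0 i).
    have d1 := is_derive_dotp x y (e_ i).
    have d2 := @is_deriveD _ _ _ _ _ _ _ _ _ d1 (is_derive_cst th y (e_ i)).
    by apply: (is_derive_eq d2); rewrite addr0 dotp_delta.
  have ds : is_derive y (e_ i) s (cos (dotp x y + th) * x 0 i).
    exact: (is_derive_chain1 (is_derive_sin _) dd).
  have d3 := @is_deriveM _ _ _ _ _ _ _ _ dG ds.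
  have [_ ->] := d3.
  by rewrite /GRing.scale /= addrA cosDpihalf /s; ring.
have := Rintegral_pderiv i tH.
under eq_Rintegral do rewrite dH.
have i1 := test_integrable (test_oscint x th tG).
rewrite RintegralB//.
- by rewrite RintegralZl// => /eqP; rewrite subr_eq0 => /eqP.
- have := test_integrable (testM (test_oscint x th tG) (smooth_on_cst (x 0 i) openT)).
  by under eq_fun do rewrite mulrC.
- exact: test_integrable (test_oscint _ _ tD).
Qed.

Lemma bounded_pderiv_continuous f (C : 'I_n -> R) :
  (forall x i, derivable f x (e_ i)) -> (forall x i, `|'D_(e_ i) f x| <= C i) ->
  continuous f.
Proof.
move=> df fC x; apply/(@cvgrPdist_lt _ _ _ (nbhs x) _) => e e0.
pose K := \sum_i C i.
have C0 i : 0 <= C i by exact: le_trans (fC 0 i).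
have K0 : 0 <= K by apply: sumr_ge0.
have : nbhs x (ball x (e / (K + 1))).
  by apply: nbhsx_ballx; rewrite divr_gt0// ltr_wpDl.
apply: filterS => y xy.
have [z [_ E]] := rV_mvt (fun z _ i => df z i) xy.
rewrite distrC E; apply: (@le_lt_trans _ _ (e / (K + 1) * K)).
  apply: le_trans (ler_norm_sum _ _ _) _; rewrite mulr_sumr; apply: ler_sum => k _.
  rewrite normrM ler_pM//; move/ballrV: xy => [_ /(_ k)]; rewrite distrC => /ltW; exact.
by rewrite -mulrA gtr_pMr// ltr_pdivrMl ?mulr1 ?ltrDl ?ltr_wpDl.
Qed.

Lemma continuous_oscint th G : test G -> continuous (oscint th G).
Proof.
move=> tG; apply: (@bounded_pderiv_continuous _ (fun i => \int[lam]_y `|G y * y 0 i|)).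
  by move=> x i; have [] := is_derive_oscint th x i tG.
move=> x i; have [_ ->] := is_derive_oscint th x i tG.
by apply: oscint_bound; exact: test_coord.
Qed.

Lemma pderivs_oscint th G s : test G ->
  exists th' G', test G' /\ pderivs s (oscint th G) = oscint th' G'.
Proof.
move=> tG; elim: s => [|i s [th' [G' [tG' E]]]]; first by exists th, G.
exists (th' + pi / 2), (fun y => G' y * y 0 i); split; first exact: test_coord.
by apply/funext => x; rewrite /= E; have [_ ->] := is_derive_oscint th' x i tG'.
Qed.

Lemma smooth_oscint th G : test G -> smooth_on setT (oscint th G).
Proof.
move=> tG s x _; have [th' [G' [tG' ->]]] := pderivs_oscint th s tG.
split; first exact: continuous_oscint.
by move=> i; have [] := is_derive_oscint th' x i tG'.
Qed.

(** Two integrations by parts in the i-th variable produce the square of the i-th coordinate;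
    summing over i yields one factor [dotp x x]. *)
Lemma oscint_dotp_decay k th G : test G ->
  exists2 C : R, 0 <= C & forall x, dotp x x ^+ k * `|oscint th G x| <= C.
Proof.
elim: k th G => [|k ih] th G tG.
  exists (\int[lam]_y `|G y|); first by apply: Rintegral_ge0.
  by move=> x; rewrite expr0 mul1r; exact: oscint_bound.
have /choice[C CP] (i : 'I_n) : exists C : R, 0 <= C /\ forall x,
   dotp x x ^+ k * `|oscint (th + pi / 2 + pi / 2) ('D_(e_ i) ('D_(e_ i) G)) x| <= C.
  have [C C0 HC] := ih (th + pi / 2 + pi / 2) _ (test_pderiv i (test_pderiv i tG)).
  by exists C.
exists (\sum_i C i); first by apply: sumr_ge0 => i _; have [] := CP i.
move=> x; rewrite exprSr -mulrA.
have xx0 : 0 <= dotp x x by apply: sumr_ge0 => i _; rewrite -expr2 sqr_ge0.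
rewrite -{2}(ger0_norm xx0) -normrM {2}/dotp mulr_suml.
apply: le_trans (ler_wpM2l (exprn_ge0 _ xx0) (ler_norm_sum _ _ _)) _.
rewrite mulr_sumr; apply: ler_sum => i _; have [_ HC] := CP i.
have tD := test_pderiv i tG.
by rewrite -mulrA oscint_coord// oscint_coord.
Qed.

Lemma oneD_expr_le (a : R) k : 0 <= a -> (1 + a) ^+ k <= 2 ^+ k * (1 + a ^+ k).
Proof.
move=> a0; have [a1|a1] := leP a 1.
  apply: (@le_trans _ _ (2 ^+ k)).
    by apply: lerXn2r; rewrite ?nnegrE ?addr_ge0//; lra.
  by rewrite ler_peMr ?exprn_ge0// lerDl exprn_ge0.
rewrite (@le_trans _ _ ((2 * a) ^+ k))//.
  by apply: lerXn2r; rewrite ?nnegrE ?addr_ge0 ?mulr_ge0//; lra.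
by rewrite exprMn ler_wpM2l ?exprn_ge0// lerDr.
Qed.

Lemma oscint_decay th G : test G ->
  exists2 C : R, 0 <= C & forall x, `|oscint th G x| <= C * decay x.
Proof.
move=> tG; have [C0 C00 H0] := oscint_dotp_decay 0 th tG.
have [C1 C10 H1] := oscint_dotp_decay n th tG.
exists (2 ^+ n * (C0 + C1)); first by rewrite mulr_ge0 ?addr_ge0 ?exprn_ge0.
move=> x; rewrite /decay prodfV ler_pdivlMr; last first.
  by apply: prodr_gt0 => i _; exact: oneDsqr_gt0'.
have xx0 : 0 <= dotp x x by apply: sumr_ge0 => i _; rewrite -expr2 sqr_ge0.
apply: (@le_trans _ _ (`|oscint th G x| * (1 + dotp x x) ^+ n)).
  rewrite ler_wpM2l// -[X in _ <= _ ^+ X]card_ord -prodr_const.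
  apply: ler_prod => i _; rewrite ltW ?oneDsqr_gt0'//= lerD2l /dotp (bigD1 i)//= -expr2.
  by rewrite lerDl; apply: sumr_ge0 => j _; rewrite -expr2 sqr_ge0.
apply: le_trans (ler_wpM2l (normr_ge0 _) (oneD_expr_le n xx0)) _.
rewrite mulrCA ler_wpM2l ?exprn_ge0// mulrDr mulr1 lerD//.
  by have := H0 x; rewrite expr0 mul1r.
by rewrite mulrC.
Qed.

Lemma measurable_oscint th G : test G -> measurable_fun setT (oscint th G).
Proof. by move=> tG; apply: continuous_measurable_rV; exact: continuous_oscint. Qed.

Lemma integrable_oscint th G : test G -> integ (oscint th G).
Proof.
move=> tG; have [C _ HC] := oscint_decay th tG.
exact: decay_integrable (measurable_oscint th tG) HC.
Qed.

Lemma schwartz_oscint th G : test G -> schwartz_real (oscint th G).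
Proof.
move=> tG; split; first exact: smooth_oscint.
move=> N s; have [th' [G' [tG' ->]]] := pderivs_oscint th s tG.
have [C0 C00 H0] := oscint_dotp_decay 0 th' tG'.
have [C1 C10 H1] := oscint_dotp_decay N th' tG'.
exists (C0 + C1) => x.
have xx0 : 0 <= dotp x x by apply: sumr_ge0 => i _; rewrite -expr2 sqr_ge0.
apply: (@le_trans _ _ ((1 + dotp x x ^+ N) * `|oscint th' G' x|)).
  rewrite ler_wpM2r// -(sqr_sqrtr xx0) -/(enorm x) -exprM mulnC exprM.
  have e0 : 0 <= enorm x ^+ N by rewrite exprn_ge0// sqrtr_ge0.
  by move: (enorm x ^+ N) e0 => a a0; nra.
rewrite mulrDl mul1r lerD//.
by have := H0 x; rewrite expr0 mul1r.
Qed.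

Lemma measurable_kernel G th : measurable_fun setT G ->
  measurable_fun setT (fun z : 'rV[R]_n * 'rV[R]_n => G z.2 * cos (dotp z.1 z.2 + th)).
Proof.
move=> mG; apply: measurable_funM; first exact: measurableT_comp mG measurable_snd.
apply: measurableT_comp => //.
  by apply: continuous_measurable_fun; exact: continuous_cos.
apply: measurable_funD => //; exact: measurable_dotp.
Qed.

(** Both sides are the double integral of [G y * rho (e *: x) * cos (dotp x y + th)]. Integrating in
    x first and rescaling x, then y, by [e] moves the dilation from [rho] to [G]; the two Jacobians
    cancel. *)
Lemma oscint_scale th G rho e : test G -> test rho -> 0 < e ->
  \int[lam]_x (oscint th G x * rho (e *: x)) =
  \int[lam]_x (G (e *: x) * oscint th rho x).
Proof.
move=> tG trho e0.
have e00 : e != 0 by rewrite gt_eqF.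
have mG := test_measurable tG; have mrho := test_measurable trho.
have sc f : (fun x => f (e *: x)) = (fun x => f (e *: x + 0)).
  by apply/funext => x; rewrite addr0.
have mrhoe : measurable_fun setT (fun x => rho (e *: x)).
  rewrite sc; apply: (measurableT_comp mrho); exact: measurable_rV_affine.
have trhoe : exists2 C : R, 0 <= C & forall x, `|rho (e *: x)| <= C * decay x.
  have [r r0 Gr] := test_support trho; have [M M0 GM] := test_bounded trho.
  exists (M * (1 + (r / e) ^+ 2) ^+ n).
    by rewrite mulr_ge0// exprn_ge0// ltW// oneDsqr_gt0'.
  apply: support_decay => // x; rewrite ler_pdivrMr// => H.
  by apply: Gr; rewrite normrZ gtr0_norm// mulrC.
have [C1 C10 H1] := test_decay tG; have [C2 C20 H2] := trhoe.
pose F (z : 'rV[R]_n * 'rV[R]_n) := G z.2 * cos (dotp z.1 z.2 + th) * rho (e *: z.1).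
have mF : measurable_fun setT F.
  apply: measurable_funM; first exact: measurable_kernel.
  exact: (measurableT_comp mrhoe measurable_fst).
have FC x y : `|F (x, y)| <= C1 * C2 * (decay x * decay y).
  rewrite /F /= !normrM (_ : _ * (_ * _) = C1 * decay y * (C2 * decay x)); last by ring.
  by rewrite ler_pM// (le_trans _ (H1 y))// ler_piMr// norm_cos_le1.
transitivity (\int[lam]_x \int[lam]_y F (x, y)).
  apply: eq_Rintegral => x _; rewrite /oscint -RintegralZr//.
  exact: test_integrable (test_oscint _ _ tG).
rewrite (Rintegral_fubini mF FC).
pose K y := G y * oscint th rho (e^-1 *: y).
have iK : integ K.
  apply: (@decay_integrable _ _ _ (C1 * \int[lam]_y `|rho y|)).
    apply: measurable_funM => //.
    have := measurableT_comp (measurable_oscint th trho) (measurable_rV_affine e^-1 (0 : 'rV[R]_n)).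
    by rewrite /comp; under eq_fun do rewrite addr0.
  by move=> x; rewrite normrM mulrAC ler_pM//; exact: oscint_bound.
transitivity (`|e| ^- n * \int[lam]_y K y).
  rewrite -RintegralZl//.
  apply: eq_Rintegral => y _; rewrite /K mulrCA /oscint.
  have <- : \int[lam]_x (rho (e *: x + 0) * cos (dotp (e^-1 *: y) (e *: x + 0) + th)) =
    `|e| ^- n * \int[lam]_x (rho x * cos (dotp (e^-1 *: y) x + th)).
    apply: (@Rintegral_affine _ _ e 0 (fun x => rho x * cos (dotp (e^-1 *: y) x + th))) => //.
    exact: test_integrable (test_oscint _ _ trho).
  rewrite -RintegralZl//.
    apply: eq_Rintegral => x _; rewrite /F /= addr0 dotpZl dotpZr mulKf// dotpC; ring.
  apply: (@decay_integrable _ _ _ C2); last first.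
    by move=> x; rewrite addr0 normrM (le_trans _ (H2 x))// ler_piMr// norm_cos_le1.
  apply: measurable_funM; first by rewrite -sc.
  apply: measurableT_comp; first by apply: continuous_measurable_fun; exact: continuous_cos.
  apply: measurable_funD => //.
  have := measurableT_comp (continuous_measurable_rV (smooth_continuous (smooth_on_dotp (e^-1 *: y) openT))) (measurable_rV_affine e (0 : 'rV[R]_n)).
  by [].
rewrite -(Rintegral_affine (0 : 'rV[R]_n) e00 iK).
by apply: eq_Rintegral => x _; rewrite /K addr0 scalerK.
Qed.

Lemma scale_cvg0 f x : continuous f ->
  f (k.+1%:R^-1 *: x) @[k --> \oo] --> f 0.
Proof.
move=> cf; apply: (cvg_comp (fun k : nat => k.+1%:R^-1 *: x) f); last exact: cf.
have := cvgZr_tmp (a := x) (@cvg_harmonic R); rewrite scale0r; exact.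
Qed.

Lemma Rintegral_scale_limit f G : integ f -> test G ->
  \int[lam]_x (f x * G (k.+1%:R^-1 *: x)) @[k --> \oo] --> G 0 * \int[lam]_x f x.
Proof.
move=> fi tG; have /integrableP[/measurable_EFinP mf _] := fi.
have [M M0 GM] := test_bounded tG.
have -> : G 0 * \int[lam]_x f x = \int[lam]_x (f x * G 0).
  by rewrite RintegralZr// mulrC.
apply: (@Rintegral_dominated _ _ _ _ (fun x => M * `|f x|)).
- move=> k; apply: measurable_funM => //.
  have := measurableT_comp (test_measurable tG) (measurable_rV_affine k.+1%:R^-1 (0 : 'rV[R]_n)).
  by rewrite /comp; under eq_fun do rewrite addr0.
- exact: measurable_funM.
- have := integrableZl measurableT M (integrable_norm fi).
  by apply: eq_integrable => // x _ /=; rewrite EFinM.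
- by move=> k x; rewrite normrM mulrC ler_wpM2r.
- move=> x; apply: cvgM; first exact: cvg_cst.
  exact: scale_cvg0 (smooth_continuous tG.1).
Qed.

(** Let the scale in [oscint_scale] tend to 0: one side tends to [rho 0] times the integral for [G],
    the other to the same with the roles exchanged. Hence the ratio of the integral of [oscint th G]
    to [G 0] is common to all test functions, and can be read off one bump. *)
Lemma oscint_inversion_sym th G rho : test G -> test rho ->
  rho 0 * \int[lam]_x oscint th G x = G 0 * \int[lam]_x oscint th rho x.
Proof.
move=> tG trho.
have H1 := Rintegral_scale_limit (integrable_oscint th tG) trho.
have H2 := Rintegral_scale_limit (integrable_oscint th trho) tG.
have E : (fun k : nat => \int[lam]_x (oscint th G x * rho (k.+1%:R^-1 *: x))) =
    (fun k : nat => \int[lam]_x (oscint th rho x * G (k.+1%:R^-1 *: x))).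
  apply/funext => k; rewrite oscint_scale//.
  by apply: eq_Rintegral => x _; rewrite mulrC.
by rewrite E in H1; rewrite -(cvg_lim _ H1)// -(cvg_lim _ H2).
Qed.

Lemma oscint_shift th G x : test G ->
  oscint th G x = cos th * oscint 0 G x - sin th * oscint (- (pi / 2)) G x.
Proof.
move=> tG; rewrite /oscint -!RintegralZl//.
- rewrite -RintegralB//.
  + apply: eq_Rintegral => y _; rewrite addr0 -[- (pi / 2)]add0r.
    by rewrite sub0r cosD cosB cos_pihalf sin_pihalf; ring.
  + have := test_integrable (testM (test_oscint x 0 tG) (smooth_on_cst (cos th) openT)).
    by under eq_fun do rewrite mulrC.
  + have := test_integrable (testM (test_oscint x (- (pi / 2)) tG) (smooth_on_cst (sin th) openT)).
    by under eq_fun do rewrite mulrC.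
- exact: test_integrable (test_oscint _ _ tG).
- exact: test_integrable (test_oscint _ _ tG).
Qed.

(** With this phase the kernel is a sine, odd in x, so the substitution of -x for x changes the sign
    of the integral. *)
Lemma Rintegral_oscint_odd G : test G -> \int[lam]_x oscint (- (pi / 2)) G x = 0.
Proof.
move=> tG; have i1 := integrable_oscint (- (pi / 2)) tG.
have N1 : (-1 : R) != 0 by rewrite oppr_eq0 oner_eq0.
have := Rintegral_affine (0 : 'rV[R]_n) N1 i1.
rewrite normrN1 expr1n invr1 mul1r.
rewrite (_ : \int[lam]_x _ = \int[lam]_x (-1 * oscint (- (pi / 2)) G x)).
  by rewrite RintegralZl// => H; lra.
apply: eq_Rintegral => x _; rewrite addr0 scaleN1r mulN1r /oscint.
rewrite -mulN1r -RintegralZl//; last exact: test_integrable (test_oscint _ _ tG).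
apply: eq_Rintegral => y _; rewrite dotpNl mulrCA; congr (_ * _).
by rewrite cosB cosN sinN cosB cos_pihalf sin_pihalf; ring.
Qed.

(* This is (2 pi)^n, but only its positivity is needed, and that follows from
   Plancherel's identity. *)
Definition invconst : R :=
  (\int[lam]_x oscint 0 (bump (0 : 'rV[R]_n) 1) x) / bump (0 : 'rV[R]_n) 1 0.

Lemma test_bump x0 r : 0 < r -> test (bump (x0 : 'rV[R]_n) r).
Proof.
move=> r0; split; first exact: smooth_bump openT.
exists (r + `|x0|) => x rx; apply: bump_eq0 => //.
by rewrite -(lerD2r `|x0|) (le_trans rx)// -{1}(subrK x0 x) ler_normD.
Qed.

Lemma oscint_inversion0 th G : test G ->
  \int[lam]_x oscint th G x = invconst * cos th * G 0.
Proof.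
move=> tG; have tb := test_bump (0 : 'rV[R]_n) ltr01.
have b0 := bump_gt0 (0 : 'rV[R]_n) (1 : R).
have b00 : bump (0 : 'rV[R]_n) (1 : R) 0 != 0 by rewrite gt_eqF.
under eq_Rintegral do rewrite oscint_shift//.
rewrite RintegralB//; last 2 first.
- have := integrableZl measurableT (cos th) (integrable_oscint 0 tG).
  by apply: eq_integrable => // x _ /=; rewrite EFinM.
- have := integrableZl measurableT (sin th) (integrable_oscint (- (pi / 2)) tG).
  by apply: eq_integrable => // x _ /=; rewrite EFinM.
rewrite !RintegralZl//; try exact: integrable_oscint.
rewrite Rintegral_oscint_odd// mulr0 subr0.
have := oscint_inversion_sym 0 tG tb.
move=> H; rewrite /invconst.
rewrite -(mulKf b00 (\int[lam]_x oscint 0 G x)) H.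
by move: (\int[lam]_x oscint 0 _ x) => I; field.
Qed.

(** Modulating the kernel by [z] is the same as translating [G]; this carries inversion from the
    origin to any point. *)
Lemma oscint_translate th G z x : test G ->
  \int[lam]_y (G y * cos (dotp x (y - z) + th)) = oscint th (fun y => G (y + z)) x.
Proof.
move=> tG; rewrite /oscint.
have -> : \int[lam]_y (G y * cos (dotp x (y - z) + th)) =
  \int[lam]_y ((fun y => G y * cos (dotp x (y - z) + th)) (y + z)).
  apply/esym; apply: (Rintegral_shift z (f := fun y => G y * cos (dotp x (y - z) + th))).
  apply: test_integrable; apply: (testM tG).
  apply: (smooth_on_ext openT _ (smooth_phase_cos x (th - dotp x z))) => y _.
  by rewrite dotpDr dotpNr; congr cos; ring.
by apply: eq_Rintegral => y _; rewrite addrK.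
Qed.

Lemma oscint_inversion th G z : test G ->
  \int[lam]_x oscint th (fun y => G (y + z)) x = invconst * cos th * G z.
Proof. by move=> tG; rewrite (oscint_inversion0 th (test_shift z tG)) add0r. Qed.

End oscillatory_integral.
(** * Wave packets *)

Section wave_packets.
Context {R : realType} {n : nat}.
Implicit Types (x y z v : 'rV[R]_n) (th s : R).
Local Notation e_ i := (delta_mx 0 i : 'rV[R]_n).
Local Notation lam := (lebesgue_rV R n).
Local Notation integ f := (lam.-integrable setT (EFin \o f)).

Lemma smooth_on_cutoff (U K : set 'rV[R]_n) (G : 'rV[R]_n -> R) :
  closed K -> K `<=` U -> smooth_on U G -> (forall x, ~ K x -> G x = 0) ->
  smooth_on setT G.
Proof.
move=> cK KU sG G0.
have oK : open (~` K) by exact: closed_openC.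
have sK : smooth_on (~` K) G.
  by apply: (smooth_on_ext oK _ (smooth_on_cst 0 oK)) => x Kx; rewrite G0.
have -> : setT = U `|` ~` K.
  by apply/seteqP; split => // x _; have [/KU|] := pselect (K x); [left|right].
exact: smooth_on_setU.
Qed.

Lemma closed_norm_le (c : 'rV[R]_n) (r : R) : closed [set x : 'rV[R]_n | `|x - c| <= r].
Proof.
have -> : [set x : 'rV[R]_n | `|x - c| <= r] =
   (fun x : 'rV[R]_n => `|x - c|) @^-1` [set y : R | y <= r] by [].
apply: closed_comp; last exact: closed_le.
move=> x _; apply: (@continuous_comp _ _ _ (fun x => x - c) (fun x => `|x|)).
  exact: (cvgB cvg_id (cvg_cst c)).
exact: norm_continuous.
Qed.

Variables (U : set 'rV[R]_n) (Phi chi : 'rV[R]_n -> R) (c : 'rV[R]_n) (r : R).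
Hypothesis oU : open U.
Hypothesis sPhi : smooth_on U Phi.
Hypothesis tchi : test chi.
Hypothesis chi0 : forall x, r < `|x - c| -> chi x = 0.
Hypothesis rU : forall x, `|x - c| <= r -> U x.

(** For [th = 0] and [th = - pi / 2] these are the real and imaginary parts of the integral of chi
    e^{i (x.y + s Phi)}. [Phi] is controlled on [U] only, which contains the closed ball outside
    which [chi] vanishes. *)
Definition wave th s x : R := \int[lam]_y (chi y * cos (dotp x y + th + s * Phi y)).

(** Amplitudes that absorb the factor e^{i s Phi}. They are test functions, so a wave is a sum of
    two functions [oscint] and inherits their decay and inversion formula. *)
Let A s y := chi y * cos (s * Phi y).
Let B s y := chi y * sin (s * Phi y).

Let test_cut f : smooth_on U f -> test (fun y => chi y * f y).
Proof.
move=> sf; split; last first.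
  by have [_ [r' Hr']] := tchi; exists r' => x rx; rewrite Hr'// mul0r.
apply: (@smooth_on_cutoff U [set x | `|x - c| <= r]).
- exact: closed_norm_le.
- by [].
- exact (smooth_onM oU (smooth_on_sub (@subsetT _ U) tchi.1) sf).
- by move=> x /negP; rewrite -ltNge => /chi0 ->; rewrite mul0r.
Qed.

Let smooth_sPhi s : smooth_on U (fun y => s * Phi y).
Proof. exact (smooth_onM oU (smooth_on_cst s oU) sPhi). Qed.

Let tA s : test (A s).
Proof. exact (test_cut (smooth_on_cos oU (smooth_sPhi s))). Qed.

Let tB s : test (B s).
Proof. exact (test_cut (smooth_on_sin oU (smooth_sPhi s))). Qed.

Let kerE s (a : R) y : chi y * cos (a + s * Phi y) = A s y * cos a + B s y * cos (a + pi / 2).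
Proof. by rewrite cosDpihalf cosD /A /B; ring. Qed.

Lemma waveE th s x : wave th s x = oscint th (A s) x + oscint (th + pi / 2) (B s) x.
Proof.
rewrite /wave /oscint -RintegralD//.
- by apply: eq_Rintegral => y _; rewrite kerE addrA.
- exact: test_integrable (test_oscint _ _ (tA s)).
- exact: test_integrable (test_oscint _ _ (tB s)).
Qed.

Lemma pderivsD (f g : 'rV[R]_n -> R) l : smooth_on setT f -> smooth_on setT g ->
  pderivs l (fun x => f x + g x) = (fun x => pderivs l f x + pderivs l g x).
Proof.
move=> sf sg; elim: l => [//|i l ih] /=; rewrite ih; apply/funext => x.
rewrite [LHS](@deriveD _ _ _ (pderivs l f) (pderivs l g))//.
  exact (smooth_on_derivable (smooth_on_pderivs l sf) I).
exact (smooth_on_derivable (smooth_on_pderivs l sg) I).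
Qed.

Lemma enorm_ge0 (x : 'rV[R]_n) : 0 <= enorm x.
Proof. exact: sqrtr_ge0. Qed.

Lemma schwartz_realD (f g : 'rV[R]_n -> R) : schwartz_real f -> schwartz_real g ->
  schwartz_real (fun x => f x + g x).
Proof.
move=> [sf bf] [sg bg]; split; first exact (smooth_onD openT sf sg).
move=> N l; have [C1 H1] := bf N l; have [C2 H2] := bg N l.
exists (C1 + C2) => x; rewrite pderivsD//.
apply: le_trans (ler_wpM2l (exprn_ge0 _ (enorm_ge0 x)) (ler_normD _ _)) _.
by rewrite mulrDr lerD.
Qed.

Lemma schwartz_wave th s : schwartz_real (wave th s).
Proof.
have -> : wave th s = (fun x => oscint th (A s) x + oscint (th + pi / 2) (B s) x).
  by apply/funext => x; rewrite waveE.
by apply: schwartz_realD; exact: schwartz_oscint.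
Qed.

Lemma continuous_wave th s : continuous (wave th s).
Proof. by apply: smooth_continuous; have [] := schwartz_wave th s. Qed.

Lemma measurable_wave th s : measurable_fun setT (wave th s).
Proof. by apply: continuous_measurable_rV; exact: continuous_wave. Qed.

Lemma wave_decay th s : exists2 C : R, 0 <= C & forall x, `|wave th s x| <= C * decay x.
Proof.
have [C1 C10 H1] := oscint_decay th (tA s).
have [C2 C20 H2] := oscint_decay (th + pi / 2) (tB s).
exists (C1 + C2); first exact: addr_ge0.
by move=> x; rewrite waveE [leRHS]mulrDl (le_trans (ler_normD _ _))// lerD.
Qed.

Lemma integrable_wave_kernel th s x :
  integ (fun y => chi y * cos (dotp x y + th + s * Phi y)).
Proof.
have i1 := test_integrable (test_oscint x th (tA s)).
have i2 := test_integrable (test_oscint x (th + pi / 2) (tB s)).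
have := integrableD measurableT i1 i2.
by apply: eq_integrable => // y _; rewrite /= -EFinD kerE addrA.
Qed.

Lemma wave_bound th s x : `|wave th s x| <= \int[lam]_y `|chi y|.
Proof.
have iw := integrable_wave_kernel th s x.
apply: le_trans (le_normr_Rintegral measurableT iw) _.
apply: le_Rintegral => //.
- exact: integrable_norm iw.
- exact: integrable_norm (test_integrable tchi).
- by move=> y _; rewrite normrM ler_piMr// norm_cos_le1.
Qed.

Lemma wave_inversion th s z :
  \int[lam]_x (\int[lam]_y (chi y * cos (dotp x (y - z) + th + s * Phi y))) =
  @invconst R n * (chi z * cos (th + s * Phi z)).
Proof.
transitivity (\int[lam]_x (oscint th (fun y => A s (y + z)) x +
   oscint (th + pi / 2) (fun y => B s (y + z)) x)).
  apply: eq_Rintegral => x _; rewrite -!oscint_translate//.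
  have itest th' G : test G -> integ (fun y => G y * cos (dotp x (y - z) + th')).
    move=> tG; apply: test_integrable; apply: (testM tG).
    apply: (smooth_on_ext openT _ (smooth_phase_cos x (th' - dotp x z))) => y _.
    by rewrite dotpDr dotpNr; congr cos; ring.
  rewrite -RintegralD//; try exact: itest.
  by apply: eq_Rintegral => y _; rewrite kerE addrA.
rewrite RintegralD//.
- by rewrite !oscint_inversion// kerE; ring.
- exact: (integrable_oscint _ (test_shift z (tA s))).
- exact: (integrable_oscint _ (test_shift z (tB s))).
Qed.

(** The left side is the real part of e^{-ia} times the complex packet, since cos (a - pi/2) is sin
    a. *)
Lemma wave_rotate s x a :
  wave 0 s x * cos a + wave (- (pi / 2)) s x * cos (a - pi / 2) =
  \int[lam]_y (chi y * cos (dotp x y - a + s * Phi y)).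
Proof.
have iw th := integrable_wave_kernel th s x.
rewrite /wave -!RintegralZr// -RintegralD//.
- apply: eq_Rintegral => y _; rewrite addr0.
  rewrite (_ : dotp x y - pi / 2 + s * Phi y = dotp x y + s * Phi y - pi / 2); last by ring.
  rewrite (_ : dotp x y - a + s * Phi y = dotp x y + s * Phi y - a); last by ring.
  move: (dotp x y + _) => b.
  by rewrite !cosB cos_pihalf sin_pihalf; ring.
- have := integrableZr measurableT (cos a) (iw 0).
  by apply: eq_integrable => // y _; rewrite /= EFinM.
- have := integrableZr measurableT (cos (a - pi / 2)) (iw (- (pi / 2))).
  by apply: eq_integrable => // y _; rewrite /= EFinM.
Qed.

Lemma measurable_wave_kernel th s : measurable_fun setT
  (fun w : 'rV[R]_n * 'rV[R]_n => chi w.2 * cos (dotp w.1 w.2 + th + s * Phi w.2)).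
Proof.
have -> : (fun w : 'rV[R]_n * 'rV[R]_n => chi w.2 * cos (dotp w.1 w.2 + th + s * Phi w.2)) =
  (fun w => A s w.2 * cos (dotp w.1 w.2 + th) + B s w.2 * cos (dotp w.1 w.2 + (th + pi / 2))).
  by apply/funext => w; rewrite kerE addrA.
apply: measurable_funD; apply: measurable_kernel; exact: test_measurable.
Qed.

(* The squared modulus of the integral of chi e^{i (x.y + s Phi)}. *)
Definition energy s x : R := wave 0 s x ^+ 2 + wave (- (pi / 2)) s x ^+ 2.

Lemma energyE s x : energy s x =
  \int[lam]_y (chi y * (wave 0 s x * cos (dotp x y + s * Phi y) +
     wave (- (pi / 2)) s x * cos (dotp x y + s * Phi y - pi / 2))).
Proof.
have iw th := integrable_wave_kernel th s x.
rewrite /energy !expr2 {2 4}/wave -!RintegralZl// -RintegralD//.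
- apply: eq_Rintegral => y _; rewrite addr0.
  rewrite (_ : dotp x y - pi / 2 + s * Phi y = dotp x y + s * Phi y - pi / 2); last by ring.
  by ring.
- have := integrableZl measurableT (wave 0 s x) (iw 0).
  by apply: eq_integrable => // y _; rewrite /= EFinM.
- have := integrableZl measurableT (wave (- (pi / 2)) s x) (iw (- (pi / 2))).
  by apply: eq_integrable => // y _; rewrite /= EFinM.
Qed.

Lemma energy_kernel s x : energy s x =
  \int[lam]_y (chi y * \int[lam]_z (chi z * cos (dotp x (z - y) - s * Phi y + s * Phi z))).
Proof.
rewrite energyE; apply: eq_Rintegral => y _; congr (_ * _).
rewrite wave_rotate; apply: eq_Rintegral => z _; congr (_ * cos _).
by rewrite dotpDr dotpNr; ring.
Qed.

(** After exchanging the integrals, the inner one in x is [wave_inversion] at the point y with phase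
    - s Phi y, where the cosine becomes 1. The result does not involve [s], which is how the L^2
    norm is seen to be constant. *)
Lemma plancherel_wave s :
  \int[lam]_x energy s x = @invconst R n * \int[lam]_y (chi y ^+ 2).
Proof.
under eq_Rintegral do rewrite energyE.
(* One of the two factors of the energy stays a [wave]: its decay in x is what makes [F] integrable
   on the product. The fully expanded kernel would not decay in x. *)
pose F (w : 'rV[R]_n * 'rV[R]_n) :=
   wave 0 s w.1 * (chi w.2 * cos (dotp w.1 w.2 + 0 + s * Phi w.2)) +
   wave (- (pi / 2)) s w.1 * (chi w.2 * cos (dotp w.1 w.2 + (- (pi / 2)) + s * Phi w.2)).
have FE x y : chi y * (wave 0 s x * cos (dotp x y + s * Phi y) +
     wave (- (pi / 2)) s x * cos (dotp x y + s * Phi y - pi / 2)) = F (x, y).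
  rewrite /F /= addr0.
  rewrite (_ : dotp x y - pi / 2 + s * Phi y = dotp x y + s * Phi y - pi / 2); last by ring.
  by ring.
under eq_Rintegral do under eq_Rintegral do rewrite FE.
have mF : measurable_fun setT F.
  apply: measurable_funD; apply: measurable_funM.
  - exact: measurableT_comp (measurable_wave _ _) measurable_fst.
  - exact: measurable_wave_kernel.
  - exact: measurableT_comp (measurable_wave _ _) measurable_fst.
  - exact: measurable_wave_kernel.
have [C1 C10 H1] := wave_decay 0 s; have [C2 C20 H2] := wave_decay (- (pi / 2)) s.
have [C3 C30 H3] := test_decay tchi.
rewrite (@Rintegral_fubini _ _ _ F ((C1 + C2) * C3) mF); last first.
  move=> x y; rewrite (_ : _ * (_ * _) = C1 * decay x * (C3 * decay y) + C2 * decay x * (C3 * decay y)); last by ring.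
  rewrite (le_trans (ler_normD _ _))// lerD// normrM ler_pM// normrM.
    by rewrite (le_trans _ (H3 y))// ler_piMr// norm_cos_le1.
  by rewrite (le_trans _ (H3 y))// ler_piMr// norm_cos_le1.
rewrite -RintegralZl//; last first.
  have := test_integrable (testM tchi tchi.1).
  by under eq_fun do rewrite -expr2.
apply: eq_Rintegral => y _; under eq_Rintegral do rewrite -FE.
transitivity (\int[lam]_x (chi y * \int[lam]_z (chi z * cos (dotp x (z - y) + (- (s * Phi y)) + s * Phi z)))).
  apply: eq_Rintegral => x _; congr (_ * _); rewrite wave_rotate.
  apply: eq_Rintegral => z _; congr (_ * cos _).
  by rewrite dotpDr dotpNr; ring.
rewrite RintegralZl//; first by rewrite wave_inversion addNr cos0; ring.
apply: (@decay_integrable _ _ _ (C1 + C2)).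
  apply: (@eq_measurable_fun _ _ _ _ _ (fun x => wave 0 s x * cos (dotp x y + s * Phi y) + wave (- (pi / 2)) s x * cos (dotp x y + s * Phi y - pi / 2))).
    move=> x _; rewrite wave_rotate; apply: eq_Rintegral => z _; congr (_ * cos _).
    by rewrite dotpDr dotpNr; ring.
  have md a : measurable_fun setT (fun x => cos (dotp x y + a)).
    have := continuous_measurable_rV (smooth_continuous (smooth_phase_cos y a)).
    by under eq_fun do rewrite dotpC.
  apply: measurable_funD; apply: measurable_funM; try exact: measurable_wave; first exact: md.
  by have := md (s * Phi y - pi / 2); under eq_fun do rewrite addrA.
move=> x; have -> : \int[lam]_z (chi z * cos (dotp x (z - y) + (- (s * Phi y)) + s * Phi z)) =
  wave 0 s x * cos (dotp x y + s * Phi y) + wave (- (pi / 2)) s x * cos (dotp x y + s * Phi y - pi / 2).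
  rewrite wave_rotate; apply: eq_Rintegral => z _; congr (_ * cos _).
  by rewrite dotpDr dotpNr; ring.
rewrite [leRHS]mulrDl (le_trans (ler_normD _ _))// lerD// normrM.
  by rewrite (le_trans _ (H1 x))// ler_piMr// norm_cos_le1.
by rewrite (le_trans _ (H2 x))// ler_piMr// norm_cos_le1.
Qed.

(* The autocorrelation of chi e^{i s Phi} at [h]; the phase [th] encodes real and
   imaginary parts as in [oscint]. *)
Definition corr s th h : R :=
  \int[lam]_y (chi y * chi (y + h) * cos (th + s * (Phi (y + h) - Phi y))).

Let F s x (w : 'rV[R]_n * 'rV[R]_n) :=
  chi w.1 * chi (w.1 + w.2) * cos (dotp x w.2 + s * (Phi (w.1 + w.2) - Phi w.1)).

Let measurable_F s x : measurable_fun setT (F s x).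
Proof.
(* [Phi] is arbitrary off [U], so measurability is read off the test functions [A] and [B] after
   expanding the cosine. *)
pose Aw s (w : 'rV[R]_n * 'rV[R]_n) := A s w.1.
pose Bw s (w : 'rV[R]_n * 'rV[R]_n) := B s w.1.
pose As s (w : 'rV[R]_n * 'rV[R]_n) := A s (w.1 + w.2).
pose Bs s (w : 'rV[R]_n * 'rV[R]_n) := B s (w.1 + w.2).
have -> : F s x = (fun w => cos (dotp x w.2) * (Aw s w * As s w + Bw s w * Bs s w) -
    sin (dotp x w.2) * (Bs s w * Aw s w - As s w * Bw s w)).
  apply/funext => w; rewrite /F /Aw /Bw /As /Bs /A /B mulrBr.
  move: (s * Phi (w.1 + w.2)) (s * Phi w.1) => a b.
  by rewrite cosD sinB cosB; ring.
have madd : measurable_fun setT (fun w : 'rV[R]_n * 'rV[R]_n => w.1 + w.2).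
  apply: measurable_fun_rV => i.
  rewrite (_ : _ \o _ = (fun w : 'rV[R]_n * 'rV[R]_n => rV_coord i w.1 + rV_coord i w.2)).
    apply: measurable_funD.
      exact: measurableT_comp (measurable_rV_coord i) measurable_fst.
    exact: measurableT_comp (measurable_rV_coord i) measurable_snd.
  by apply/funext => w; rewrite /rV_coord /= mxE.
have mx : measurable_fun setT (fun w : 'rV[R]_n * 'rV[R]_n => dotp x w.2).
  apply: (measurableT_comp _ measurable_snd).
  exact: continuous_measurable_rV (smooth_continuous (smooth_on_dotp x openT)).
have m1 G : test G -> measurable_fun setT (fun w : 'rV[R]_n * 'rV[R]_n => G w.1).
  by move=> tG; exact: measurableT_comp (test_measurable tG) measurable_fst.
have m2 G : test G -> measurable_fun setT (fun w : 'rV[R]_n * 'rV[R]_n => G (w.1 + w.2)).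
  by move=> tG; exact: measurableT_comp (test_measurable tG) madd.
apply: measurable_funB; apply: measurable_funM.
- by apply: measurableT_comp mx; apply: continuous_measurable_fun; exact: continuous_cos.
- by apply: measurable_funD; apply: measurable_funM; (try exact: m1); exact: m2.
- by apply: measurableT_comp mx; apply: continuous_measurable_fun; exact: continuous_sin.
- by apply: measurable_funB; apply: measurable_funM; (try exact: m1); exact: m2.
Qed.

Let F_decay s x : 0 < r ->
  exists C : R, forall y h, `|F s x (y, h)| <= C * (decay y * decay h).
Proof.
move=> r0; have [C1 C10 H1] := test_decay tchi; have [N N0 HN] := test_bounded tchi.
(* Where the integrand is nonzero, y and y + h are both within r of c, so |h| <= 2r. The radius
   passed to [support_decay] is 2r + 1 because [g] need not vanish at |h| = 2r. *)
pose g (h : 'rV[R]_n) : R := if `|h| <= 2 * r then N else 0.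
exists (C1 * (N * (1 + (2 * r + 1) ^+ 2) ^+ n)) => y h.
have gd := @support_decay R n N (2 * r + 1) g N0.
rewrite (_ : _ * (_ * _) = C1 * decay y * (N * (1 + (2 * r + 1) ^+ 2) ^+ n * decay h)); last by ring.
apply: (@le_trans _ _ (`|chi y| * `|g h|)); last first.
  rewrite ler_pM//; apply: gd => z; rewrite /g.
    by case: ifP => _; rewrite ?normr0 ?ger0_norm.
  by move=> rz; rewrite leNgt (lt_le_trans _ rz)// ltrDl.
rewrite /F /= !normrM (@le_trans _ _ (`|chi y| * `|chi (y + h)|))//.
  by rewrite ler_piMr ?mulr_ge0// norm_cos_le1.
have [yr|yr] := leP `|y - c| r; last by rewrite chi0// normr0 !mul0r.
rewrite ler_wpM2l// /g; case: ifPn => [_|]; first by rewrite (ger0_norm N0) HN.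
rewrite -ltNge normr0 => hr; rewrite chi0 ?normr0//.
have : `|h| <= `|y + h - c| + `|y - c|.
  rewrite [X in `|X| <= _](_ : h = (y + h - c) - (y - c)); first exact: ler_normB.
  by apply/rowP => i; rewrite !mxE; ring.
by move=> hy; move: hr hy yr; move: `|h| `|_ - _| `|_ - _| => a b d *; lra.
Qed.

Lemma energy_corr s x : 0 < r ->
  energy s x = \int[lam]_h corr s (dotp x h) h.
Proof.
move=> r0; rewrite energy_kernel.
have [C HC] := F_decay s x r0.
rewrite -(Rintegral_fubini (measurable_F s x) HC).
apply: eq_Rintegral => y _.
have iz : integ (fun z => chi z * cos (dotp x (z - y) - s * Phi y + s * Phi z)).
  have i1 := test_integrable (test_oscint x (- dotp x y - s * Phi y) (tA s)).
  have i2 := test_integrable (test_oscint x (- dotp x y - s * Phi y + pi / 2) (tB s)).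
  have := integrableD measurableT i1 i2.
  apply: eq_integrable => // z _; rewrite /= -EFinD; congr EFin.
  by rewrite [RHS]kerE dotpDr dotpNr !addrA.
rewrite -RintegralZl// -(Rintegral_shift y).
  apply: eq_Rintegral => h _; rewrite /F /= addrK [h + y]addrC -mulrA; congr (_ * (_ * cos _)).
  by ring.
have := integrableZl measurableT (chi y) iz.
by apply: eq_integrable => // z _; rewrite /= EFinM.
Qed.

Lemma energy_le s x C : 0 < r -> s != 0 ->
  (forall th h, `|corr s th h| <= C * decay (s *: h)) ->
  energy s x <= C * (`|s| ^- n * \int[lam]_h decay h).
Proof.
move=> r0 s0 HC; rewrite energy_corr//.
have id : integ (fun h => decay (s *: h)).
  have := integrable_affine (0 : 'rV[R]_n) s0 (integrable_decay (R := R) n).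
  by apply: eq_integrable => // h _; rewrite /= addr0.
have iCd : integ (fun h => C * decay (s *: h)).
  have := integrableZl measurableT C id.
  by apply: eq_integrable => // h _; rewrite /= EFinM.
have -> : `|s| ^- n * \int[lam]_h decay h = \int[lam]_h decay (s *: h).
  rewrite -(Rintegral_affine (0 : 'rV[R]_n) s0 (integrable_decay n)).
  by apply: eq_Rintegral => h _; rewrite addr0.
rewrite -RintegralZl//; apply: le_Rintegral => //.
  apply: (le_integrable measurableT _ _ iCd).
    apply/measurable_EFinP.
    have [C' HC'] := F_decay s x r0.
    apply: (@measurable_Rintegral2 R n n (fun w => F s x (w.2, w.1)) C').
      apply: (measurableT_comp (measurable_F s x)).
      exact: measurable_fun_pair measurable_snd measurable_fst.
    by move=> h y; rewrite /= [decay h * _]mulrC; exact: HC'.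
  by move=> h _; rewrite /= lee_fin (le_trans (HC _ _))// ler_norm.
by move=> h _; apply: le_trans (ler_norm _) (HC _ _).
Qed.

End wave_packets.
(** * The dispersive estimate *)

Section nonstationary_phase.
Context {R : realType} {n : nat}.
Implicit Types (x y z v h : 'rV[R]_n) (th s : R) (t : 'rV[R]_n * 'I_n).
Local Notation e_ i := (delta_mx 0 i : 'rV[R]_n).
Local Notation lam := (lebesgue_rV R n).
Local Notation integ f := (lam.-integrable setT (EFin \o f)).

Lemma smooth_ball_bounded (U : set 'rV[R]_n) (f : 'rV[R]_n -> R) (c : 'rV[R]_n) (r : R) :
  smooth_on U f -> (forall x, `|x - c| <= r -> U x) ->
  exists2 M : R, 0 <= M & forall x, `|x - c| <= r -> `|f x| <= M.
Proof.
move=> sf rU.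
have K : compact [set x : 'rV[R]_n | forall i, [set` `[c 0 i - r, c 0 i + r]] (x ord0 i)].
  by apply: (@rV_compact R n (fun i => [set` `[c 0 i - r, c 0 i + r]])) => i; exact: segment_compact.
have [r0|r0] := leP 0 r; last first.
  by exists 0 => // x xr; have := le_lt_trans xr r0; rewrite normr_lt0.
have KE : [set x : 'rV[R]_n | forall i, [set` `[c 0 i - r, c 0 i + r]] (x ord0 i)] =
    [set x : 'rV[R]_n | `|x - c| <= r].
  apply/seteqP; split => x /=.
    move=> H; apply/rV_norm_le; split => // i; rewrite !mxE ler_norml.
    by have := H i; rewrite /= in_itv/= => /andP[? ?]; apply/andP; split; lra.
  move=> /rV_norm_le[_ H] i; have := H i; rewrite !mxE ler_norml => /andP[? ?].
  by rewrite in_itv/=; apply/andP; split; lra.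
rewrite KE in K.
have : compact (f @` [set x : 'rV[R]_n | `|x - c| <= r]).
  apply: continuous_compact => //; apply: continuous_in_subspaceT => x.
  by move=> /set_mem /= /rU; exact: smooth_on_continuous.
move=> /compact_bounded[M [_ HM]]; exists (`|M| + 1); first by rewrite addr_ge0.
move=> x xr; apply: (HM (`|M| + 1)); first by rewrite ltr_pwDr// ler_norm.
by exists x.
Qed.

Variables (U : set 'rV[R]_n) (Phi chi : 'rV[R]_n -> R) (c : 'rV[R]_n) (r : R).
Hypothesis oU : open U.
Hypothesis sPhi : smooth_on U Phi.
Hypothesis r0 : 0 < r.
Hypothesis tchi : test chi.
Hypothesis chi0 : forall x, r < `|x - c| -> chi x = 0.
Hypothesis rU : forall x, `|x - c| <= 6 * r -> U x.
(* For [adm h i], the phase difference y |-> Phi (y + h) - Phi y has no stationary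
   point in the i-th variable, so that one can integrate by parts in it. *)
Variables (adm : 'rV[R]_n -> 'I_n -> Prop) (c1 : R).
Hypothesis c10 : 0 < c1.
Hypothesis adm0 : forall h i, adm h i -> h != 0.
Hypothesis admP : forall h i, adm h i ->
  forall y, `|y - c| < 2 * r -> `|y + h - c| < 2 * r ->
  c1 * `|h| <= `|'D_(e_ i) Phi (y + h) - 'D_(e_ i) Phi y|.

(** The amplitudes vanish off the closed set [K h]; the open set [V h] around it leaves room to
    differentiate, and on it both y and y + h lie in [U]. *)
Let V h : set 'rV[R]_n := [set y | `|y - c| < 2 * r /\ `|y + h - c| < 2 * r].
Let K h : set 'rV[R]_n := [set y | `|y - c| <= r /\ `|y + h - c| <= r].
(** A pair [t] that is not admissible gets the empty set, so membership in a [diffclass] over [W]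
    with base class [Bd] means bounds uniform over the admissible pairs. There is one direction of
    differentiation, and it depends on [t]. *)
Let W t : set 'rV[R]_n := [set y | adm t.1 t.2 /\ V t.1 y].
Let dir (u : unit) t : 'rV[R]_n := e_ t.2.
Let Bd (g : 'rV[R]_n * 'I_n -> 'rV[R]_n -> R) : Prop :=
  exists C : R, forall t y, W t y -> `|g t y| <= C.

Let open_norm_lt (a : 'rV[R]_n) (e : R) : open [set y : 'rV[R]_n | `|y + a| < e].
Proof.
have : open ((fun y : 'rV[R]_n => `|y + a|) @^-1` [set z : R | z < e]); last exact.
apply: open_comp => [x _|]; last exact: open_lt.
apply: (@continuous_comp _ _ _ (fun x => x + a) (fun x => `|x|)).
  exact: (cvgD cvg_id (cvg_cst a)).
exact: norm_continuous.
Qed.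

Let oV h : open (V h).
Proof.
have -> : V h = [set y : 'rV[R]_n | `|y + (- c)| < 2 * r] `&`
    [set y : 'rV[R]_n | `|y + (h - c)| < 2 * r].
  by apply/seteqP; split => y /=; rewrite /V /= addrA.
by apply: openI; exact: open_norm_lt.
Qed.

Let cK h : closed (K h).
Proof.
have -> : K h = [set y : 'rV[R]_n | `|y - c| <= r] `&`
    [set y : 'rV[R]_n | `|y - (c - h)| <= r].
  by apply/seteqP; split => y /=; rewrite /K /= opprB addrA.
by apply: closedI; exact: closed_norm_le.
Qed.

Let KV h : K h `<=` V h.
Proof. by move=> y [a b]; split; [apply: le_lt_trans a _|apply: le_lt_trans b _];
  rewrite ltr_pMl// ltr1n. Qed.

Let oW t : open (W t).
Proof.
have [a|na] := pselect (adm t.1 t.2).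
  have -> : W t = V t.1 by apply/seteqP; split => y; [case|].
  exact: oV.
have -> : W t = set0 by apply/seteqP; split => y; [case|].
exact: open0.
Qed.

Let r6 y : `|y - c| < 2 * r -> `|y - c| <= 6 * r.
Proof. by move=> H; apply: le_trans (ltW H) _; rewrite ler_pM2r// ler_nat. Qed.

Let VU h y : V h y -> U y /\ U (y + h).
Proof. by move=> [a b]; split; apply: rU; exact: r6. Qed.

Let Bdext (f g : 'rV[R]_n * 'I_n -> 'rV[R]_n -> R) :
  (forall t x, W t x -> f t x = g t x) -> Bd f -> Bd g.
Proof. by move=> fg [C HC]; exists C => t y Wy; rewrite -fg//; exact: HC. Qed.

Let BdD (f g : 'rV[R]_n * 'I_n -> 'rV[R]_n -> R) :
  Bd f -> Bd g -> Bd (fun t x => f t x + g t x).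
Proof.
move=> [C HC] [C' HC']; exists (C + C') => t y Wy.
by rewrite (le_trans (ler_normD _ _))// lerD ?HC ?HC'.
Qed.

Let BdM (f g : 'rV[R]_n * 'I_n -> 'rV[R]_n -> R) :
  Bd f -> Bd g -> Bd (fun t x => f t x * g t x).
Proof.
move=> [C HC] [C' HC']; exists (C * C') => t y Wy.
by rewrite normrM ler_pM ?HC ?HC'.
Qed.

Let family_bound (F : 'I_n -> 'rV[R]_n -> R) : (forall i, smooth_on U (F i)) ->
  exists2 C : R, 0 <= C & forall i x, `|x - c| <= 6 * r -> `|F i x| <= C.
Proof.
move=> sF.
have /choice[C HC] (i : 'I_n) : exists C : R, 0 <= C /\ forall x, `|x - c| <= 6 * r -> `|F i x| <= C.
  by have [C C0 HC] := smooth_ball_bounded (sF i) rU; exists C.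
exists (\sum_i C i); first by apply: sumr_ge0 => i _; have [] := HC i.
move=> i x xr; have [_ H] := HC i; apply: (le_trans (H x xr)).
by rewrite (bigD1 i)//= lerDl; apply: sumr_ge0 => j _; have [] := HC j.
Qed.

Let class_fam (F : 'I_n -> 'rV[R]_n -> R) k : (forall i, smooth_on U (F i)) ->
  diffclass dir W Bd k (fun t y => F t.2 y).
Proof.
move=> sF; have Bd0 G : (forall i, smooth_on U (G i)) -> Bd (fun t y => G t.2 y).
  move=> sG; have [C C0 HC] := family_bound sG.
  by exists C => t y [_ [Wy _]]; apply: HC; exact: r6.
elim: k F sF => [|k ih] F sF; first by split=> //; exact: Bd0.
split=> [|u]; first exact: Bd0.
split; first by move=> t y [_ /VU[Uy _]]; exact: smooth_on_derivable (sF t.2) Uy.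
by apply: (ih (fun i => 'D_(e_ i) (F i))) => i; exact: smooth_on_pderiv.
Qed.

Let derive_shift (f : 'rV[R]_n -> R) v h y :
  'D_v (fun y => f (y + h)) y = 'D_v f (y + h).
Proof.
rewrite /derive; set a := (fun h : R => _); set b := (fun h : R => _).
by suff -> : a = b by []; apply/funext => k; rewrite /a /b /= addrA.
Qed.

Let derivable_shift (f : 'rV[R]_n -> R) v h y :
  derivable f (y + h) v -> derivable (fun y => f (y + h)) y v.
Proof.
rewrite /derivable; set a := (fun h : R => _); set b := (fun h : R => _).
by suff -> : a = b by []; apply/funext => k; rewrite /a /b /= addrA.
Qed.

Let class_fam_shift (F : 'I_n -> 'rV[R]_n -> R) k : (forall i, smooth_on U (F i)) ->
  diffclass dir W Bd k (fun t y => F t.2 (y + t.1)).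
Proof.
move=> sF; have Bd0 G : (forall i, smooth_on U (G i)) -> Bd (fun t y => G t.2 (y + t.1)).
  move=> sG; have [C C0 HC] := family_bound sG.
  by exists C => t y [_ [_ Wy]]; apply: HC; exact: r6.
elim: k F sF => [|k ih] F sF; first by split=> //; exact: Bd0.
split=> [|u]; first exact: Bd0.
split.
  move=> t y [_ /VU[_ Uy]]; apply: derivable_shift.
  exact: smooth_on_derivable (sF t.2) Uy.
apply: (diffclass_ext oW Bdext _ (ih (fun i => 'D_(e_ i) (F i)) _)) => [t y _|i].
  by rewrite derive_shift.
exact: smooth_on_pderiv.
Qed.

(** By the mean value theorem the increment over h is at most |h| times a bound for the gradient.
    Dividing by |h| is what makes the estimates uniform as h tends to 0. *)
Let quot_bounded (F : 'I_n -> 'rV[R]_n -> R) : (forall i, smooth_on U (F i)) ->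
  Bd (fun t y => (F t.2 (y + t.1) - F t.2 y) / `|t.1|).
Proof.
move=> sF.
have /choice[C HC] (j : 'I_n) : exists C : R, 0 <= C /\
    forall i x, `|x - c| <= 6 * r -> `|'D_(e_ j) (F i) x| <= C.
  have [C C0 HC] := family_bound (fun i => @smooth_on_pderiv _ _ _ _ j (sF i)).
  by exists C.
exists (\sum_j C j) => t y [ad [y1 y2]].
have h0 := adm0 ad; rewrite normrM normfV normr_id ler_pdivrMr ?normr_gt0//.
(* Origin of the 6 in [rU]: y and y + h within 2r of c force |h| < 4r, and the intermediate points,
   within 4r of y, stay within 6r of c. *)
have hr : `|t.1| < 4 * r.
  rewrite [X in `|X| < _](_ : t.1 = (y + t.1 - c) - (y - c)).
    rewrite (le_lt_trans (ler_normB _ _))// (_ : 4 * r = 2 * r + 2 * r) ?ltrD//; ring.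
  by apply/rowP => i; rewrite !mxE; ring.
have yb : ball y (4 * r) (y + t.1) by rewrite mx_norm_ball /ball_ /= opprD addNKr normrN.
have zb z : ball y (4 * r) z -> `|z - c| <= 6 * r.
  rewrite mx_norm_ball /ball_ /= => yz; rewrite (_ : z - c = (y - c) - (y - z)).
    rewrite (le_trans (ler_normB _ _))// (_ : 6 * r = 2 * r + 4 * r) ?lerD ?ltW//; ring.
  by apply/rowP => i; rewrite !mxE; ring.
have dz z : ball y (4 * r) z -> forall i, derivable (F t.2) z (e_ i).
  by move=> /zb/rU Uz i; exact: smooth_on_derivable (sF t.2) Uz.
have [z [zP ->]] := rV_mvt dz yb.
apply: le_trans (ler_norm_sum _ _ _) _; rewrite mulr_suml; apply: ler_sum => j _.
rewrite (_ : (y + t.1) 0 j - y 0 j = t.1 0 j); last by rewrite mxE; ring.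
rewrite normrM mulrC ler_pM ?rV_norm_coord//.
have [_ H] := HC j; apply: H; apply: zb; apply/ballrV; split; first by rewrite mulr_gt0.
move=> i; rewrite distrC (le_lt_trans (zP j i))//.
rewrite (_ : (y + t.1) 0 i - y 0 i = t.1 0 i); last by rewrite mxE; ring.
exact: le_lt_trans (rV_norm_coord _ _) hr.
Qed.

(** The derivative of the difference quotient of [F] is the difference quotient of the derivative of
    [F], so the uniform bound applies again at every order. *)
Let class_quot (F : 'I_n -> 'rV[R]_n -> R) k : (forall i, smooth_on U (F i)) ->
  diffclass dir W Bd k (fun t y => (F t.2 (y + t.1) - F t.2 y) / `|t.1|).
Proof.
elim: k F => [|k ih] F sF; first by split=> //; exact: quot_bounded.
split=> [|u]; first exact: quot_bounded.
split.
  move=> t y [_ /VU[Uy Uyh]].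
  apply: derivableM; last exact: derivable_cst.
  apply: derivableB; last exact: smooth_on_derivable (sF t.2) Uy.
  by apply: derivable_shift; exact: smooth_on_derivable (sF t.2) Uyh.
apply: (diffclass_ext oW Bdext _ (ih (fun i => 'D_(e_ i) (F i)) _)) => [t y [_ /VU[Uy Uyh]]|i].
  have d1 := derivable_shift (smooth_on_derivable (sF t.2) Uyh : derivable _ _ (e_ t.2)).
  have d2 : derivable (F t.2) y (e_ t.2) := smooth_on_derivable (sF t.2) Uy.
  have d3 := @is_deriveB _ _ _ _ _ _ _ _ _ (derivableP d1) (derivableP d2).
  have d4 := @is_deriveM _ _ _ _ _ _ _ _ d3 (is_derive_cst (`|t.1|^-1) y (e_ t.2)).
  have [_ E] := d4.
  transitivity ('D_(e_ t.2) (((fun y => F t.2 (y + t.1)) - F t.2) * cst `|t.1|^-1) y); last by [].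
  by rewrite E scaler0 add0r derive_shift /GRing.scale /= mulrC.
exact: smooth_on_pderiv.
Qed.

Let b t y : R := ('D_(e_ t.2) Phi (y + t.1) - 'D_(e_ t.2) Phi y) / `|t.1|.

Let b_ge t y : W t y -> c1 <= `|b t y|.
Proof.
move=> [ad [y1 y2]]; have h0 := adm0 ad.
rewrite /b normrM normfV normr_id ler_pdivlMr ?normr_gt0//.
exact: admP.
Qed.

Let q t y : R := (b t y)^-1.

Let class_q k : diffclass dir W Bd k q.
Proof.
pose psi j (z : R) := (-1) ^+ j * j`!%:R * (z ^+ j.+1)^-1.
have cb := class_quot k (fun i => @smooth_on_pderiv _ _ _ _ i sPhi).
have H := @diffclass_comp _ _ _ _ dir W oW Bd Bdext BdD BdM k psi _ _ _ cb 0%N.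
apply: (diffclass_ext oW Bdext _ (H _ _)) => [t y Wy|t y Wy j|j].
- by rewrite /psi fact0 expr0 !mul1r expr1.
- apply: is_derive_invpow.
  by rewrite -normr_gt0 (lt_le_trans c10)// b_ge.
- exists (j`!%:R * (c1 ^+ j.+1)^-1) => t y Wy.
  rewrite /psi !normrM normrX normrN1 expr1n mul1r normr_nat ler_wpM2l//.
  rewrite normfV normrX lef_pV2 ?posrE ?exprn_gt0//; last first.
    by rewrite (lt_le_trans c10)// b_ge.
  by apply: lerXn2r; rewrite ?nnegrE ?(ltW c10)// b_ge.
Qed.

(* The amplitude left after [N] integrations by parts in the variable [t.2], each
   of which gains a factor [s * `|t.1|]. *)
Let amp t (N : nat) : 'rV[R]_n -> R :=
  iter N (fun A => 'D_(e_ t.2) (fun y => A y * q t y)) (fun y => chi y * chi (y + t.1)).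

Let class_amp N k : diffclass dir W Bd k (fun t => amp t N).
Proof.
elim: N k => [|N ih] k.
  apply: (diffclassM oW Bdext BdD BdM).
    apply: (@class_fam (fun=> chi)) => i; exact: smooth_on_sub tchi.1.
  apply: (@class_fam_shift (fun=> chi)) => i; exact: smooth_on_sub tchi.1.
have H := diffclassM oW Bdext BdD BdM (ih k.+1) (class_q k.+1).
by have [_] := diffclassS H tt.
Qed.

Let smooth_q t : adm t.1 t.2 -> smooth_on (V t.1) (q t).
Proof.
move=> ad; have oVt := @oV t.1.
have s1 : smooth_on (V t.1) ('D_(e_ t.2) Phi).
  by apply: (smooth_on_sub _ (@smooth_on_pderiv _ _ _ _ t.2 sPhi)) => y /VU[].
have s2 : smooth_on (V t.1) (fun y => 'D_(e_ t.2) Phi (y + t.1)).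
  apply: (smooth_on_sub _ (smooth_on_shift (v := t.1) (@smooth_on_pderiv _ _ _ _ t.2 sPhi))).
  by move=> y /VU[].
have s3 : smooth_on (V t.1) (b t).
  exact (smooth_onM oVt (smooth_onB oVt s2 s1) (smooth_on_cst _ oVt)).
apply: (smooth_on_inv oVt _ s3) => y Vy.
by rewrite -normr_gt0 (lt_le_trans c10)// b_ge.
Qed.

Let supp h (A : 'rV[R]_n -> R) := forall y, ~ K h y -> A y = 0.

Let test_K h (A : 'rV[R]_n -> R) : smooth_on (V h) A -> supp h A -> test A.
Proof.
move=> sA A0; split; first exact (smooth_on_cutoff (@cK h) (@KV h) sA A0).
exists (r + `|c| + 1) => x rx; apply: A0 => -[xc _].
have : `|x| <= `|x - c| + `|c| by rewrite -{1}(subrK c x) ler_normD.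
move=> H; have : r + `|c| + 1 <= r + `|c| by rewrite (le_trans rx)// (le_trans H)// lerD2r.
by rewrite gerDl ler10.
Qed.

Let supp_deriv h A i : supp h A -> supp h ('D_(e_ i) A).
Proof.
move=> A0 y Ky; rewrite -(derive_cst (0 : R) y (e_ i)); apply: near_eq_derive.
have : nbhs y (~` K h) by apply: open_nbhs_nbhs; split => //; exact: closed_openC.
by apply: filterS => z Kz; rewrite A0.
Qed.

Let amp_test t N : adm t.1 t.2 -> test (amp t N) /\ supp t.1 (amp t N).
Proof.
move=> ad; elim: N => [|N [tN sN]].
  split; first exact: (testM tchi (test_shift t.1 tchi).1).
  move=> y nK; have [y1|y1] := leP `|y - c| r; last by rewrite /amp/= chi0// mul0r.
  have [y2|y2] := leP `|y + t.1 - c| r; last by rewrite /amp/= (chi0 y2) mulr0.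
  by case: nK.
have sq : supp t.1 (fun y => amp t N y * q t y) by move=> y /sN ->; rewrite mul0r.
have tq : test (fun y => amp t N y * q t y).
  apply: (test_K _ sq).
  exact (smooth_onM (@oV t.1) (smooth_on_sub (@subsetT _ _) tN.1) (smooth_q ad)).
by split; [exact: test_pderiv|exact: supp_deriv].
Qed.

(** The i-th derivative of the phase [P] is s |h| [b t], and [q t] is the inverse of [b t]. Hence
    the derivative of [amp t N * q t * sin P] is the difference of the two integrands, and its
    integral vanishes. The sine left over is minus a cosine advanced by a quarter period. *)
Let ibp_step t th s N : adm t.1 t.2 ->
  s * `|t.1| * \int[lam]_y (amp t N y * cos (th + s * (Phi (y + t.1) - Phi y))) =
  \int[lam]_y (amp t N.+1 y * cos (th + pi / 2 + s * (Phi (y + t.1) - Phi y))).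
Proof.
move=> ad; have h0 := adm0 ad; have oVt := @oV t.1.
have [tA sA] := amp_test N ad; have [tA1 sA1] := amp_test N.+1 ad.
pose P y := th + s * (Phi (y + t.1) - Phi y).
have sP : smooth_on (V t.1) P.
  have s1 : smooth_on (V t.1) Phi by apply: (smooth_on_sub _ sPhi) => y /VU[].
  have s2 : smooth_on (V t.1) (fun y => Phi (y + t.1)).
    by apply: (smooth_on_sub _ (smooth_on_shift (v := t.1) sPhi)) => y /VU[].
  exact (smooth_onD oVt (smooth_on_cst _ oVt) (smooth_onM oVt (smooth_on_cst _ oVt) (smooth_onB oVt s2 s1))).
pose Q y := amp t N y * q t y.
have sQV : smooth_on (V t.1) Q.
  exact (smooth_onM oVt (smooth_on_sub (@subsetT _ _) tA.1) (smooth_q ad)).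
have tH : test (fun y => Q y * sin (P y)).
  apply: (@test_K t.1); first exact (smooth_onM oVt sQV (smooth_on_sin oVt sP)).
  by move=> y /sA; rewrite /Q => ->; rewrite !mul0r.
have tC N' th' : test (fun y => amp t N' y * cos (th' + s * (Phi (y + t.1) - Phi y))).
  have [tN' sN'] := amp_test N' ad.
  apply: (@test_K t.1); last by move=> y /sN' ->; rewrite mul0r.
  have s1 : smooth_on (V t.1) Phi by apply: (smooth_on_sub _ sPhi) => y /VU[].
  have s2 : smooth_on (V t.1) (fun y => Phi (y + t.1)).
    by apply: (smooth_on_sub _ (smooth_on_shift (v := t.1) sPhi)) => y /VU[].
  exact (smooth_onM oVt (smooth_on_sub (@subsetT _ _) tN'.1) (smooth_on_cos oVt
    (smooth_onD oVt (smooth_on_cst _ oVt) (smooth_onM oVt (smooth_on_cst _ oVt) (smooth_onB oVt s2 s1))))).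
have dH y : 'D_(e_ t.2) (fun y => Q y * sin (P y)) y =
    s * `|t.1| * (amp t N y * cos (th + s * (Phi (y + t.1) - Phi y))) -
    amp t N.+1 y * cos (th + pi / 2 + s * (Phi (y + t.1) - Phi y)).
  (* Off the closed set [K] everything vanishes in a neighbourhood of y; on [K] the function [Phi]
     is known to be differentiable at y and at y + h. *)
  have [Ky|Ky] := pselect (K t.1 y); last first.
    rewrite sA// sA1// !mul0r mulr0 subr0.
    apply: (@supp_deriv t.1 (fun y => Q y * sin (P y))) => // z Kz.
    by rewrite /Q sA// !mul0r.
  have Vy := KV Ky; have [Uy Uyh] := VU Vy.
  have dQ : is_derive y (e_ t.2) Q (amp t N.+1 y).
    exact: (derivableP (smooth_on_derivable sQV Vy)).
  have dP : is_derive y (e_ t.2) P (s * (b t y * `|t.1|)).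
    have d1 : derivable (fun y => Phi (y + t.1)) y (e_ t.2).
      exact: (derivable_shift (smooth_on_derivable sPhi Uyh)).
    have d2 : derivable Phi y (e_ t.2) := smooth_on_derivable sPhi Uy.
    have d3 := @is_deriveB _ _ _ _ _ _ _ _ _ (derivableP d1) (derivableP d2).
    have d4 := @is_deriveZ _ _ _ _ s _ _ _ d3.
    have d5 := @is_deriveD _ _ _ _ _ _ _ _ _ (is_derive_cst th y (e_ t.2)) d4.
    apply: (is_derive_eq d5); rewrite add0r derive_shift /GRing.scale /= /b divfK//.
    by rewrite normr_eq0.
  have dS := is_derive_chain1 (is_derive_sin (P y)) dP.
  have [_ ->] := @is_deriveM _ _ _ _ _ _ _ _ dQ dS.
  rewrite /GRing.scale /= /Q.
  have b0 : b t y != 0 by rewrite -normr_gt0 (lt_le_trans c10)// b_ge.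
  rewrite (_ : cos (th + pi / 2 + _) = - sin (P y)); last first.
    by rewrite -cosDpihalf /P; congr cos; ring.
  rewrite -/(P y) /q; move: (amp t N.+1 y) (amp t N y) => a1 a2.
  by field.
have := Rintegral_pderiv t.2 tH.
under eq_Rintegral do rewrite dH.
rewrite RintegralB//.
- rewrite RintegralZl//; last exact: test_integrable (tC N th).
  by move=> /eqP; rewrite subr_eq0 => /eqP.
- have := integrableZl measurableT (s * `|t.1|) (test_integrable (tC N th)).
  by apply: eq_integrable => // y _; rewrite /= EFinM.
- exact: test_integrable (tC N.+1 (th + pi / 2)).
Qed.

Let ibp t th s N : adm t.1 t.2 ->
  (s * `|t.1|) ^+ N * \int[lam]_y (amp t 0 y * cos (th + s * (Phi (y + t.1) - Phi y))) =
  \int[lam]_y (amp t N y * cos (th + N%:R * (pi / 2) + s * (Phi (y + t.1) - Phi y))).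
Proof.
move=> ad; elim: N => [|N ih].
  by rewrite expr0 mul1r; apply: eq_Rintegral => y _; rewrite mul0r addr0.
rewrite exprS -mulrA ih ibp_step//; apply: eq_Rintegral => y _.
by rewrite -[in RHS]natr1 [in RHS]mulrDl mul1r addrA.
Qed.

(** The constant is chosen before h, i, [th] and [s]: it comes from the uniform bound on the N-th
    amplitude, multiplied by the weight [decay] of a fixed ball containing all supports. *)
Lemma corr_nonstationary N : exists C : R, forall h i, adm h i -> forall th s,
  (`|s| * `|h|) ^+ N * `|corr Phi chi s th h| <= C.
Proof.
have [C HC] := diffclassB (class_amp N 0).
pose C' := (`|C| * (1 + (r + `|c| + 1) ^+ 2) ^+ n).
exists (C' * \int[lam]_y decay y) => h i ad th s.
have /= [tA sA] := @amp_test (h, i) N ad.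
have ampC y : `|amp (h, i) N y| <= C' * decay y.
  apply: support_decay => //.
    move=> {}y; have [Ky|Ky] := pselect (K h y); last by rewrite sA// normr0.
    rewrite (le_trans (HC (h, i) y _))// ?ler_norm//; split=> //=; exact: KV.
  move=> {}y ry; apply: sA => -[yc _].
  have : `|y| <= `|y - c| + `|c| by rewrite -{1}(subrK c y) ler_normD.
  move=> H; have : r + `|c| + 1 <= r + `|c| by rewrite (le_trans ry)// (le_trans H)// lerD2r.
  by rewrite gerDl ler10.
have := @ibp (h, i) th s N ad; rewrite /= -/(corr Phi chi s th h) => E.
rewrite -[`|h|]normr_id -normrM -normrX -normrM E.
have iD : integ (fun y => C' * decay y).
  have := integrableZl measurableT C' (integrable_decay (R := R) n).
  by apply: eq_integrable => // y _; rewrite /= EFinM.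
rewrite -RintegralZl//; last exact: integrable_decay.
have i1 : integ (fun y => amp (h, i) N y * cos (th + N%:R * (pi / 2) + s * (Phi (y + h) - Phi y))).
  have sN' := sA; apply: test_integrable; apply: (@test_K h); last by move=> y /sA ->; rewrite mul0r.
  have oVt := @oV h.
  have s1 : smooth_on (V h) Phi by apply: (smooth_on_sub _ sPhi) => y /VU[].
  have s2 : smooth_on (V h) (fun y => Phi (y + h)).
    by apply: (smooth_on_sub _ (smooth_on_shift (v := h) sPhi)) => y /VU[].
  exact (smooth_onM oVt (smooth_on_sub (@subsetT _ _) tA.1) (smooth_on_cos oVt
    (smooth_onD oVt (smooth_on_cst _ oVt) (smooth_onM oVt (smooth_on_cst _ oVt) (smooth_onB oVt s2 s1))))).
apply: le_trans (le_normr_Rintegral measurableT i1) _.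
apply: le_Rintegral => //; first exact: integrable_norm i1.
by move=> y _; rewrite normrM (le_trans _ (ampC y))// ler_piMr// norm_cos_le1.
Qed.

End nonstationary_phase.
Section positivity.
Context {R : realType} {n : nat}.
Local Notation lam := (lebesgue_rV R n).
Local Notation integ f := (lam.-integrable setT (EFin \o f)).

(** On a small cube around [x0], whose measure is known from [lebesgue_rV_box], the function exceeds
    half of [g x0]. Continuity at the one point [x0] is the form that suits real powers of the
    energy, which are differentiated only where the energy is positive. *)
Lemma Rintegral_gt0 (g : 'rV[R]_n -> R) (x0 : 'rV[R]_n) :
  {for x0, continuous g} -> integ g -> (forall x, 0 <= g x) -> 0 < g x0 ->
  0 < \int[lam]_x g x.
Proof.
move=> cg ig g0 gx0.
have e0 : 0 < g x0 / 2 by rewrite divr_gt0.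
have /(@cvgrPdist_lt _ _ _ (nbhs x0) _)/(_ _ e0) := cg.
move=> /nbhs_ballP[d /= d0 Hd].
pose A (i : 'I_n) : set R := [set` `]x0 0 i - d, x0 0 i + d[].
pose B := [set x : 'rV[R]_n | forall i, A i (x 0 i)].
have AE (i : 'I_n) (y : R) : A i y <-> `|x0 0 i - y| < d.
  rewrite /A /= in_itv/= distrC ltr_norml; split => /andP[? ?]; apply/andP; split; lra.
have BE : B = ball x0 d.
  apply/seteqP; split => x; first by move=> Bx; apply/ballrV; split => // i; exact/AE/Bx.
  by move=> /ballrV[_ Bx] i; exact/AE/Bx.
have mB : measurable B by rewrite BE; apply: open_measurable_rV; exact: ball_open.
have muB : lam B = ((d + d) ^+ n)%:E.
  rewrite /B lebesgue_rV_box => [|i]; last exact: measurable_itv.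
  rewrite (eq_bigr (fun=> (d + d)%:E)) => [|i _].
    by rewrite prodEFin prodr_const card_ord.
  rewrite /A lebesgue_measure_itv/= lte_fin; have -> : x0 0 i - d < x0 0 i + d by move: d0 => /=; lra.
  by rewrite -EFinB; congr EFin; ring.
have /integrableP[mg goo] := ig.
have pos : ((g x0 / 2 * (d + d) ^+ n)%:E <= \int[lam]_x (g x)%:E)%E.
  apply: (@le_trans _ _ (\int[lam]_(x in B) (cst (g x0 / 2)%:E x))%E).
    by rewrite integral_cst// [X in (_ <= _ * X)%E](_ : _ = ((d + d) ^+ n)%:E).
  apply: (@le_trans _ _ (\int[lam]_(x in B) (g x)%:E)%E).
    apply: ge0_le_integral => //.
    - by move=> x _; rewrite lee_fin ltW.
    - exact: measurable_funS mg.
    - move=> x; rewrite BE => /Hd /= H; rewrite lee_fin.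
      by move: H; rewrite ltr_norml => /andP[_ H]; lra.
  apply: ge0_subset_integral => //.
  by move=> x _; rewrite lee_fin.
have : 0 < g x0 / 2 * (d + d) ^+ n by rewrite mulr_gt0// exprn_gt0// addr_gt0.
rewrite -lte_fin => /lt_le_trans/(_ pos).
rewrite /Rintegral => H; apply: fine_gt0; rewrite H /=.
by have := integrable_fin_num measurableT ig; rewrite fin_numE => /andP[_]; rewrite ltey.
Qed.

End positivity.

(** * The dispersive bound near a nondegenerate point *)

Section dispersive.
Context {R : realType} {n : nat}.
Implicit Types (x y z v h : 'rV[R]_n) (th s : R).
Local Notation e_ i := (delta_mx 0 i : 'rV[R]_n).
Local Notation lam := (lebesgue_rV R n).
Local Notation integ f := (lam.-integrable setT (EFin \o f)).

(** From h = (h M) M^-1: if every coordinate of h M were below c0 |h|, then |h| would be at most c0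
    B |h|, where B is the sum of the absolute entries of M^-1 and c0 = 1/(B + 1). *)
Lemma unitmx_lower_bound (M : 'M[R]_n) : M \in unitmx ->
  exists2 c0 : R, 0 < c0 & forall h, h != 0 -> exists i, c0 * `|h| <= `|(h *m M) 0 i|.
Proof.
move=> uM; pose B := \sum_k \sum_j `|invmx M k j|.
have B0 : 0 <= B by apply: sumr_ge0 => k _; apply: sumr_ge0.
exists (B + 1)^-1; first by rewrite invr_gt0 ltr_wpDl.
move=> h h0; apply: contrapT => /forallNP H.
have hp : 0 < `|h| by rewrite normr_gt0.
suff : `|h| <= (B + 1)^-1 * `|h| * B.
  rewrite mulrAC -[X in X <= _]mul1r ler_pM2r// mulrC ler_pdivlMr ?ltr_wpDl// mul1r.
  by rewrite gerDl ler10.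
apply/rV_norm_le; split.
  by rewrite !mulr_ge0// ?invr_ge0 ?addr_ge0.
move=> j; rewrite -{1}(mulmxK uM h) mxE.
apply: le_trans (ler_norm_sum _ _ _) _; rewrite mulr_sumr; apply: ler_sum => k _.
rewrite normrM ler_pM//.
  by have /negP := H k; rewrite -ltNge => /ltW.
by rewrite (bigD1 j)//= lerDl; apply: sumr_ge0.
Qed.

Definition hessian (Phi : 'rV[R]_n -> R) x : 'M[R]_n :=
  \matrix_(j, i) 'D_(e_ j) ('D_(e_ i) Phi) x.

Lemma hessianE (Phi : 'rV[R]_n -> R) x j i :
  hessian Phi x j i = 'D_(e_ j) ('D_(e_ i) Phi) x.
Proof. by rewrite mxE. Qed.

Lemma hessian_near (U : set 'rV[R]_n) (Phi : 'rV[R]_n -> R) c eta :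
  open U -> U c -> smooth_on U Phi -> 0 < eta ->
  exists2 r : R, 0 < r & forall x, `|x - c| <= 6 * r ->
    U x /\ forall j i, `|hessian Phi x j i - hessian Phi c j i| <= eta.
Proof.
move=> oU Uc sPhi eta0.
have H1 : nbhs c U by exact: open_nbhs_nbhs.
have H2 (ji : 'I_n * 'I_n) : nbhs c (fun x =>
    `|hessian Phi c ji.1 ji.2 - hessian Phi x ji.1 ji.2| < eta).
  have E : (fun x => hessian Phi x ji.1 ji.2) = 'D_(e_ ji.1) ('D_(e_ ji.2) Phi).
    by apply/funext => x; exact: hessianE.
  have cD : {for c, continuous (fun x => hessian Phi x ji.1 ji.2)}.
    rewrite E; exact (smooth_on_continuous (@smooth_on_pderiv _ _ _ _ ji.1
      (@smooth_on_pderiv _ _ _ _ ji.2 sPhi)) Uc).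
  by have /(@cvgrPdist_lt _ _ _ (nbhs c) _)/(_ _ eta0) := cD.
have H3 : nbhs c (fun x => forall ji : 'I_n * 'I_n,
    `|hessian Phi c ji.1 ji.2 - hessian Phi x ji.1 ji.2| < eta).
  exact: (@filter_forall _ _ _ (nbhs c) _ H2).
have /nbhs_ballP[e /= e0 He] : nbhs c (U `&` (fun x => forall ji : 'I_n * 'I_n,
    `|hessian Phi c ji.1 ji.2 - hessian Phi x ji.1 ji.2| < eta)).
  exact: filterI.
exists (e / 12); first by rewrite divr_gt0.
move=> x xc; have bx : ball c e x.
  rewrite mx_norm_ball /ball_ /= distrC (le_lt_trans xc)//.
  rewrite (_ : 6 * (e / 12) = e / 2); last by field.
  by rewrite ltr_pdivrMr// ltr_pMr// ltr1n.
have [Ux Hx] := He x bx.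
split; first exact Ux.
move=> j i; rewrite distrC; exact (ltW (Hx (j, i))).
Qed.

Variables (U : set 'rV[R]_n) (Phi : 'rV[R]_n -> R) (c : 'rV[R]_n).
Hypothesis oU : open U.
Hypothesis Uc : U c.
Hypothesis sPhi : smooth_on U Phi.
Hypothesis uM : hessian Phi c \in unitmx.

Lemma jbracket_gt0 (s : R) : 0 < jbracket s.
Proof. by rewrite sqrtr_gt0 ltr_pwDl// sqr_ge0. Qed.

Lemma dispersive_estimate : exists r : R, [/\ 0 < r,
  (forall x, `|x - c| <= r -> U x) &
  exists2 C : R, 0 < C & forall s x,
    energy Phi (bump c r) s x <= C * (jbracket s ^+ n)^-1].
Proof.
have [c0 c00 Hc0] := unitmx_lower_bound uM.
(* Error budget for the mean value theorem: n terms, each at most |h| eta, add up to at most c0 / 2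
   |h|, half of the lower bound at c. The [+ 1] keeps the quotient meaningful for n = 0. *)
pose eta := c0 / 2 / (n%:R + 1).
have n0 : 0 < n%:R + 1 :> R by rewrite ltr_wpDl.
have eta0 : 0 < eta by rewrite !divr_gt0.
have [r r0 Hr] := hessian_near oU Uc sPhi eta0.
have rU6 x : `|x - c| <= 6 * r -> U x by move=> /Hr[].
have rU x : `|x - c| <= r -> U x.
  by move=> H; apply: rU6; rewrite (le_trans H)// ler_pMl// ler1n.
exists r; split => //.
pose chi := bump c r.
have tchi : test chi by exact: test_bump.
have chi0 x : r < `|x - c| -> chi x = 0 by move=> /ltW; exact: bump_eq0.
pose adm h (i : 'I_n) := h != 0 /\ c0 * `|h| <= `|(h *m hessian Phi c) 0 i|.
have adm0 h i : adm h i -> h != 0 by case.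
have c20 : 0 < c0 / 2 by rewrite divr_gt0.
(* By the mean value theorem the increment of 'D_(e_ i) Phi is the i-th
   coordinate of [h *m hessian Phi c], up to an error at most c0 / 2 |h|. *)
have admP h i : adm h i -> forall y, `|y - c| < 2 * r -> `|y + h - c| < 2 * r ->
  c0 / 2 * `|h| <= `|'D_(e_ i) Phi (y + h) - 'D_(e_ i) Phi y|.
  move=> [h0 hi] y y1 y2.
  have hr : `|h| < 4 * r.
    rewrite [X in `|X| < _](_ : h = (y + h - c) - (y - c)).
      rewrite (le_lt_trans (ler_normB _ _))// (_ : 4 * r = 2 * r + 2 * r) ?ltrD//; ring.
    by apply/rowP => k; rewrite !mxE; ring.
  have yb : ball y (4 * r) (y + h) by rewrite mx_norm_ball /ball_ /= opprD addNKr normrN.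
  have zb z : ball y (4 * r) z -> `|z - c| <= 6 * r.
    rewrite mx_norm_ball /ball_ /= => yz; rewrite (_ : z - c = (y - c) - (y - z)).
      rewrite (le_trans (ler_normB _ _))// (_ : 6 * r = 2 * r + 4 * r) ?lerD ?ltW//; ring.
    by apply/rowP => k; rewrite !mxE; ring.
  have dz z : ball y (4 * r) z -> forall k, derivable ('D_(e_ i) Phi) z (e_ k).
    move=> /zb/rU6 Uz k; exact: smooth_on_derivable (@smooth_on_pderiv _ _ _ _ i sPhi) Uz.
  have [z [zP E]] := rV_mvt dz yb.
  have yh k : (y + h) 0 k - y 0 k = h 0 k by rewrite mxE; ring.
  have close : `|('D_(e_ i) Phi (y + h) - 'D_(e_ i) Phi y) - (h *m hessian Phi c) 0 i|
      <= c0 / 2 * `|h|.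
    rewrite E mxE -sumrB.
    apply: le_trans (ler_norm_sum _ _ _) _.
    apply: (@le_trans _ _ (\sum_(k < n) `|h| * eta)).
      apply: ler_sum => k _; rewrite yh -mulrBr normrM ler_pM ?rV_norm_coord//.
      have [_ H] : U (z k) /\ forall j i, `|hessian Phi (z k) j i - hessian Phi c j i| <= eta.
        apply: Hr; apply: zb; apply/ballrV; split; first by rewrite mulr_gt0.
        move=> l; rewrite distrC (le_lt_trans (zP k l))// yh.
        exact: le_lt_trans (rV_norm_coord _ _) hr.
      by rewrite -hessianE; exact: H.
    rewrite sumr_const card_ord -[_ *+ n]mulr_natr.
    rewrite (_ : `|h| * eta * n%:R = c0 / 2 * `|h| * (n%:R / (n%:R + 1))); last by rewrite /eta; field; rewrite gt_eqF.
    have q1 : n%:R / (n%:R + 1) <= 1 :> R by rewrite ler_pdivrMr// mul1r lerDl.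
    by have := ler_wpM2l (mulr_ge0 (ltW c20) (normr_ge0 h)) q1; rewrite mulr1.
  have : `|(h *m hessian Phi c) 0 i| <= `|'D_(e_ i) Phi (y + h) - 'D_(e_ i) Phi y| + c0 / 2 * `|h|.
    rewrite -lerBlDl; apply: le_trans close; rewrite [leRHS]distrC; exact: lerB_dist.
  move=> H; have := le_trans hi H; move: (`|h|) (`|_ - _|) => a b; lra.
have [C0 H0] := corr_nonstationary sPhi r0 tchi chi0 rU6 c20 adm0 admP 0.
(* [decay] has n factors, each quadratic, so 2n integrations by parts are needed; the instance with
   none covers small |s h|. *)
have [C1 H1] := corr_nonstationary sPhi r0 tchi chi0 rU6 c20 adm0 admP (2 * n).
pose C2 := \int[lam]_y (chi y * chi y).
pose D := 2 ^+ n * (`|C0| + `|C1| + `|C2|).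
have D0 : 0 <= D by rewrite mulr_ge0 ?exprn_ge0// !addr_ge0.
have HD s th h : `|corr Phi chi s th h| <= D * decay (s *: h).
  (* No coordinate is admissible for h = 0, but there the autocorrelation is [C2] times [cos th] and
     the weight is 1; this is why [D] contains [C2]. *)
  have [->|hn0] := eqVneq h 0.
    rewrite scaler0 /decay; under eq_bigr do rewrite mxE expr0n addr0 invr1.
    rewrite big1// mulr1 /corr.
    have i2 : integ (fun y => chi y * chi y) by exact: test_integrable (testM tchi tchi.1).
    have -> : \int[lam]_y (chi y * chi (y + 0) * cos (th + s * (Phi (y + 0) - Phi y))) =
      \int[lam]_y (chi y * chi y) * cos th.
      by rewrite -RintegralZr//; apply: eq_Rintegral => y _; rewrite addr0 subrr mulr0 addr0.
    rewrite normrM (@le_trans _ _ `|C2|)//; first by rewrite ler_piMr// norm_cos_le1.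
    rewrite (@le_trans _ _ (`|C0| + `|C1| + `|C2|))// ?lerDr ?addr_ge0// ler_peMl ?addr_ge0//.
    by rewrite exprn_ege1// ler1n.
  have [i hi] := Hc0 h hn0; have ad : adm h i by [].
  have := H0 h i ad th s; rewrite expr0 mul1r => {}H0.
  have {}H1 := H1 h i ad th s.
  rewrite /decay prodfV ler_pdivlMr; last by apply: prodr_gt0 => k _; exact: oneDsqr_gt0'.
  have sh0 : 0 <= (`|s| * `|h|) ^+ 2 by exact: sqr_ge0.
  apply: (@le_trans _ _ (`|corr Phi chi s th h| * (1 + (`|s| * `|h|) ^+ 2) ^+ n)).
    rewrite ler_wpM2l// -[X in _ <= _ ^+ X]card_ord -prodr_const.
    apply: ler_prod => k _; rewrite ltW ?oneDsqr_gt0'//= lerD2l mxE.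
    rewrite -[X in X <= _]real_normK ?num_real// normrM.
    by rewrite lerXn2r ?nnegrE ?mulr_ge0// ler_wpM2l// rV_norm_coord.
  apply: le_trans (ler_wpM2l (normr_ge0 _) (oneD_expr_le n sh0)) _.
  rewrite mulrCA ler_wpM2l ?exprn_ge0// mulrDr mulr1 -exprM.
  rewrite (@le_trans _ _ (`|C0| + `|C1|))// ?lerDl// lerD//.
    exact: le_trans H0 (ler_norm _).
  by rewrite mulrC (le_trans H1)// ler_norm.
pose I0 := \int[lam]_y `|chi y|.
have I00 : 0 <= I0 by apply: Rintegral_ge0.
pose E0 := I0 ^+ 2 + I0 ^+ 2.
have HE0 s x : energy Phi chi s x <= E0.
  rewrite /energy /E0 -[X in X + _ <= _]real_normK ?num_real//.
  rewrite -[X in _ + X <= _]real_normK ?num_real//.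
  by rewrite lerD// lerXn2r ?nnegrE// (wave_bound oU sPhi tchi chi0 rU).
pose I1 := \int[lam]_h (decay h : R).
have I10 : 0 <= I1 by apply: Rintegral_ge0 => h _; exact: ltW (decay_gt0 h).
(* The term with [E0] serves |s| <= 1, where the bracket is at most 2; the term with [D * I1] serves
   |s| > 1, where the bracket is at most 2 |s|. The final 1 makes the constant positive. *)
pose CC := 2 ^+ n * (E0 + D * I1) + 1.
have E00 : 0 <= E0 by rewrite addr_ge0 ?sqr_ge0.
exists CC; first by rewrite ltr_wpDl// mulr_ge0 ?exprn_ge0// addr_ge0// mulr_ge0.
move=> s x; rewrite ler_pdivlMr ?exprn_gt0 ?jbracket_gt0//.
have e0 : 0 <= energy Phi chi s x by rewrite addr_ge0 ?sqr_ge0.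
have [s1|s1] := leP `|s| 1.
  have jb : jbracket s <= 2.
    rewrite -[leRHS]ger0_norm// -sqrtr_sqr ler_sqrt ?sqr_ge0//.
    have : `|s| ^+ 2 <= 1 by rewrite expr_le1.
    by move=> H; lra.
  apply: (@le_trans _ _ (E0 * 2 ^+ n)).
    rewrite ler_pM ?exprn_ge0 ?(ltW (jbracket_gt0 _)) ?HE0//.
    by rewrite lerXn2r ?nnegrE ?(ltW (jbracket_gt0 _)).
  by rewrite /CC mulrDr [2 ^+ n * E0]mulrC -addrA lerDl addr_ge0// mulr_ge0 ?exprn_ge0// mulr_ge0.
have jb : jbracket s <= 2 * `|s|.
  have s20 : 0 <= 2 * `|s| by rewrite mulr_ge0.
  rewrite -[leRHS](ger0_norm s20) -sqrtr_sqr ler_sqrt ?sqr_ge0//.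
  have : 1 <= `|s| ^+ 2 by rewrite exprn_ege1// ltW.
  by rewrite exprMn => H; lra.
have s0 : s != 0 by rewrite -normr_gt0 (lt_trans _ s1).
have sn0 : 0 < `|s| ^+ n by rewrite exprn_gt0// (lt_trans _ s1).
have HE := energy_le oU sPhi tchi chi0 rU x r0 s0 (HD s).
apply: (@le_trans _ _ (D * (`|s| ^- n * I1) * (2 * `|s|) ^+ n)).
  rewrite ler_pM ?exprn_ge0 ?(ltW (jbracket_gt0 _))//.
  by rewrite lerXn2r ?nnegrE ?(ltW (jbracket_gt0 _)) ?mulr_ge0.
rewrite exprMn (_ : _ * (_ * _) = 2 ^+ n * (D * I1)); last first.
  by field; rewrite gt_eqF.
by rewrite /CC mulrDr addrAC lerDr addr_ge0// mulr_ge0 ?exprn_ge0.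
Qed.

End dispersive.
(** * L^p norms of wave packets *)

Section packet_norms.
Context {R : realType} {n : nat}.
Implicit Types (x y z : 'rV[R]_n) (s t p : R).
Local Notation lam := (lebesgue_rV R n).
Local Notation integ f := (lam.-integrable setT (EFin \o f)).

Lemma cLnormE p (g : 'rV[R]_n -> R[i]) :
  integ (fun x => Normc.normc (g x) `^ p) ->
  cLnorm p g = ((\int[lam]_x (Normc.normc (g x) `^ p)) `^ p^-1)%:E.
Proof.
move=> ig; have g0 x : 0 <= Normc.normc (g x) by case: (g x) => a b; exact: sqrtr_ge0.
rewrite /cLnorm unlock -poweR_EFin /Rintegral fineK; last exact: integrable_fin_num ig.
congr (poweR _ _); apply: eq_integral => x _.
by rewrite /= ger0_norm.
Qed.

Lemma normc_realM (k : R) (z : R[i]) : 0 <= k ->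
  Normc.normc (k%:C%C * z) = k * Normc.normc z.
Proof.
case: z => a b k0; rewrite /= !mul0r subr0 addr0 !exprMn -mulrDr sqrtrM ?sqr_ge0//.
by rewrite sqrtr_sqr ger0_norm.
Qed.

Variables (U : set 'rV[R]_n) (Phi chi : 'rV[R]_n -> R) (c : 'rV[R]_n) (r : R).
Hypothesis oU : open U.
Hypothesis sPhi : smooth_on U Phi.
Hypothesis tchi : test chi.
Hypothesis chi0 : forall x, r < `|x - c| -> chi x = 0.
Hypothesis rU : forall x, `|x - c| <= r -> U x.
Hypothesis chi_ge0 : forall x, 0 <= chi x.
Hypothesis chic : 0 < chi c.

Definition packet s x : R[i] := (wave Phi chi 0 s x +i* wave Phi chi (- (pi / 2)) s x)%C.

Local Notation en := (energy Phi chi).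

Lemma schwartz_packet s : schwartz (packet s).
Proof. by split; apply: schwartz_wave oU sPhi tchi chi0 rU _ _. Qed.

Lemma normc_packet s x : Normc.normc (packet s x) = Num.sqrt (en s x).
Proof. by []. Qed.

Definition packet_const : R := (2 * pi) ^- n * @invconst R n.

(** The real and imaginary parts of the integrand are [wave_rotate] with a = z.x and a = z.x + pi/2;
    integrating in x is then [wave_inversion] with phase 0 and - pi/2. *)
Lemma fourier_packet s z :
  fourier (packet s) z = ((packet_const * chi z)%:C * cis (s * Phi z))%C.
Proof.
have re : \int[lam]_x complex.Re (packet s x * cis (- dotp z x)) =
    @invconst R n * (chi z * cos (s * Phi z)).
  rewrite -[s * Phi z]add0r -(wave_inversion oU sPhi tchi chi0 rU).
  apply: eq_Rintegral => x _; rewrite /= cosN sinN mulrN opprK.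
  rewrite -[sin _]cosBpihalf (wave_rotate oU sPhi tchi chi0 rU).
  apply: eq_Rintegral => y _; rewrite addr0 dotpDr dotpNr (dotpC z); congr (_ * cos _); ring.
have im : \int[lam]_x complex.Im (packet s x * cis (- dotp z x)) =
    @invconst R n * (chi z * sin (s * Phi z)).
  rewrite -cosBpihalf [s * Phi z - _]addrC -(wave_inversion oU sPhi tchi chi0 rU).
  apply: eq_Rintegral => x _; rewrite /= cosN sinN mulrN -mulNr.
  have -> : - wave Phi chi 0 s x * sin (dotp z x) = wave Phi chi 0 s x * cos (dotp z x + pi / 2).
    by rewrite cosDpihalf mulNr mulrN.
  have -> : cos (dotp z x) = cos (dotp z x + pi / 2 - pi / 2) by rewrite addrK.
  rewrite (wave_rotate oU sPhi tchi chi0 rU).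
  apply: eq_Rintegral => y _; rewrite dotpDr dotpNr (dotpC z); congr (_ * cos _); ring.
rewrite /fourier /cintegral re im /packet_const /cis; apply/eqP; rewrite eq_complex /=.
by apply/andP; split; apply/eqP; ring.
Qed.

Lemma multiplier_packet s t x :
  multiplier Phi t (packet s) x = (packet_const%:C)%C * packet (s + t) x.
Proof.
have iw th u := integrable_wave_kernel oU sPhi tchi chi0 rU th u x.
rewrite /multiplier.
rewrite (_ : (fun xi => _) = fun xi =>
  cis (t * Phi xi + dotp xi x) * ((packet_const * chi xi)%:C * cis (s * Phi xi))%C); last first.
  by apply/funext => xi; rewrite fourier_packet.
rewrite /cintegral /packet /wave; apply/eqP; rewrite eq_complex /=.
rewrite !mul0r subr0 addr0 -!RintegralZl//.
apply/andP; split; apply/eqP; apply: eq_Rintegral => y _ /=.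
  rewrite addr0 (_ : dotp x y + (s + t) * Phi y = (t * Phi y + dotp y x) + s * Phi y).
    by move: (t * Phi y + dotp y x) (s * Phi y) => u v; rewrite cosD; ring.
  by rewrite dotpC; ring.
rewrite (_ : dotp x y - pi / 2 + (s + t) * Phi y = (t * Phi y + dotp y x) + s * Phi y - pi / 2).
  by move: (t * Phi y + dotp y x) (s * Phi y) => u v; rewrite cosBpihalf sinD; ring.
by rewrite dotpC; ring.
Qed.

Lemma energy_ge0 s x : 0 <= en s x.
Proof. by rewrite addr_ge0 ?sqr_ge0. Qed.

Lemma continuous_energy s : continuous (en s).
Proof.
have sw th := (schwartz_wave oU sPhi tchi chi0 rU th s).1.
have -> : en s = (fun x => wave Phi chi 0 s x * wave Phi chi 0 s x +
    wave Phi chi (- (pi / 2)) s x * wave Phi chi (- (pi / 2)) s x).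
  by apply/funext => x; rewrite -!expr2.
exact (smooth_continuous (smooth_onD openT (smooth_onM openT (sw _) (sw _))
  (smooth_onM openT (sw _) (sw _)))).
Qed.

Lemma energy_decay s : exists2 C : R, 0 <= C & forall x, en s x <= C * decay x ^+ 2.
Proof.
have [C1 C10 H1] := wave_decay oU sPhi tchi chi0 rU 0 s.
have [C2 C20 H2] := wave_decay oU sPhi tchi chi0 rU (- (pi / 2)) s.
exists (C1 ^+ 2 + C2 ^+ 2); first by rewrite addr_ge0 ?sqr_ge0.
move=> x; have d0 := ltW (decay_gt0 x); rewrite mulrDl -!exprMn /energy.
rewrite -[X in X + _ <= _]real_normK ?num_real// -[X in _ + X <= _]real_normK ?num_real//.
by rewrite lerD// lerXn2r ?nnegrE ?mulr_ge0.
Qed.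

(** The energy is O([decay ^+ 2]), so its power a is dominated by [decay] to the power 2a, hence by
    [decay] as soon as 2a >= 1. For a = p / 2 this is covered by p > 1. *)
Lemma integrable_energy_powR s (a : R) : 2^-1 <= a -> integ (fun x => en s x `^ a).
Proof.
move=> a2; have a0 : 0 < a by rewrite (lt_le_trans _ a2)// invr_gt0.
have [C C0 HC] := energy_decay s.
apply: (@decay_integrable _ _ _ (C `^ a)).
  apply: (measurableT_comp (measurable_powR a)); apply: continuous_measurable_rV.
  exact: continuous_energy.
move=> x; have d0 := decay_gt0 x; rewrite ger0_norm ?powR_ge0//.
apply: (@le_trans _ _ ((C * decay x ^+ 2) `^ a)).
  by apply: ge0_ler_powR; rewrite ?nnegrE ?mulr_ge0 ?sqr_ge0 ?energy_ge0//; exact: ltW.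
rewrite powRM ?sqr_ge0// ler_wpM2l ?powR_ge0//.
rewrite -powR_mulrn ?(ltW d0)// -powRrM ge1r_powR//.
  by rewrite d0 decay_le1.
by move: a2; lra.
Qed.

Lemma integrable_energy s : integ (en s).
Proof.
have := @integrable_energy_powR s 1 _; rewrite (_ : (fun x => en s x `^ 1) = en s).
  by apply; lra.
by apply/funext => x; rewrite powRr1// energy_ge0.
Qed.

(** By Plancherel the total does not depend on [s]. For s = 0 the packet takes at the origin the
    value of the integral of [chi], which is positive. *)
Lemma energy_total_gt0 s : 0 < \int[lam]_x en s x.
Proof.
rewrite (plancherel_wave oU sPhi tchi chi0 rU) -(plancherel_wave oU sPhi tchi chi0 rU 0).
apply: (@Rintegral_gt0 _ _ _ 0); [exact: continuous_energy|exact: integrable_energy|exact: energy_ge0|].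
have chi1 : 0 < \int[lam]_y chi y.
  apply: (@Rintegral_gt0 _ _ _ c) => //; first exact: smooth_continuous tchi.1 _.
  exact: test_integrable.
rewrite /energy ltr_wpDr ?sqr_ge0// exprn_gt0// /wave.
rewrite (_ : \int[lam]_x _ = \int[lam]_x chi x)//.
apply: eq_Rintegral => y _; rewrite mul0r !addr0 /dotp big1 ?cos0 ?mulr1// => i _.
by rewrite mxE mul0r.
Qed.

(** Plancherel writes a positive total energy as [invconst] times a nonnegative integral, which
    fixes the sign of [invconst]. *)
Lemma packet_const_gt0 : 0 < packet_const.
Proof.
have k0 : 0 < @invconst R n.
  have := energy_total_gt0 0; rewrite (plancherel_wave oU sPhi tchi chi0 rU) => H.
  have c2 : 0 <= \int[lam]_y (chi y ^+ 2) by apply: Rintegral_ge0 => y _; exact: sqr_ge0.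
  rewrite ltNge; apply/negP => k0; have := lt_le_trans H (mulr_le0_ge0 k0 c2).
  by rewrite ltxx.
by apply: mulr_gt0 => //; rewrite invr_gt0 exprn_gt0// mulr_gt0// pi_gt0.
Qed.

Lemma energy_pos s : exists x, 0 < en s x.
Proof.
apply: contrapT => /forallNP H; have := energy_total_gt0 s.
rewrite (_ : \int[lam]_x en s x = \int[lam]_x (0 : R)); first by rewrite Rintegral_cst// mul0r ltxx.
apply: eq_Rintegral => x _; apply/eqP; rewrite eq_le energy_ge0 andbT leNgt.
exact/negP/H.
Qed.

Lemma energy_powR_gt0 s (a : R) : 2^-1 <= a -> 0 < \int[lam]_x (en s x `^ a).
Proof.
move=> a2; have [x0 ex0] := energy_pos s.
apply: (@Rintegral_gt0 _ _ _ x0); last exact: powR_gt0.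
- have cp : {for en s x0, continuous (fun y : R => y `^ a)}.
    apply: differentiable_continuous; apply/derivable1_diffP.
    by have [] := is_derive1_powR a ex0.
  exact: (@cvg_comp _ _ _ (en s) (fun y : R => y `^ a) _ _ _ (@continuous_energy s x0) cp).
- exact: integrable_energy_powR.
- by move=> x; exact: powR_ge0.
Qed.

Lemma packet_neq0 s : packet s <> cst 0.
Proof.
move=> E; have [x ex] := energy_pos s.
have : Normc.normc (packet s x) = 0 by rewrite E /= expr0n addr0 sqrtr0.
by rewrite normc_packet => /eqP; rewrite sqrtr_eq0 leNgt ex.
Qed.

Lemma cLnorm_packet p s (k : R) : 1 < p -> 0 <= k ->
  cLnorm p (fun x => k%:C%C * packet s x) =
  (k * (\int[lam]_x (en s x `^ (p / 2))) `^ p^-1)%:E.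
Proof.
move=> p1 k0; have p0 : 0 < p by exact: lt_trans p1.
have E x : Normc.normc (k%:C%C * packet s x) `^ p = k `^ p * en s x `^ (p / 2).
  rewrite normc_realM// normc_packet powRM ?sqrtr_ge0// -powR12_sqrt ?energy_ge0//.
  by rewrite -powRrM [p / 2]mulrC.
have p2 : 2^-1 <= p / 2 by move: p1; lra.
have ie := integrable_energy_powR s p2.
rewrite cLnormE.
  congr EFin; under eq_Rintegral do rewrite E.
  rewrite RintegralZl// powRM ?powR_ge0//; last first.
    by apply: Rintegral_ge0 => x _; exact: powR_ge0.
  by rewrite -powRrM divff ?gt_eqF// powRr1.
have := integrableZl measurableT (k `^ p) ie.
by apply: eq_integrable => // x _; rewrite /= E EFinM.
Qed.

End packet_norms.

(** * Lower bound for the multiplier norm at a nondegenerate point *)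

Section lower_bound.
Context {R : realType} {n : nat}.
Local Notation lam := (lebesgue_rV R n).

Lemma jbracketN (t : R) : jbracket (- t) = jbracket t.
Proof. by rewrite /jbracket normrN. Qed.

Lemma multiplier_lower_bound (U : set 'rV[R]_n) (Phi : 'rV[R]_n -> R) c (p : R) :
  1 < p -> open U -> U c -> smooth_on U Phi -> hessian Phi c \in unitmx ->
  exists k : R, 0 < k /\ forall t : R,
    ((k * jbracket t `^ (n%:R * `|2^-1 - p^-1|))%:E <= multiplier_norm p Phi t)%E.
Proof.
move=> p1 oU Uc sPhi uM; have p0 : 0 < p by exact: lt_trans p1.
have [r [r0 rU [C C0 disp]]] := dispersive_estimate oU Uc sPhi uM.
pose chi := bump c r.
have tchi : test chi by exact: test_bump.
have chi0 x : r < `|x - c| -> chi x = 0 by move=> /ltW; exact: bump_eq0.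
have chi_ge0 x : 0 <= chi x by exact: bump_ge0.
have chic : 0 < chi c by exact: bump_gt0.
pose K := \int[lam]_x energy Phi chi 0 x.
have K0 : 0 < K by exact: (energy_total_gt0 oU sPhi tchi chi0 rU chi_ge0 chic).
have KE s : \int[lam]_x energy Phi chi s x = K.
  by rewrite /K !(plancherel_wave oU sPhi tchi chi0 rU).
pose A s := \int[lam]_x (energy Phi chi s x `^ (p / 2)).
have p2 : 2^-1 <= p / 2 by move: p1; lra.
have A0 s : 0 < A s by exact: (energy_powR_gt0 oU sPhi tchi chi0 rU chi_ge0 chic s p2).
pose M s := C * (jbracket s ^+ n)^-1.
have jb0 (s : R) : 0 < jbracket s ^+ n by rewrite exprn_gt0// jbracket_gt0.
have M0 s : 0 < M s by rewrite /M divr_gt0.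
pose a := 2^-1 - p^-1.
pose q := @packet_const R n.
have q0 : 0 < q by exact: (packet_const_gt0 oU sPhi tchi chi0 rU chi_ge0 chic).
have lower s t : ((q * (A (s + t) `^ p^-1 / A s `^ p^-1))%:E <= multiplier_norm p Phi t)%E.
  rewrite /multiplier_norm; apply: ereal_sup_ubound => /=.
  exists (packet Phi chi s).
    split; first exact: (schwartz_packet oU sPhi tchi chi0 rU).
    exact: (packet_neq0 oU sPhi tchi chi0 rU chi_ge0 chic).
  have -> : multiplier Phi t (packet Phi chi s) = (fun x => (q%:C)%C * packet Phi chi (s + t) x).
    by apply/funext => x; exact: (multiplier_packet oU sPhi tchi chi0 rU).
  have -> : packet Phi chi s = (fun x => (1%:C)%C * packet Phi chi s x).
    by apply/funext => x; rewrite mul1r.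
  rewrite !(cLnorm_packet oU sPhi tchi chi0 rU)// ?(ltW q0)//.
  by rewrite mul1r inver gt_eqF ?powR_gt0 ?A0// -EFinM mulrA.
have ie s := integrable_energy oU sPhi tchi chi0 rU s.
have iA s := integrable_energy_powR oU sPhi tchi chi0 rU s p2.
have eM s x : energy Phi chi s x <= M s by exact: disp.
have e0 s x := energy_ge0 Phi chi s x.
(* Source of the exponent: (p/2 - 1) / p = 1/2 - 1/p = a, and [M s] is C <s>^-n. *)
have Mpow s : (K * M s `^ (p / 2 - 1)) `^ p^-1 = K `^ p^-1 * C `^ a * jbracket s `^ (n%:R * - a).
  rewrite powRM ?powR_ge0 ?(ltW K0)// -powRrM -mulrA; congr (_ * _).
  rewrite (_ : (p / 2 - 1) / p = a); last by rewrite /a; field; rewrite gt_eqF.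
  rewrite /M powRM ?(ltW C0) ?invr_ge0 ?(ltW (jb0 _))//; congr (_ * _).
  by rewrite -powR_inv1 ?(ltW (jb0 _))// -powR_mulrn ?(ltW (jbracket_gt0 _))// -!powRrM; congr (_ `^ _); ring.
(* The base is an energy, which may vanish at some points; the condition on the sum of the exponents
   takes care of base 0. *)
have split_powR (y b1 b2 : R) : 0 <= y -> b1 + b2 != 0 -> y `^ (b1 + b2) = y `^ b1 * y `^ b2.
  by move=> y0 b0; rewrite powRD// (negbTE b0).
(* For p >= 2 the packet spreads out before [T^t] refocuses it at parameter 0: the numerator [A 0]
   is fixed, and the denominator is at most K times [M (- t)] to the power p/2 - 1, by splitting off
   one factor of the energy. *)
have [p22|p22] := leP 2 p.
  have a0 : 0 <= a by rewrite subr_ge0 lef_pV2 ?posrE.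
  exists (q * (A 0 `^ p^-1 / (K `^ p^-1 * C `^ a))).
  split; first by rewrite mulr_gt0// divr_gt0 ?mulr_gt0 ?powR_gt0 ?A0.
  move=> t; apply: le_trans (lower (- t) t); rewrite addNr lee_fin -mulrA ler_pM2l//.
  rewrite -mulrA ler_pM2l ?powR_gt0 ?A0//.
  have -> : (K `^ p^-1 * C `^ a)^-1 * jbracket t `^ (n%:R * `|2^-1 - p^-1|) =
      ((K * M (- t) `^ (p / 2 - 1)) `^ p^-1)^-1.
    by rewrite Mpow jbracketN mulrN powRN ger0_norm -?/a// [RHS]invfM invrK.
  rewrite lef_pV2 ?posrE ?powR_gt0 ?A0 ?mulr_gt0 ?powR_gt0//.
  apply: ge0_ler_powR; rewrite ?nnegrE ?invr_ge0 ?(ltW p0) ?(ltW (A0 _))//.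
    by rewrite mulr_ge0 ?powR_ge0 ?(ltW K0).
  rewrite -(KE (- t)) -RintegralZr//; apply: le_Rintegral => //.
    have := integrableZr measurableT (M (- t) `^ (p / 2 - 1)) (ie (- t)).
    by apply: eq_integrable => // x _; rewrite /= EFinM.
  move=> x _; rewrite -{1}(subrKC 1 (p / 2)) split_powR ?powRr1 ?ler_wpM2l//.
    by apply: ge0_ler_powR; rewrite ?nnegrE ?(ltW (M0 _))//; move: p22; lra.
  by rewrite subrKC gt_eqF// divr_gt0.
(* For p < 2 the packet starts focused and spreads: the conserved integral K of the energy is at
   most [A t] times [M t] to the power 1 - p/2, which bounds [A t] from below. *)
have a0 : a < 0 by rewrite subr_lt0 ltf_pV2 ?posrE.
exists (q * (K `^ p^-1 * C `^ a / A 0 `^ p^-1)).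
split; first by rewrite mulr_gt0// divr_gt0 ?mulr_gt0 ?powR_gt0 ?A0.
move=> t; apply: le_trans (lower 0 t); rewrite add0r lee_fin -mulrA ler_pM2l//.
rewrite mulrAC ler_pM2r ?invr_gt0 ?powR_gt0 ?A0//.
have -> : K `^ p^-1 * C `^ a * jbracket t `^ (n%:R * `|2^-1 - p^-1|) =
    (K * M t `^ (p / 2 - 1)) `^ p^-1.
  by rewrite Mpow ltr0_norm.
apply: ge0_ler_powR; rewrite ?nnegrE ?invr_ge0 ?(ltW p0) ?(ltW (A0 _))//.
  by rewrite mulr_ge0 ?powR_ge0 ?(ltW K0).
rewrite -[p / 2 - 1]opprB powRN ler_pdivrMr ?powR_gt0//.
rewrite -(KE t) -RintegralZr//; apply: le_Rintegral => //.
  have := integrableZr measurableT (M t `^ (1 - p / 2)) (iA t).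
  by apply: eq_integrable => // x _; rewrite /= EFinM.
move=> x _; rewrite -{1}[energy _ _ _ _]powRr1// -{1}(subrKC (p / 2) 1) split_powR ?subrKC ?oner_eq0//.
rewrite ler_wpM2l ?powR_ge0//.
by apply: ge0_ler_powR; rewrite ?nnegrE ?(ltW (M0 _))//; move: p22; lra.
Qed.

End lower_bound.
(** * Homogeneous functions in the plane *)

Section homogeneous.
Context {R : realType} {n : nat}.
Implicit Types (x y z v xi : 'rV[R]_n) (Phi : 'rV[R]_n -> R).
Local Notation e_ i := (delta_mx 0 i : 'rV[R]_n).
Local Notation punctured := [set xi : 'rV[R]_n | xi != 0].

Lemma open_punctured : open punctured.
Proof.
rewrite (_ : punctured = [set x | 0 < `|x|]); first exact: norm_gt_open.
by apply/seteqP; split => x /=; rewrite normr_gt0.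
Qed.

Lemma is_derive_smooth (U : set 'rV[R]_n) f x v : open U -> smooth_on U f -> U x ->
  is_derive x v f (\sum_k 'D_(e_ k) f x * v 0 k).
Proof.
move=> oU sf Ux.
exact: (@is_derive_chain _ _ _ f id U x v (fun k => v 0 k) oU Ux sf (fun k => is_derive_coord k x v)).
Qed.

(** The weight [w] stays general because two are used: the constant 1 for [Phi], and 1/l for its
    partial derivatives, which are homogeneous of degree -1. The proof differentiates along the ray
    at l = 1. *)
Lemma euler_identity f (w : R -> R) (w' : R) xi : smooth_on punctured f ->
  (forall l, 0 < l -> f (l *: xi) = w l * f xi) -> is_derive (1 : R) 1 w w' -> xi != 0 ->
  \sum_k 'D_(e_ k) f xi * xi 0 k = w' * f xi.
Proof.
move=> sf hf dw xi0.
have d1 := is_derive_smooth xi open_punctured sf xi0.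
have : is_derive (1 *: xi + 0) xi f (w' * f xi).
  apply/is_derive_line; apply: (@near_is_derive _ _ (fun l : R => w l * f xi)).
    near=> l; rewrite addr0 hf//.
    near: l; exact: lt_nbhsr.
  have d := is_deriveM dw (is_derive_cst (f xi) (1 : R) (1 : R)).
  by apply: (is_derive_eq d); rewrite scaler0 add0r /GRing.scale /= mulrC.
by rewrite scale1r addr0 => d2; rewrite -(@derive_val _ _ _ _ _ _ _ d1) (@derive_val _ _ _ _ _ _ _ d2).
Unshelve. all: by end_near. Qed.

Lemma homogeneous_pderiv Phi i (l : R) xi : smooth_on punctured Phi ->
  homogeneous0 Phi -> 0 < l -> xi != 0 ->
  'D_(e_ i) Phi (l *: xi) = l^-1 * 'D_(e_ i) Phi xi.
Proof.
move=> sP hP l0 xi0.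
have lxi : l *: xi != 0 by rewrite scaler_eq0 negb_or gt_eqF.
have d1 : is_derive xi (e_ i) (Phi \o (fun y => l *: y))
    (\sum_k 'D_(e_ k) Phi (l *: xi) * (l * (e_ i) 0 k)).
  apply: (is_derive_chain open_punctured lxi sP) => k.
  rewrite (_ : (fun y => _) = (fun y => l * y 0 k)).
    have := is_deriveZ l (is_derive_coord k xi (e_ i)).
    exact.
  by apply/funext => y; rewrite mxE.
have d2 : is_derive xi (e_ i) Phi (\sum_k 'D_(e_ k) Phi (l *: xi) * (l * (e_ i) 0 k)).
  apply: near_is_derive d1.
  have : nbhs xi punctured by apply: open_nbhs_nbhs; split => //; exact: open_punctured.
  by apply: filterS => y y0; exact: hP.
rewrite [in RHS](@derive_val _ _ _ _ _ _ _ d2) (bigD1 i)//= mxE !eqxx big1 ?addr0.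
  by rewrite /= mulr1 [_ * l]mulrC mulKf ?gt_eqF.
by move=> k ki; rewrite mxE (negbTE ki) andbF !mulr0.
Qed.

(** The row identity is Euler's relation for the partial derivatives; the column identity comes from
    differentiating Euler's relation for [Phi]. Proving both separately avoids an appeal to the
    symmetry of the Hessian. *)
Lemma hessian_euler Phi xi : smooth_on punctured Phi -> homogeneous0 Phi -> xi != 0 ->
  [/\ \sum_k xi 0 k * 'D_(e_ k) Phi xi = 0,
      forall i, (xi *m hessian Phi xi) 0 i = - 'D_(e_ i) Phi xi &
      forall j, \sum_k hessian Phi xi j k * xi 0 k = - 'D_(e_ j) Phi xi].
Proof.
move=> sP hP xi0.
have E0 x : x != 0 -> \sum_k 'D_(e_ k) Phi x * x 0 k = 0.
  move=> x0; rewrite (@euler_identity Phi (cst 1) 0 x sP)// ?mul0r// => l l0.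
  by rewrite mul1r hP.
split.
- by under eq_bigr do rewrite mulrC; exact: E0.
- move=> i; have dV : is_derive (1 : R) 1 (fun l : R => l^-1) (-1).
    have := @is_derive_invpow R 0 1 (oner_neq0 _).
    rewrite (_ : (fun _ => _) = (fun l : R => l^-1)).
      by rewrite expr1 expr1n divr1 mulr1.
    by apply/funext => l; rewrite expr0 mul1r expr1 div1r.
  have hD l : 0 < l -> 'D_(e_ i) Phi (l *: xi) = l^-1 * 'D_(e_ i) Phi xi.
    by move=> l0; exact: homogeneous_pderiv.
  have := euler_identity (@smooth_on_pderiv _ _ _ _ i sP) hD dV xi0.
  rewrite mulN1r mxE => <-.
  by apply: eq_bigr => k _; rewrite hessianE mulrC.
- move=> j; apply/eqP; rewrite -addr_eq0; apply/eqP.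
  have d1 : is_derive xi (e_ j) (fun x => \sum_k 'D_(e_ k) Phi x * x 0 k)
      (\sum_k ('D_(e_ k) Phi xi * (e_ j) 0 k + xi 0 k * 'D_(e_ j) ('D_(e_ k) Phi) xi)).
    rewrite (_ : (fun x => _) = \sum_k (fun x => 'D_(e_ k) Phi x * x 0 k)); last first.
      by apply/funext => x; rewrite fct_sumE.
    apply: is_derive_sum => k.
    apply: is_deriveM; last exact: is_derive_coord.
    by apply: DeriveDef => //; exact: smooth_on_derivable (@smooth_on_pderiv _ _ _ _ k sP) xi0.
  have d2 : is_derive xi (e_ j) (fun x => \sum_k 'D_(e_ k) Phi x * x 0 k) 0.
    apply: (@near_is_derive _ _ (cst (0 : R))).
    have : nbhs xi punctured by apply: open_nbhs_nbhs; split => //; exact: open_punctured.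
    by apply: filterS => y y0; rewrite E0.
  rewrite [RHS](_ : 0 = \sum_k ('D_(e_ k) Phi xi * (e_ j) 0 k + xi 0 k * 'D_(e_ j) ('D_(e_ k) Phi) xi)); last first.
    exact: eq_trans (esym (@derive_val _ _ _ _ _ _ _ d2)) (@derive_val _ _ _ _ _ _ _ d1).
  rewrite big_split addrC /=; congr (_ + _); last by apply: eq_bigr => k _; rewrite hessianE mulrC.
  rewrite (bigD1 j)//= mxE !eqxx mulr1 big1 ?addr0// => k kj.
  by rewrite mxE (negbTE kj) andbF mulr0.
Qed.

Lemma unitmx_inj (M : 'M[R]_n) : (forall v : 'rV_n, v *m M = 0 -> v = 0) -> M \in unitmx.
Proof.
move=> H; rewrite -row_free_unit -kermx_eq0; apply/rowV0P => v /sub_kermxP.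
exact: H.
Qed.

Lemma dotpp_gt0 x : x != 0 -> 0 < dotp x x.
Proof.
move=> x0; rewrite lt_neqAle eq_sym; apply/andP; split; last by apply: sumr_ge0 => i _; rewrite -expr2 sqr_ge0.
apply: contra x0 => /eqP /psumr_eq0P H; apply/eqP/rowP => i; rewrite mxE.
have : x 0 i * x 0 i == 0.
  by apply/eqP; apply: H => // k _; rewrite -expr2 sqr_ge0.
by rewrite mulf_eq0 orbb => /eqP.
Qed.

(** If the segment met the origin at parameter h, pairing with x would give (1 - h) |x|^2 + h x.y =
    0, impossible for h < 1 when x.y >= 0. The mean value theorem then applies along the segment. *)
Lemma constant_segment Phi x y : smooth_on punctured Phi ->
  (forall z, z != 0 -> forall i, 'D_(e_ i) Phi z = 0) ->
  x != 0 -> y != 0 -> 0 <= dotp x y -> Phi x = Phi y.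
Proof.
move=> sP g0 x0 y0 xy.
have xx := dotpp_gt0 x0.
have seg (h : R) : 0 <= h <= 1 -> h *: (y - x) + x != 0.
  move=> /andP[h0 h1]; have [->|h1'] := eqVneq h 1.
    by rewrite scale1r subrK.
  apply/negP => /eqP E.
  have : dotp x (h *: (y - x) + x) = 0 by rewrite E /dotp big1// => i _; rewrite mxE mulr0.
  rewrite dotpDr dotpZr dotpDr dotpNr => H.
  have hl : h < 1 by rewrite lt_neqAle h1'.
  have : 0 <= h * dotp x y by exact: mulr_ge0.
  have : 0 < (1 - h) * dotp x x by rewrite mulr_gt0// subr_gt0.
  move: H; move: (dotp x x) (dotp x y) => a b; nra.
have [h _] : exists2 h : R, 0 < h < 1 & Phi (y - x + x) - Phi x = 0.
  apply: (@MVT_line _ _ Phi (fun=> 0)) => h /seg h0.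
  have d := is_derive_smooth (y - x) open_punctured sP h0.
  by apply: (is_derive_eq d); rewrite big1// => k _; rewrite g0// mul0r.
by rewrite subrK => /eqP; rewrite subr_eq0 => /eqP.
Qed.

End homogeneous.

(** * Nondegeneracy in the plane *)

Section plane.
Context {R : realType}.
Implicit Types (x y z v xi : 'rV[R]_2) (Phi : 'rV[R]_2 -> R).
Local Notation e_ i := (delta_mx 0 i : 'rV[R]_2).
Local Notation punctured := [set xi : 'rV[R]_2 | xi != 0].

Lemma sum2 (f : 'I_2 -> R) : \sum_i f i = f 0 + f 1.
Proof. by rewrite big_ord_recl big_ord1; congr (_ + f _); exact: val_inj. Qed.

Lemma rV2P x y : x 0 0 = y 0 0 -> x 0 1 = y 0 1 -> x = y.
Proof.
move=> h0 h1; apply/rowP => i; case: (unliftP 0 i) => [j ->|->//].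
by rewrite (_ : lift 0 j = 1)//; apply: val_inj; rewrite /= (ord1 j).
Qed.

Definition perp x : 'rV[R]_2 := \row_i (if i == 0 then - x 0 1 else x 0 0).

Lemma nonconstant_grad Phi : smooth_on punctured Phi -> nonconstant Phi ->
  exists xi i, xi != 0 /\ 'D_(e_ i) Phi xi != 0.
Proof.
move=> sP [xi [eta [xi0 eta0 ne]]]; apply: contrapT => H.
have g0 z : z != 0 -> forall i, 'D_(e_ i) Phi z = 0.
  move=> z0 i; apply/eqP; apply: contrapT => /negP gz; apply: H; by exists z, i.
have pE0 x : perp x 0 0 = - x 0 1 by rewrite mxE.
have pE1 x : perp x 0 1 = x 0 0 by rewrite mxE.
have p0 x : x != 0 -> perp x != 0.
  apply: contra => /eqP E; apply/eqP; apply: rV2P; rewrite mxE.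
    by rewrite -pE1 E mxE.
  by apply/eqP; rewrite -oppr_eq0 -pE0 E mxE.
(* The segments from x to perp x and from perp x to - x avoid the origin. *)
have step x : x != 0 -> Phi x = Phi (perp x).
  move=> x0; apply: constant_segment => //; first exact: p0.
  by rewrite /dotp sum2 pE0 pE1 mulrN mulrC addNr.
have ppE x : perp (perp x) = - x.
  by apply: rV2P; rewrite !mxE.
(* If the scalar product is negative, [xi] is first replaced by its opposite, reached by two quarter
   turns. *)
case/negP: ne; apply/eqP; have [h|h] := leP 0 (dotp xi eta).
  exact: constant_segment.
rewrite step// step ?p0// ppE; apply: constant_segment => //; first by rewrite oppr_eq0.
by rewrite dotpNl oppr_ge0 ltW.
Qed.

(** Let v H = 0. Pairing with xi and using H xi = - g gives v.g = 0; also xi.g = 0. In the plane, g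
    != 0 then forces v to be a multiple l xi, and xi H = - g turns v H = 0 into l g = 0, so l =
    0. *)
Lemma hessian_plane_unit Phi xi i : smooth_on punctured Phi -> homogeneous0 Phi ->
  xi != 0 -> 'D_(e_ i) Phi xi != 0 -> hessian Phi xi \in unitmx.
Proof.
move=> sP hP xi0 gi; have [E0 E1 E2] := hessian_euler sP hP xi0.
apply: unitmx_inj => v vM.
pose g k := 'D_(e_ k) Phi xi.
have vg : v 0 0 * g 0 + v 0 1 * g 1 = 0.
  have : \sum_k (v *m hessian Phi xi) 0 k * xi 0 k = 0.
    by rewrite vM big1// => k _; rewrite mxE mul0r.
  under eq_bigr do rewrite mxE mulr_suml.
  rewrite exchange_big /=.
  under eq_bigr do (under eq_bigr do rewrite -mulrA; rewrite -mulr_sumr E2 mulrN).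
  by rewrite sum2 => H; apply/eqP; rewrite -oppr_eq0 opprD; apply/eqP.
have xg : xi 0 0 * g 0 + xi 0 1 * g 1 = 0 by rewrite -E0 sum2.
have gn : (g 0 != 0) || (g 1 != 0).
  move: gi; case: (unliftP 0 i) => [j ->|->]; last by rewrite /g => ->.
  by rewrite (_ : lift 0 j = 1) ?/g => [->|]; [rewrite orbT|apply: val_inj; rewrite /= (ord1 j)].
(* Vanishing of the determinant of v and xi, both orthogonal to g; one cancels a nonzero coordinate
   of g. *)
have cr : v 0 0 * xi 0 1 = v 0 1 * xi 0 0.
  case/orP: gn => gk; apply: (mulIf gk).
    have -> : v 0 0 * xi 0 1 * g 0 = xi 0 1 * (v 0 0 * g 0 + v 0 1 * g 1) - v 0 1 * xi 0 1 * g 1 by ring.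
    have -> : v 0 1 * xi 0 0 * g 0 = v 0 1 * (xi 0 0 * g 0 + xi 0 1 * g 1) - v 0 1 * xi 0 1 * g 1 by ring.
    by rewrite vg xg !mulr0.
  have -> : v 0 0 * xi 0 1 * g 1 = v 0 0 * (xi 0 0 * g 0 + xi 0 1 * g 1) - v 0 0 * xi 0 0 * g 0 by ring.
  have -> : v 0 1 * xi 0 0 * g 1 = xi 0 0 * (v 0 0 * g 0 + v 0 1 * g 1) - v 0 0 * xi 0 0 * g 0 by ring.
  by rewrite vg xg !mulr0.
have [l vl] : exists l, v = l *: xi.
  have : (xi 0 0 != 0) || (xi 0 1 != 0).
    apply: contraT; rewrite negb_or !negbK => /andP[/eqP h0 /eqP h1].
    by case/eqP: xi0; apply: rV2P; rewrite mxE.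
  case/orP => xk.
    exists (v 0 0 / xi 0 0); apply: rV2P; rewrite mxE ?divfK//.
    by apply: (mulIf xk); rewrite -cr mulrAC divfK.
  exists (v 0 1 / xi 0 1); apply: rV2P; rewrite mxE ?divfK//.
  by apply: (mulIf xk); rewrite cr mulrAC divfK.
have lg : l * g i = 0.
  have := E1 i; move: vM; rewrite vl -scalemxAl => /rowP/(_ i); rewrite !mxE => H1 H2.
  by apply/eqP; rewrite -oppr_eq0 -mulrN /g -H2 H1.
by move: lg => /eqP; rewrite mulf_eq0 (negbTE gi) orbF vl => /eqP ->; rewrite scale0r.
Qed.

End plane.
(** * The Hessian of a homogeneous extension *)

Section composition.
Context {R : realType} {n m : nat}.
Implicit Types (U : set 'rV[R]_n) (V : set 'rV[R]_m) (F : 'rV[R]_m -> R).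
Local Notation e_ i := (delta_mx 0 i).

Lemma smoothclass_sum U k (I : Type) (r : seq I) (f : I -> 'rV[R]_n -> R) : open U ->
  (forall i, smoothclass U k (f i)) -> smoothclass U k (fun x => \sum_(i <- r) f i x).
Proof.
move=> oU sf; elim: r => [|i r ih].
  have /smooth_onP -/(_ oU k) := @smooth_on_cst _ _ U 0 oU.
  by apply: smoothclass_ext => // x _; rewrite big_nil.
apply: (smoothclass_ext oU _ (smoothclassD oU (sf i) ih)) => x _; by rewrite big_cons.
Qed.

Variables (U : set 'rV[R]_n) (V : set 'rV[R]_m) (u : 'rV[R]_n -> 'rV[R]_m).
Hypotheses (oU : open U) (oV : open V) (uV : forall x, U x -> V (u x)).
Hypothesis su : forall k, smooth_on U (fun x => u x 0 k).

Lemma pderiv_compose F i x : smooth_on V F -> U x ->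
  is_derive x (e_ i : 'rV_n) (fun x => F (u x))
    (\sum_k 'D_(e_ k) F (u x) * 'D_(e_ i) (fun x => u x 0 k) x).
Proof.
move=> sF Ux; apply: (is_derive_chain oV (uV Ux) sF) => k.
by apply: DeriveDef => //; exact: smooth_on_derivable (su k) Ux.
Qed.

(** The induction on the order generalises [F]: a derivative of the composite is a sum of products
    in which partial derivatives of [F] are composed with [u]. *)
Lemma smooth_on_compose F : smooth_on V F -> smooth_on U (fun x => F (u x)).
Proof.
move=> sF; apply/smooth_onP => // k; elim: k F sF => [|k ih] F sF.
  split => // x Ux; apply: (@continuous_comp _ _ _ u F); last exact: smooth_on_continuous sF (uV Ux).
  apply/(@cvgrPdist_lt _ _ _ (nbhs x) _) => e e0.
  have H j : nbhs x (fun y => `|u x 0 j - u y 0 j| < e).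
    have cu := smooth_on_continuous (su j) Ux.
    by have /(@cvgrPdist_lt _ _ _ (nbhs x) _)/(_ _ e0) := cu.
  have H' : nbhs x (fun y => forall j, `|u x 0 j - u y 0 j| < e).
    exact: (@filter_forall _ _ _ (nbhs x) _ H).
  apply: filterS H' => y Hy; apply/rV_norm_lt; split => // j.
  by rewrite !mxE; exact: Hy.
split.
  exact: diffclassB (ih F sF).
move=> i; split.
  by move=> [] x Ux; have [] := pderiv_compose i sF Ux.
apply: (@smoothclass_ext _ _ U k (fun x => \sum_l 'D_(e_ l) F (u x) * 'D_(e_ i) (fun x => u x 0 l) x)) => //.
  by move=> x Ux; have [_ ->] := pderiv_compose i sF Ux.
apply: smoothclass_sum => // l; apply: smoothclassM => //.
  exact: ih (@smooth_on_pderiv _ _ _ _ l sF).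
by have /smooth_onP -/(_ oU k) := @smooth_on_pderiv _ _ _ _ i (su l).
Qed.

Lemma hessian_compose F x j i : smooth_on V F -> U x ->
  hessian (fun x => F (u x)) x j i =
  \sum_k ((\sum_l hessian F (u x) l k * 'D_(e_ j) (fun x => u x 0 l) x) *
       'D_(e_ i) (fun x => u x 0 k) x +
     'D_(e_ k) F (u x) * 'D_(e_ j) ('D_(e_ i) (fun x => u x 0 k)) x).
Proof.
move=> sF Ux.
have d1 : is_derive x (e_ j : 'rV_n)
    (fun x => \sum_k 'D_(e_ k) F (u x) * 'D_(e_ i) (fun x => u x 0 k) x)
    (\sum_k ('D_(e_ k) F (u x) * 'D_(e_ j) ('D_(e_ i) (fun x => u x 0 k)) x +
     'D_(e_ i) (fun x => u x 0 k) x * \sum_l 'D_(e_ l) ('D_(e_ k) F) (u x) * 'D_(e_ j) (fun x => u x 0 l) x)).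
  rewrite (_ : (fun x => _) = \sum_k (fun x => 'D_(e_ k) F (u x) * 'D_(e_ i) (fun x => u x 0 k) x)); last first.
    by apply/funext => y; rewrite fct_sumE.
  apply: is_derive_sum => k; apply: is_deriveM.
    exact: (pderiv_compose j (@smooth_on_pderiv _ _ _ _ k sF) Ux).
  by apply: DeriveDef => //; exact: smooth_on_derivable (@smooth_on_pderiv _ _ _ _ i (su k)) Ux.
have d2 : is_derive x (e_ j : 'rV_n) ('D_(e_ i) (fun x => F (u x)))
    (\sum_k ('D_(e_ k) F (u x) * 'D_(e_ j) ('D_(e_ i) (fun x => u x 0 k)) x +
     'D_(e_ i) (fun x => u x 0 k) x * \sum_l 'D_(e_ l) ('D_(e_ k) F) (u x) * 'D_(e_ j) (fun x => u x 0 l) x)).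
  apply: near_is_derive d1; have : nbhs x U by exact: open_nbhs_nbhs.
  by apply: filterS => y Uy; have [_ ->] := pderiv_compose i sF Uy.
rewrite hessianE (@derive_val _ _ _ _ _ _ _ d2).
apply: eq_bigr => k _; rewrite addrC mulrC; congr (_ * _ + _).
by apply: eq_bigr => l _; rewrite hessianE.
Qed.

End composition.

Section powers.
Context {R : realType} {n : nat}.

Lemma smooth_on_powR (U : set 'rV[R]_n) f (a : R) : open U ->
  (forall x, U x -> 0 < f x) -> smooth_on U f -> smooth_on U (fun x => f x `^ a).
Proof.
move=> oU f0 sf.
(* The j-th derivative of the power a, with its falling factorial. *)
pose psi j (y : R) := \prod_(i < j) (a - i%:R) * y `^ (a - j%:R).
suff : smooth_on U (fun x => psi 0%N (f x)).
  by apply: smooth_on_ext => // x _; rewrite /psi big_ord0 mul1r subr0.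
apply: (smooth_on_comp oU) => // x Ux j.
have d := @is_deriveZ _ _ _ _ (\prod_(i < j) (a - i%:R)) _ _ _ (is_derive1_powR (a - j%:R) (f0 x Ux)).
apply: (is_derive_eq d); rewrite /psi big_ord_recr /GRing.scale /= mulrA.
by congr (_ * _ `^ _); rewrite -natr1; ring.
Qed.

End powers.
Section pderivs_local.
Context {R : realType} {n : nat}.
Implicit Types (U : set 'rV[R]_n) (f g : 'rV[R]_n -> R).

Lemma pderivs_ext U f g s x : open U -> (forall y, U y -> f y = g y) -> U x ->
  pderivs s f x = pderivs s g x.
Proof.
move=> oU fg; elim: s x => [|i s ih] x Ux /=; first exact: fg.
apply: near_eq_derive; have : nbhs x U by exact: open_nbhs_nbhs.
by apply: filterS => y; exact: ih.
Qed.

Lemma pderivs_linear U f g (c : R) s x : open U -> smooth_on U f -> smooth_on U g -> U x ->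
  pderivs s (fun y => f y + c * g y) x = pderivs s f x + c * pderivs s g x.
Proof.
move=> oU sf sg; elim: s x => [//|i s ih] x Ux /=.
have df := smooth_on_derivable (i := i) (smooth_on_pderivs s sf) Ux.
have dg := smooth_on_derivable (i := i) (smooth_on_pderivs s sg) Ux.
have d : is_derive x (delta_mx 0 i : 'rV_n) (fun y => pderivs s f y + c * pderivs s g y)
    ('D_(delta_mx 0 i) (pderivs s f) x + c * 'D_(delta_mx 0 i) (pderivs s g) x).
  by apply: is_deriveD; [apply: DeriveDef|apply: is_deriveZ; apply: DeriveDef].
rewrite -(@derive_val _ _ _ _ _ _ _ d); apply: near_eq_derive.
have : nbhs x U by exact: open_nbhs_nbhs.
by apply: filterS => y; exact: ih.
Qed.

Lemma hessian_ext U f g x : open U -> (forall y, U y -> f y = g y) -> U x ->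
  hessian f x = hessian g x.
Proof.
move=> oU fg Ux; apply/matrixP => j i.
have E := @pderivs_ext U f g [:: j; i] x oU fg Ux.
exact (eq_trans (hessianE f x j i) (eq_trans E (esym (hessianE g x j i)))).
Qed.

Lemma smooth_on_dotpp U : open U -> smooth_on U (fun x => dotp x x).
Proof.
move=> oU; apply: smooth_on_sum => // i.
exact (smooth_onM oU (@smooth_on_coord _ _ U i oU) (@smooth_on_coord _ _ U i oU)).
Qed.

Lemma is_derive_dotpp x (v : 'rV[R]_n) : is_derive x v (fun y => dotp y y) (2 * dotp x v).
Proof.
have -> : (fun y : 'rV[R]_n => dotp y y) = \sum_i (fun y : 'rV[R]_n => y 0 i * y 0 i).
  by apply/funext => y; rewrite fct_sumE.
have -> : 2 * dotp x v = \sum_i (x 0 i * v 0 i + x 0 i * v 0 i).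
  by rewrite mulr_sumr; apply: eq_bigr => i _; ring.
apply: is_derive_sum => i.
exact: is_deriveM (is_derive_coord i x v) (is_derive_coord i x v).
Qed.

Lemma open_open_disk : open (open_disk R n).
Proof.
have -> : open_disk R n = (fun y : 'rV[R]_n => dotp y y) @^-1` [set z : R | z < 1].
  apply/seteqP; split => y /=; rewrite /open_disk /enorm /=.
    by rewrite -[X in _ < X]sqrtr1 ltr_sqrt.
  by move=> y1; rewrite -[X in _ < X]sqrtr1 ltr_sqrt.
apply: open_comp; last exact: open_lt.
by move=> y _; exact: (smooth_continuous (smooth_on_dotpp openT)).
Qed.

Lemma open_disk0 : open_disk R n 0.
Proof.
by rewrite /open_disk /= /enorm /dotp big1 ?sqrtr0// => i _; rewrite mxE mul0r.
Qed.

End pderivs_local.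

(** * The Hessian at e_0 in the hemisphere chart *)

Section polar_chart.
Context {R : realType} {m : nat}.
Implicit Types (x y xi : 'rV[R]_m.+1).
Local Notation e_ i := (delta_mx 0 i).

Definition halfspace : set 'rV[R]_m.+1 := [set xi | 0 < xi 0 ord0].

(** The chart coordinates of xi/|xi| on the hemisphere around e_0. The inverse norm is written as a
    real power of the squared norm, which is directly differentiable. *)
Definition polar xi : 'rV[R]_m :=
  \row_k (xi 0 (lift ord0 k) * dotp xi xi `^ (- 2^-1)).

Lemma open_halfspace : open halfspace.
Proof.
apply: (@open_comp _ _ (fun xi : 'rV[R]_m.+1 => xi 0 ord0) [set z : R | 0 < z]); last exact: open_gt.
by move=> y _; exact: coord_continuous.
Qed.

Lemma halfspace_e0 : halfspace (e_ ord0).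
Proof. by rewrite /halfspace /= mxE !eqxx. Qed.

Lemma halfspace_dotp_gt0 xi : halfspace xi -> 0 < dotp xi xi.
Proof.
move=> xi0; apply: dotpp_gt0; apply/eqP => E; move: xi0.
by rewrite /halfspace E /= mxE ltxx.
Qed.

Lemma smooth_on_polar k : smooth_on halfspace (fun xi => polar xi 0 k).
Proof.
have oH := open_halfspace.
have sp := smooth_on_powR (- 2^-1) oH halfspace_dotp_gt0 (smooth_on_dotpp oH).
have := smooth_onM oH (@smooth_on_coord _ _ halfspace (lift ord0 k) oH) sp.
by apply: smooth_on_ext => // x _; rewrite mxE.
Qed.

Lemma powR_halfN xi : dotp xi xi `^ (- 2^-1) = (enorm xi)^-1.
Proof.
rewrite powRN powR12_sqrt//.
by apply: sumr_ge0 => i _; rewrite -expr2 sqr_ge0.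
Qed.

Lemma polar_dotp xi : halfspace xi ->
  1 - dotp (polar xi) (polar xi) = (xi 0 ord0 / enorm xi) ^+ 2.
Proof.
move=> xi0; have d0 := halfspace_dotp_gt0 xi0.
have e2 : enorm xi ^+ 2 = dotp xi xi by rewrite sqr_sqrtr// ltW.
have e0 : enorm xi != 0 by rewrite -sqrf_eq0 e2 gt_eqF.
have -> : dotp (polar xi) (polar xi) = (\sum_k xi 0 (lift ord0 k) * xi 0 (lift ord0 k)) / enorm xi ^+ 2.
  rewrite mulr_suml; apply: eq_bigr => k _; rewrite !mxE powR_halfN.
  by field.
rewrite -[X in X - _](@divff _ (enorm xi ^+ 2)) ?expf_neq0// -mulrBl expr_div_n; congr (_ / _).
by rewrite e2 /dotp big_ord_recl addrK expr2.
Qed.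

Lemma polar_disk xi : halfspace xi -> open_disk R m (polar xi).
Proof.
move=> xi0; rewrite /open_disk /= /enorm -[X in _ < X]sqrtr1 ltr_sqrt//.
rewrite -subr_gt0 polar_dotp// exprn_gt0// divr_gt0//.
by rewrite sqrtr_gt0 halfspace_dotp_gt0.
Qed.

Lemma hemisphere_polar xi : halfspace xi ->
  hemisphere ord0 false (polar xi) = (enorm xi)^-1 *: xi.
Proof.
move=> xi0; apply/rowP => i; rewrite !mxE; case: unliftP => [k ->|->].
  by rewrite mxE powR_halfN mulrC.
rewrite expr0 mul1r polar_dotp// sqrtr_sqr ger0_norm 1?mulrC//.
by rewrite mulr_ge0 ?invr_ge0 ?sqrtr_ge0// ltW.
Qed.

Lemma homogeneous_ext_polar (phi : sphere R m.+1 -> R) xi : halfspace xi ->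
  homogeneous_ext phi xi = local_rep ord0 false phi (polar xi).
Proof. by move=> xi0; rewrite /local_rep hemisphere_polar. Qed.

Lemma polar_e0 : polar (e_ ord0) = 0.
Proof. by apply/rowP => k; rewrite !mxE /= mul0r. Qed.

Let dpow (a : R) xi (i : 'I_m.+1) : halfspace xi ->
  is_derive xi (e_ i : 'rV_m.+1) (fun x => dotp x x `^ a)
    (a * dotp xi xi `^ (a - 1) * (2 * xi 0 i)).
Proof.
move=> /halfspace_dotp_gt0 x0.
have := @is_derive_chain1 _ _ (fun z => z `^ a) (fun x => dotp x x) xi (e_ i) _ _
  (is_derive1_powR a x0) (is_derive_dotpp xi (e_ i)).
by rewrite dotp_delta.
Qed.

Lemma pderiv_polar i k xi : halfspace xi ->
  'D_(e_ i) (fun x => polar x 0 k) xi =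
  (i == lift ord0 k)%:R * dotp xi xi `^ (- 2^-1) -
    xi 0 (lift ord0 k) * xi 0 i * dotp xi xi `^ (- 2^-1 - 1).
Proof.
move=> xi0.
have -> : (fun x => polar x 0 k) = (fun x => x 0 (lift ord0 k) * dotp x x `^ (- 2^-1)).
  by apply/funext => x; rewrite mxE.
have d := is_deriveM (is_derive_coord (lift ord0 k) xi (e_ i)) (dpow (- 2^-1) i xi0).
rewrite (@derive_val _ _ _ _ _ _ _ d) /GRing.scale /= mxE eqxx /= eq_sym.
move: (dotp xi xi `^ _) (dotp xi xi `^ _) ((i == lift ord0 k)%:R : R) => a b e.
by field.
Qed.

(** Only the mixed derivatives in the radial variable and the k-th tangential one survive, with
    value -1; they put the gradient, with a minus sign, in the border of the Hessian. *)
Lemma pderiv2_polar i j k :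
  'D_(e_ j) ('D_(e_ i) (fun x => polar x 0 k)) (e_ ord0 : 'rV_m.+1) =
  - ((i == lift ord0 k)%:R * (j == ord0)%:R + (j == lift ord0 k)%:R * (i == ord0)%:R).
Proof.
have h0 := halfspace_e0.
set f := (fun x : 'rV[R]_m.+1 => (i == lift ord0 k)%:R * dotp x x `^ (- 2^-1) -
    x 0 (lift ord0 k) * x 0 i * dotp x x `^ (- 2^-1 - 1)).
transitivity ('D_(e_ j) f (e_ ord0 : 'rV_m.+1)).
  by apply: near_eq_derive; apply: (near_open open_halfspace h0) => y; exact: pderiv_polar.
have d1 := @is_deriveZ _ _ _ _ ((i == lift ord0 k)%:R : R) _ _ _ (dpow (- 2^-1) j h0).
have d2 := is_deriveM (is_derive_coord (lift ord0 k) (e_ ord0 : 'rV[R]_m.+1) (e_ j))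
  (is_derive_coord i (e_ ord0 : 'rV[R]_m.+1) (e_ j)).
have d3 := is_deriveM d2 (dpow (- 2^-1 - 1) j h0).
have d := is_deriveB d1 d3.
rewrite (@derive_val _ _ _ _ _ _ _ d) mulrfctE /GRing.scale /= dotp_delta !mxE !eqxx /= !powR1.
rewrite (eq_sym j (lift _ _)) (eq_sym j ord0) (eq_sym i ord0) !mul0r.
by field.
Qed.

Definition bordered (g : 'I_m -> R) (H : 'I_m -> 'I_m -> R) : 'M[R]_m.+1 :=
  \matrix_(j, i) match unlift ord0 j, unlift ord0 i with
    | Some l, Some k => H l k
    | Some l, None => - g l
    | None, Some k => - g k
    | None, None => 0
    end.

Definition bordered_rep (phi : sphere R m.+1 -> R) : 'M[R]_m.+1 :=
  bordered (fun k => pderivs [:: k] (local_rep ord0 false phi) 0)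
    (fun l k => pderivs [:: l; k] (local_rep ord0 false phi) 0).

Lemma smooth_on_homogeneous_ext (phi : smooth_sphere R m.+1) :
  smooth_on halfspace (homogeneous_ext phi).
Proof.
have := smooth_on_compose open_halfspace (@open_open_disk R m) polar_disk smooth_on_polar
  (smooth_sphereP phi ord0 false).
by apply: smooth_on_ext; [exact: open_halfspace|move=> x /homogeneous_ext_polar ->].
Qed.

(** At e_0 the differential of [polar] is the projection that forgets coordinate 0. In the
    second-order chain rule the quadratic term therefore gives the tangential block, and the second
    derivatives of [polar] give the border. *)
Lemma hessian_homogeneous_ext (phi : smooth_sphere R m.+1) :
  hessian (homogeneous_ext phi) (e_ ord0) = bordered_rep phi.
Proof.
rewrite (hessian_ext open_halfspace (homogeneous_ext_polar phi) halfspace_e0).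
have pol i k : 'D_(e_ i) (fun x => polar x 0 k) (e_ ord0 : 'rV_m.+1) = (i == lift ord0 k)%:R.
  rewrite (pderiv_polar _ _ halfspace_e0) dotp_delta !mxE !eqxx /= !powR1.
  by rewrite !mul0r mulr1 subr0.
apply/matrixP => j i.
rewrite (hessian_compose open_halfspace (@open_open_disk R m) polar_disk smooth_on_polar
  j i (smooth_sphereP phi ord0 false) halfspace_e0).
rewrite mxE polar_e0.
under eq_bigr do rewrite pol pderiv2_polar.
under eq_bigr do under eq_bigr do rewrite pol.
have lk (f : 'I_m -> R) k : \sum_l f l * (lift ord0 k == lift ord0 l)%:R = f k.
  rewrite (bigD1 k)//= eqxx mulr1 big1 ?addr0// => l lk.
  by rewrite (inj_eq lift_inj) eq_sym (negbTE lk) mulr0.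
rewrite big_split /=.
case: (unliftP ord0 j) => [l ->|->]; case: (unliftP ord0 i) => [k ->|->].
- rewrite lk lk hessianE [X in _ + X]big1 ?addr0// => k' _.
  by rewrite /= !mulr0 addr0 oppr0 mulr0.
- rewrite [X in X + _]big1 ?add0r => [|k' _]; last by rewrite /= mulr0.
  under eq_bigr do rewrite /= mul0r add0r mulr1 mulrN.
  by rewrite sumrN lk.
- rewrite [X in X + _]big1 ?add0r => [|k' _]; last first.
    by rewrite big1 ?mul0r// => l _; rewrite /= mulr0.
  under eq_bigr do rewrite /= mul0r addr0 mulr1 mulrN.
  by rewrite sumrN lk.
- rewrite !big1 ?addr0// => k _; last by rewrite /= mulr0.
  by rewrite /= !mul0r addr0 oppr0 mulr0.
Qed.

End polar_chart.
(** * Genericity in the Whitney topology *)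

Section whitney.
Context {R : realType}.

Lemma near_seq (T : eqType) (l : seq T) (P : T -> R -> Prop) :
  (forall x, x \in l -> nbhs (0 : R) (P x)) ->
  nbhs (0 : R) (fun c => forall x, x \in l -> P x c).
Proof.
elim: l => [|a l ih] H; first by apply: filterS (@filterT _ (nbhs (0 : R)) _) => c _ x.
have Ha := H a (mem_head _ _).
have Hl := ih (fun x xl => H x (mem_behead (s := a :: l) xl)).
apply: filterS (filterI Ha Hl) => c [Pa Pl] x; rewrite inE => /orP[/eqP -> //|]; exact: Pl.
Qed.

(** Words of length at most r over a finite alphabet are finite in number; the induction peels off
    the first letter. *)
Lemma near_words (k r : nat) (P : seq 'I_k -> R -> Prop) :
  (forall s, nbhs (0 : R) (P s)) ->
  nbhs (0 : R) (fun c => forall s, (size s <= r)%N -> P s c).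
Proof.
elim: r P => [|r ih] P H.
  by apply: filterS (H [::]) => c Pc [|].
have Hi : nbhs (0 : R) (fun c => forall i s, (size s <= r)%N -> P (i :: s) c).
  by apply: (@filter_forall _ _ _ (nbhs (0 : R)) _) => i; apply: (ih (fun s => P (i :: s))).
by apply: filterS (filterI (H [::]) Hi) => c [P0 Pi] [|i s] //; exact: Pi.
Qed.

(** On a compact set the strict inequality has a margin, e minus the maximum of |a|, which absorbs c
    times the bounded function b. *)
Lemma near_compact_lt n (U K : set 'rV[R]_n) (a b : 'rV[R]_n -> R) (e : R) :
  compact K -> K `<=` U -> smooth_on U a -> smooth_on U b ->
  (forall y, K y -> `|a y| < e) ->
  nbhs (0 : R) (fun c => forall y, K y -> `|a y + c * b y| < e).
Proof.
move=> cK KU sa sb ae.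
have [[y0 Ky0]|K0] := pselect (K !=set0); last first.
  by apply: filterS (@filterT _ (nbhs (0 : R)) _) => c _ y Ky; case: K0; exists y.
have cont f : smooth_on U f -> {within K, continuous (fun y => `|f y|)}.
  move=> sf; apply: continuous_in_subspaceT => y /set_mem /KU Uy.
  exact: continuous_comp (smooth_on_continuous sf Uy) (@norm_continuous _ _ _).
have K_ne : K !=set0 by exists y0.
have [y1 /set_mem Ky1 H1] := compact_EVT_max K_ne cK (cont a sa).
have [y2 /set_mem Ky2 H2] := compact_EVT_max K_ne cK (cont b sb).
have b0 : 0 < `|b y2| + 1 by rewrite ltr_wpDl.
have d0 : 0 < (e - `|a y1|) / (`|b y2| + 1) by rewrite divr_gt0 ?subr_gt0 ?ae.
apply/nbhs_ballP; exists ((e - `|a y1|) / (`|b y2| + 1)) => //= c.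
rewrite -ball_normE /ball_ /= sub0r normrN (ltr_pdivlMr _ _ b0) => Hc y Ky.
have h1 := H1 y (mem_set Ky); have h2 := H2 y (mem_set Ky).
rewrite (le_lt_trans (ler_normD _ _))// normrM.
have h3 : `|c| * `|b y| <= `|c| * (`|b y2| + 1).
  by rewrite ler_wpM2l// (le_trans h2)// lerDl.
by move: Hc h1 h3; move: (`|c| * _) (`|c| * _) => p q *; lra.
Qed.

Lemma unitmx_perturb n (A C : 'M[R]_n) (d : R) : C \in unitmx -> 0 < d ->
  exists2 c : R, `|c| < d & A + c *: C \in unitmx.
Proof.
move=> uC d0; pose p := char_poly (A *m invmx C).
have p0 : p != 0 by rewrite monic_neq0// char_poly_monic.
(* As many distinct values as the size of [p], one more than its degree, so some value is not a
   root. Starting the denominators at 2 makes them strictly smaller than [d] in absolute value. *)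
pose rs := [seq - (d / k.+2%:R) | k <- iota 0 (size p)].
have : ~~ all (root p) rs.
  apply/negP => /(max_poly_roots p0) H.
  have : (size rs < size p)%N.
    apply: H; rewrite map_inj_uniq ?iota_uniq// => i j /oppr_inj /(mulfI (lt0r_neq0 d0)) /invr_inj.
    by move=> /eqP; rewrite eqr_nat => /eqP[].
  by rewrite size_map size_iota ltnn.
move=> /allPn[_ /mapP[k _ ->] nr]; exists (d / k.+2%:R).
  rewrite ger0_norm ?divr_ge0 ?(ltW d0)// ltr_pdivrMr ?ltr0n// ltr_pMr// ltr1n//.
(* A + b C = (A C^-1 + b) C is singular for finitely many b only. *)
have -> : A + d / k.+2%:R *: C = (A *m invmx C - (- (d / k.+2%:R))%:M) *m C.
  by rewrite mulmxBl mulmxKV// mul_scalar_mx scaleNr opprK.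
rewrite unitmx_mul uC andbT; apply: unitmx_inj => v.
rewrite mulmxBr mul_mx_scalar => /eqP; rewrite subr_eq0 => /eqP E.
apply/eqP; apply: contraNT nr => v0.
rewrite -eigenvalue_root_char; apply/eigenvalueP; by exists v.
Qed.

Variable n : nat.
Implicit Types (phi psi : smooth_sphere R n.+1).

Lemma whitney_subbase_open (V : set (smooth_sphere R n.+1)) : whitney_subbase V -> open V.
Proof.
move=> sV; exists [set W | W = V]; last first.
  by apply/seteqP; split => [x [W ->]//|x Vx]; exists V.
move=> _ ->; exists (finmap.fset1 V); first by move=> W; rewrite finmap.in_fset1 => /eqP ->; exact/mem_set.
apply/seteqP; split => [x /(_ V)|x Vx W /=]; first by apply; rewrite /= finmap.in_fset1.
by rewrite finmap.in_fset1 => /eqP ->.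
Qed.

Lemma whitney_open_finI (O : set (smooth_sphere R n.+1)) phi : open O -> O phi ->
  exists2 l : seq (set (smooth_sphere R n.+1)),
    (forall V, V \in l -> whitney_subbase V /\ V phi) &
    forall psi, (forall V, V \in l -> V psi) -> O psi.
Proof.
move=> [D' sD <-] [W D'W Wphi]; have [D sDD E] := sD _ D'W.
exists (finmap.enum_fset D).
  move=> V VD; split; first by have := sDD V VD; exact: set_mem.
  by move: Wphi; rewrite -E => /(_ V VD).
by move=> psi H; exists W => //; rewrite -E.
Qed.

Lemma sphere_ext0_linear (f g : sphere R n.+1 -> R) (c : R) x :
  sphere_ext0 (fun u => f u + c * g u) x = sphere_ext0 f x + c * sphere_ext0 g x.
Proof. by rewrite /sphere_ext0; case: insub => // ; rewrite mulr0 addr0. Qed.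

Lemma local_rep_linear j b (f g : sphere R n.+1 -> R) (c : R) :
  local_rep j b (fun u => f u + c * g u) =
  (fun y => local_rep j b f y + c * local_rep j b g y).
Proof. by apply/funext => y; exact: sphere_ext0_linear. Qed.

Lemma smooth_perturb phi psi (c : R) j b :
  smooth_on (open_disk R n) (local_rep j b (fun u => phi u + c * psi u)).
Proof.
have oD := @open_open_disk R n.
rewrite local_rep_linear.
exact (smooth_onD oD (smooth_sphereP phi j b)
  (smooth_onM oD (smooth_on_cst c oD) (smooth_sphereP psi j b))).
Qed.

Definition perturb phi psi (c : R) : smooth_sphere R n.+1 :=
  SmoothSphere (smooth_perturb phi psi c).

(** The subbasic set may be centred at another function [f], so the margin is taken from the strict
    inequalities that [phi] satisfies on [K], for the finitely many words of length at most [r]. *)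
Lemma near_perturb phi psi (V : set (smooth_sphere R n.+1)) : whitney_subbase V -> V phi ->
  nbhs (0 : R) (fun c => V (perturb phi psi c)).
Proof.
move=> [f [j [b [K [r [e [cK KD e0 ->]]]]]]] Vphi.
have oD := @open_open_disk R n.
have H s : nbhs (0 : R) (fun c => (size s <= r)%N -> forall y, K y ->
    `|pderivs s (local_rep j b phi) y - pderivs s (local_rep j b f) y +
       c * pderivs s (local_rep j b psi) y| < e).
  have [sr|sr] := boolP (size s <= r)%N; last first.
    by apply: filterS (@filterT _ (nbhs (0 : R)) _).
  have sg (g : smooth_sphere R n.+1) := smooth_on_pderivs s (smooth_sphereP g j b).
  have := near_compact_lt cK KD (smooth_onB oD (sg phi) (sg f)) (sg psi) (fun y Ky => Vphi s y sr Ky).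
  by apply: filterS => c Hc _ y Ky; exact: Hc.
apply: filterS (near_words r H) => c Hc s y sr Ky /=.
rewrite local_rep_linear (pderivs_linear c s oD (smooth_sphereP phi j b) (smooth_sphereP psi j b) (KD _ Ky)).
by rewrite addrAC; exact: Hc.
Qed.

Lemma bordered_rep_perturb phi psi (c : R) :
  bordered_rep (perturb phi psi c) = bordered_rep phi + c *: bordered_rep psi.
Proof.
have E s : pderivs s (local_rep ord0 false (perturb phi psi c)) 0 =
   pderivs s (local_rep ord0 false phi) 0 + c * pderivs s (local_rep ord0 false psi) 0.
  rewrite local_rep_linear.
  exact: (pderivs_linear c s (@open_open_disk R n) (smooth_sphereP phi _ _) (smooth_sphereP psi _ _) (@open_disk0 R n)).
apply/matrixP => j i; rewrite !mxE.
case: unliftP => [l _|_]; case: unliftP => [k _|_].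
- exact: (E [:: l; k]).
- by have := E [:: l] => /= ->; rewrite opprD mulrN.
- by have := E [:: k] => /= ->; rewrite opprD mulrN.
- by rewrite mulr0 addr0.
Qed.

Lemma open_bordered_unit : open [set phi : smooth_sphere R n.+1 | bordered_rep phi \in unitmx].
Proof.
rewrite openE => phi /= uphi.
have [c0 c00 Hc0] := unitmx_lower_bound uphi.
(* The matrix has n + 1 rows, so entrywise errors up to e move a coordinate of v M by at most
   (n+1)/(n+2) c0 |v|, strictly less than the lower bound c0 |v|. *)
pose e := c0 / n.+2%:R.
have e0 : 0 < e by rewrite divr_gt0.
pose V := whitney_subbasic phi ord0 false [set 0] 2 e.
have oV : open V.
  apply: whitney_subbase_open; exists phi, ord0, false, [set 0], 2%N, e; split => //.
    exact: compact_set1.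
  by move=> _ ->; exact: open_disk0.
have Vphi : V phi by move=> s y _ _; rewrite subrr normr0.
have : nbhs phi V by exact: open_nbhs_nbhs.
apply: filterS => psi Vpsi.
have close j i : `|bordered_rep psi j i - bordered_rep phi j i| <= e.
  rewrite mxE [X in _ - X]mxE.
  case: unliftP => [l _|_]; case: unliftP => [k _|_].
  - exact/ltW/(Vpsi [:: l; k] 0).
  - by rewrite -opprD normrN; exact/ltW/(Vpsi [:: l] 0).
  - by rewrite -opprD normrN; exact/ltW/(Vpsi [:: k] 0).
  - by rewrite subrr normr0 ltW.
apply: unitmx_inj => v vM; apply/eqP; apply: contraT => v0.
have [i0] := Hc0 v v0.
have -> : (v *m bordered_rep phi) 0 i0 =
    \sum_k v 0 k * (bordered_rep phi k i0 - bordered_rep psi k i0).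
  have Z : (v *m bordered_rep psi) 0 i0 = 0 by rewrite vM mxE.
  rewrite -[LHS]subr0 -[X in _ - X = _]Z [X in X - _]mxE [X in _ - X]mxE -sumrB.
  by apply: eq_bigr => k _; rewrite mulrBr.
have vn : 0 < `|v| by rewrite normr_gt0.
move=> /le_trans/(_ (ler_norm_sum _ _ _)) H.
have : c0 * `|v| <= `|v| * e * n.+1%:R.
  apply: (le_trans H); apply: (@le_trans _ _ (\sum_(k < n.+1) `|v| * e)); last first.
    by rewrite sumr_const card_ord mulr_natr.
  by apply: ler_sum => k _; rewrite normrM ler_pM ?rV_norm_coord// distrC.
rewrite mulrC -mulrA ler_pM2l// /e mulrAC ler_pdivlMr// ler_pM2l// ler_nat.
by rewrite ltnn.
Qed.

Lemma smooth_on_hemisphere (j : 'I_n.+1) (b : bool) i :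
  smooth_on (open_disk R n) (fun y => hemisphere j b y 0 i).
Proof.
have oD := @open_open_disk R n.
have d0 (y : 'rV[R]_n) : open_disk R n y -> 0 < 1 - dotp y y.
  by rewrite /open_disk /= /enorm -[X in _ < X]sqrtr1 ltr_sqrt// subr_gt0.
have [k E|E] := unliftP j i.
  apply: (smooth_on_ext oD _ (@smooth_on_coord _ _ (open_disk R n) k oD)) => y _.
  by rewrite mxE E liftK.
have := smooth_onM oD (smooth_on_cst ((-1) ^+ b) oD)
  (smooth_on_powR 2^-1 oD d0 (smooth_onB oD (smooth_on_cst 1 oD) (smooth_on_dotpp oD))).
apply: (smooth_on_ext oD) => y Dy.
by rewrite mxE E unlift_none powR12_sqrt// ltW// d0.
Qed.

Lemma local_rep_val (P : 'rV[R]_n.+1 -> R) j b (y : 'rV[R]_n) : open_disk R n y ->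
  local_rep j b (fun u : sphere R n.+1 => P (\val u)) y = P (hemisphere j b y).
Proof.
move=> Dy; rewrite /local_rep /sphere_ext0; case: insubP => [u _ ->//|].
by rewrite enorm_hemisphere ?eqxx.
Qed.

Lemma smooth_restriction (P : 'rV[R]_n.+1 -> R) : smooth_on setT P -> forall j b,
  smooth_on (open_disk R n) (local_rep j b (fun u : sphere R n.+1 => P (\val u))).
Proof.
move=> sP j b; have oD := @open_open_disk R n.
have := smooth_on_compose oD openT (fun y _ => I) (@smooth_on_hemisphere j b) sP.
by apply: (smooth_on_ext oD) => y Dy; rewrite local_rep_val.
Qed.

End whitney.

(** * Density of the nondegenerate functions *)

Section density.
Context {R : realType} {n : nat}.
Local Notation e_ i := (delta_mx 0 i).

(* In the chart [ord0, false] this is y |-> y_0 + |y|^2 / 2, whose gradient and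
   Hessian at the origin are the first basis vector and the identity. *)
Definition model (x : 'rV[R]_n.+2) : R :=
  x 0 (lift ord0 ord0) + 2^-1 * \sum_k (x 0 (lift ord0 k) * x 0 (lift ord0 k)).

Lemma smooth_model : smooth_on setT model.
Proof.
have oT := @openT 'rV[R]_n.+2.
apply: (smooth_onD oT (@smooth_on_coord _ _ setT (lift ord0 ord0) oT)).
apply: (smooth_onM oT (smooth_on_cst 2^-1 oT)).
apply: smooth_on_sum => // k.
exact (smooth_onM oT (@smooth_on_coord _ _ setT (lift ord0 k) oT) (@smooth_on_coord _ _ setT (lift ord0 k) oT)).
Qed.

Definition sphere_model : smooth_sphere R n.+2 := SmoothSphere (smooth_restriction smooth_model).

Lemma bordered_rep_model : bordered_rep sphere_model =
  bordered (fun k : 'I_n.+1 => (k == ord0)%:R) (fun l k => (l == k)%:R).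
Proof.
pose Q (y : 'rV[R]_n.+1) := y 0 ord0 + 2^-1 * dotp y y.
have QE y : open_disk R n.+1 y -> local_rep ord0 false sphere_model y = Q y.
  move=> Dy; rewrite local_rep_val// /model /Q mxE liftK; congr (_ + _ * _).
  by apply: eq_bigr => k _; rewrite mxE liftK.
have E s : pderivs s (local_rep ord0 false sphere_model) 0 = pderivs s Q 0.
  exact: pderivs_ext (@open_open_disk R n.+1) QE (@open_disk0 R n.+1).
have D1 k : 'D_(e_ k) Q = (fun y : 'rV[R]_n.+1 => (k == ord0)%:R + y 0 k).
  apply/funext => y.
  have d := is_deriveD (is_derive_coord ord0 y (e_ k))
    (@is_deriveZ _ _ _ _ (2^-1 : R) _ _ _ (is_derive_dotpp y (e_ k))).
  rewrite [LHS](@derive_val _ _ _ _ _ _ _ d) dotp_delta mxE eqxx eq_sym; congr (_ + _).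
  by rewrite /GRing.scale /= mulrA mulVf ?mul1r.
have D2 l k : 'D_(e_ l) ('D_(e_ k) Q) 0 = (l == k)%:R.
  rewrite D1.
  have d := is_deriveD (is_derive_cst ((k == ord0)%:R : R) (0 : 'rV[R]_n.+1) (e_ l))
    (is_derive_coord k (0 : 'rV[R]_n.+1) (e_ l)).
  by rewrite [LHS](@derive_val _ _ _ _ _ _ _ d) add0r mxE eqxx eq_sym.
have D1' k : pderivs [:: k] Q 0 = (k == ord0)%:R.
  by apply: eq_trans (congr1 (fun f : 'rV[R]_n.+1 -> R => f 0) (D1 k)) _; rewrite /= mxE addr0.
rewrite /bordered_rep; apply/matrixP => j i.
rewrite [LHS]mxE [RHS]mxE.
case: unliftP => [l _|_]; case: unliftP => [k _|_] //.
- by rewrite E; exact: D2.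
- by congr (- _); exact: eq_trans (E _) (D1' _).
- by congr (- _); exact: eq_trans (E _) (D1' _).
Qed.

(** With the identity as tangential block the determinant is - |g|^2, nonzero for the gradient of
    the model. The proof reads v M = 0 by columns: column 0 gives v_1 = 0, the others give v_(k+1) =
    v_0 for k = 0 and 0 for the remaining k. *)
Lemma bordered_model_unit : bordered_rep sphere_model \in unitmx.
Proof.
rewrite bordered_rep_model; apply: unitmx_inj => v vM.
have col0 : v 0 (lift ord0 ord0) = 0.
  have := congr1 (fun w : 'rV_n.+2 => w 0 ord0) vM.
  rewrite /= mxE [RHS]mxE big_ord_recl mxE unlift_none mulr0 add0r big_ord_recl.
  rewrite mxE liftK unlift_none eqxx big1 ?addr0 ?mulrN1 => [/eqP|k _].
    by rewrite oppr_eq0 => /eqP.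
  by rewrite mxE liftK unlift_none /= oppr0 mulr0.
have col k : v 0 (lift ord0 k) = v 0 ord0 * (k == ord0)%:R.
  have := congr1 (fun w : 'rV_n.+2 => w 0 (lift ord0 k)) vM.
  rewrite /= mxE [RHS]mxE big_ord_recl mxE liftK unlift_none (bigD1 k)//=.
  rewrite mxE !liftK eqxx mulr1 big1 ?addr0 => [/eqP|l lk].
    by rewrite mulrN addrC subr_eq0 => /eqP.
  by rewrite mxE !liftK (negbTE lk) mulr0.
have v0 : v 0 ord0 = 0 by have := col ord0; rewrite col0 eqxx mulr1.
apply/rowP => i; rewrite mxE; case: (unliftP ord0 i) => [k ->|->//].
by rewrite col v0 mul0r.
Qed.

Lemma dense_bordered_unit : dense [set phi : smooth_sphere R n.+2 | bordered_rep phi \in unitmx].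
Proof.
move=> O [phi Ophi] oO.
have [l lphi lO] := whitney_open_finI oO Ophi.
have : nbhs (0 : R) (fun c => forall V, V \in l -> V (perturb phi sphere_model c)).
  by apply: near_seq => V Vl; have [sV Vphi] := lphi V Vl; exact: near_perturb.
move=> /nbhs_ballP[d /= d0 Hd].
have [c cd uc] := unitmx_perturb (bordered_rep phi) bordered_model_unit d0.
rewrite -bordered_rep_perturb in uc.
exists (perturb phi sphere_model c); split; last exact uc.
by apply: lO => V Vl; apply: Hd Vl; rewrite -ball_normE /ball_ /= sub0r normrN.
Qed.

End density.

Theorem theorem2 (R : realType) (d : nat) (hd : (2 <= d)%N) (p : R) (hp : 1 < p) :
  (d = 2%N ->
   forall Phi : 'rV[R]_d -> R,
     smooth_on [set xi : 'rV[R]_d | xi != 0] Phi ->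
     homogeneous0 Phi ->
     nonconstant Phi ->
     exists c : R, 0 < c /\
       forall t : R,
         ((c * jbracket t `^ (2 * `|2^-1 - p^-1|))%:E <=
            multiplier_norm p Phi t)%E)
  /\
  ((3 <= d)%N ->
   exists G : set (smooth_sphere R d),
     open G /\ dense G /\
     forall phi : smooth_sphere R d, G phi ->
       exists c : R, 0 < c /\
         forall t : R,
           ((c * jbracket t `^ (d%:R * `|2^-1 - p^-1|))%:E <=
              multiplier_norm p (homogeneous_ext phi) t)%E).
Proof.
split=> [d2|d3]; [subst d|case: d hd d3 => [|[|n]]// _ _].
  move=> Phi sP hP /(nonconstant_grad sP)[xi [i [xi0 gi]]].
  have := multiplier_lower_bound hp (@open_punctured R 2) xi0 sP (hessian_plane_unit sP hP xi0 gi).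
  by [].
exists [set phi : smooth_sphere R n.+2 | bordered_rep phi \in unitmx].
split; first exact: open_bordered_unit.
split; first exact: dense_bordered_unit.
move=> phi uphi.
have {}uphi : hessian (homogeneous_ext phi) (delta_mx 0 ord0) \in unitmx.
  by rewrite hessian_homogeneous_ext.
exact (multiplier_lower_bound hp (@open_halfspace R n.+1) (@halfspace_e0 R n.+1)
  (smooth_on_homogeneous_ext phi) uphi).
Qed.
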